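(* Let $r_0>0$ and let $v=(v_1,v_2)$ be a smooth solution (with some scalar pressure $p$) of the stationary Navier--Stokes equations $$-\Delta v+(v\cdot\nabla)v+\nabla p=0,\qquad \operatorname{div} v=0$$ in $B_{r_0}^c=\{x\in\mathbb{R}^2: |x|>r_0\}$. Suppose that for some $q\in(2,\infty)$ $$\int_{|x|>r_0}|\nabla v(x)|^q\,dx<\infty .$$ Let $\omega=\partial_{x_1}v_2-\partial_{x_2}v_1$. Then, in polar coordinates $(r,\theta)$, $$|\omega(r,\theta)|=o\big(r^{-(1/q+1/q^2)}\big)\quad\text{and}\quad |\nabla v(r,\theta)|=o\big(r^{-(1/q+1/q^2)}\log r\big)\qquad (r\to\infty),$$ uniformly in $\theta\in[0,2\pi]$.
   Context: Here $(r,\theta)$ are polar coordinates on $\mathbb{R}^2$, $r=|x|$, and $f(r,\theta)$ denotes the value of $f$ at $x=(r\cos\theta,r\sin\theta)$. The velocity $v$ takes values in $\mathbb{R}^2$ and the pressure $p$ is real-valued. No boundary condition is imposed on $|x|=r_0$. *)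

(* Defs.v *)
(* Points and vectors of the plane are pairs in R * R. *)
From mathcomp Require Import all_boot all_order all_algebra.
From mathcomp Require Import all_classical all_reals all_analysis.
Set Implicit Arguments.
Unset Strict Implicit.
Unset Printing Implicit Defensive.
Import Order.TTheory GRing.Theory Num.Theory.
Import numFieldNormedType.Exports.
Local Open Scope classical_set_scope.
Local Open Scope ring_scope.

Section Plane.
Context {R : realType}.
Implicit Types (f g p : R * R -> R) (v : R * R -> R * R) (x : R * R).

(* The library norm on R * R is the sup norm, hence this separate definition. *)
Definition enorm x : R := Num.sqrt (x.1 ^+ 2 + x.2 ^+ 2).

Definition exterior (r0 : R) : set (R * R) := [set x | r0 < enorm x].

Definition e1 : R * R := (1, 0).
Definition e2 : R * R := (0, 1).

Definition d1 f : R * R -> R := 'D_e1 f.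
Definition d2 f : R * R -> R := 'D_e2 f.

(* Meaningful for open U.  The operators 'D_e are total, so existence of the
   partial derivatives has to be required explicitly. *)
Fixpoint Ck_on (k : nat) (U : set (R * R)) f : Prop :=
  match k with
  | 0 => forall x, U x -> {for x, continuous f}
  | k'.+1 => [/\ forall x, U x -> derivable f x e1 /\ derivable f x e2,
                 Ck_on k' U (d1 f) & Ck_on k' U (d2 f)]
  end.

Definition smooth_on (U : set (R * R)) f : Prop := forall k, Ck_on k U f.

Definition laplacian f x : R := d1 (d1 f) x + d2 (d2 f) x.

Definition comp1 v : R * R -> R := fun x => (v x).1.
Definition comp2 v : R * R -> R := fun x => (v x).2.

Definition convection v f x : R := comp1 v x * d1 f x + comp2 v x * d2 f x.

Definition divergence v x : R := d1 (comp1 v) x + d2 (comp2 v) x.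

Definition vorticity v x : R := d1 (comp2 v) x - d2 (comp1 v) x.

Definition grad_norm v x : R :=
  Num.sqrt (d1 (comp1 v) x ^+ 2 + d2 (comp1 v) x ^+ 2
            + d1 (comp2 v) x ^+ 2 + d2 (comp2 v) x ^+ 2).

Record smooth_stationary_NS (U : set (R * R)) v p : Prop := {
  NS_smooth1 : smooth_on U (comp1 v);
  NS_smooth2 : smooth_on U (comp2 v);
  NS_smoothp : smooth_on U p;
  NS_momentum1 : forall x, U x ->
    - laplacian (comp1 v) x + convection v (comp1 v) x + d1 p x = 0;
  NS_momentum2 : forall x, U x ->
    - laplacian (comp2 v) x + convection v (comp2 v) x + d2 p x = 0;
  NS_div : forall x, U x -> divergence v x = 0
}.

Definition polar f (r theta : R) : R := f (r * cos theta, r * sin theta).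

(* F(r, theta) = o(g(r)) as r -> +oo, uniformly in theta in [0, 2 pi]. *)
Definition littleo_unif (F : R -> R -> R) (g : R -> R) : Prop :=
  forall eps : R, 0 < eps ->
    \forall r \near +oo, forall theta : R, 0 <= theta <= 2 * pi ->
      `|F r theta| <= eps * `|g r|.

End Plane.

(* Main.v *)
Require Import Defs.
From mathcomp Require Import all_boot all_order all_algebra.
From mathcomp Require Import all_classical all_reals all_analysis.
From mathcomp Require Import measurable_realfun ring lra.
Import Order.TTheory GRing.Theory Num.Theory.
Import numFieldNormedType.Exports.
Local Open Scope classical_set_scope.
Local Open Scope ring_scope.
Set Implicit Arguments.
Unset Strict Implicit.
Unset Printing Implicit Defensive.

(** Write om for the vorticity and beta = 1/q + 1/q^2.  Taking the curl of the
    momentum equation removes the pressure and leaves the scalar equation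
    lap om = v . grad om with div v = 0, and the divergence condition gives
    lap v = (- d2 om, d1 om).  Everything is read off at a point x far out, after
    rescaling the square of half-side of order |x| around x to unit size, where
    the drift becomes b = l v with l = |x| / 8.

    Velocity (velocity_growth).  By Young's inequality and the convergence of
    the integral of |grad v|^q, the mean of |grad v| over a distant square of
    half-side l is o(l^(-2/q)) (mean_small).  The derivative in t of a kernel
    mean of v over the square centred at P + t B with half-side t b is controlled
    by such a mean of |grad v|, so it is O(t^(-2/q)).  Integrating along a ray
    from a fixed annulus out to x, and then along squares shrinking to x, gives
    |v(x)| = O(|x|^(1 - 2/q)).  Hence |b| <= lam^2 with lam ~ |x|^(1 - 1/q).

    Vorticity (drift_sup, vorticity_decay).  The function
    W = (om^2 + del)^(q/2) satisfies lap W - b . grad W >= E, where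
    E ~ (om^2 + del)^(q/2 - 1) |grad om|^2.  Testing with a kernel and using
    div b = 0 gives int E <= C lam^2 int W, hence int |grad W| <= C lam int W by
    the arithmetic-geometric inequality: the size lam^2 of the drift costs one
    factor lam only.  By Fubini, for each side of the square, some line parallel to it and lying
    between it and the centre carries one-dimensional integrals of W and of its
    tangential derivative at most C lam int W, and so W <= C lam int W along it.  The
    four lines bound a rectangle around x, and the maximum principle carries
    the bound to x.  As int W = o(|x|^(-2)) in the rescaled variables,
    |om(x)|^q = o(|x|^(1 - 1/q - 2)) = o(|x|^(- beta q)).

    Gradient (log_gradient, velocity_gradient_decay).  The kernel mean of a
    derivative of v, as a function of the scale t, interpolates between its value
    at x (t = 0) and a mean at unit scale, which mean_small controls.  The
    derivative in t is a mean of grad om; one more integration by parts makes it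
    O(sup |om| / t), and integration over d <= t <= 1 produces log (1 / d).  For
    t <= d, in rescaled units, one uses instead the crude bound
    |grad om| = O(|x|^(1 - beta)) (drift_gradient), which is harmless when
    d = |x|^(-2); the only loss is the logarithm of |x|. *)

(** * Differential calculus in the plane *)

Section Calculus.
Context {R : realType}.
Implicit Types (f g : R * R -> R) (x y z k : R * R) (U : set (R * R)) (b c : bool).

(** The two coordinates are indexed by a boolean (true for the first), so that one
    statement covers both partial derivatives and ~~ b is the other coordinate. *)
Definition ev b : R * R := if b then e1 else e2.
Definition co b x : R := if b then x.1 else x.2.
Definition D b f : R * R -> R := 'D_(ev b) f.

Lemma d1E f : d1 f = D true f. Proof. by []. Qed.
Lemma d2E f : d2 f = D false f. Proof. by []. Qed.

Definition cont_on U f := forall x, U x -> {for x, continuous f}.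

Lemma cont_eps f x (e : R) : {for x, continuous f} -> 0 < e ->
  exists2 d : R, 0 < d & forall z, `|z - x| <= d -> `|f z - f x| <= e.
Proof.
move=> cf e0.
have /cvgrPdist_le /(_ e e0) /nbhs_normP[d /= d0 dP] := cf.
exists (d / 2); first by rewrite divr_gt0.
move=> z zx; rewrite distrC; apply: dP => /=.
by rewrite /ball_/= distrC (le_lt_trans zx)// ltr_pdivrMr// ltr_pMr// ltr1n.
Qed.

Lemma open_eps U x : open U -> U x ->
  exists2 d : R, 0 < d & forall z, `|z - x| <= d -> U z.
Proof.
move=> oU Ux.
have /nbhs_normP[d /= d0 dP] : nbhs x U by exact: open_nbhs_nbhs.
exists (d / 2); first by rewrite divr_gt0.
move=> z zx; apply: dP => /=.
by rewrite /ball_/= distrC (le_lt_trans zx)// ltr_pdivrMr// ltr_pMr// ltr1n.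
Qed.

Lemma smooth_cont U f : smooth_on U f -> cont_on U f.
Proof. by move=> /(_ 0%N). Qed.

Lemma smooth_D b U f : smooth_on U f -> smooth_on U (D b f).
Proof. by case: b => H n; have [] := H n.+1. Qed.

Lemma smooth_derive b U f x : smooth_on U f -> U x ->
  is_derive x (ev b) f (D b f x).
Proof.
move=> /(_ 1%N)[H _ _] /H[H1 H2].
by case: b; split; [exact: H1|reflexivity|exact: H2|reflexivity].
Qed.

Lemma D_eq b U f g x : open U -> (forall z, U z -> f z = g z) -> U x ->
  D b f x = D b g x.
Proof.
move=> oU fg Ux; apply: near_eq_derive.
have : nbhs x U by exact: open_nbhs_nbhs.
by apply: filterS => z /fg.
Qed.

(** Coinduction for smoothness: a class of continuous functions that is stable
    under partial derivatives, up to equality on U, consists of smooth functions.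
    The closure properties of smooth_on below rest on it. *)
Lemma smooth_coind U (P : (R * R -> R) -> Prop) f : open U ->
  (forall g, P g -> cont_on U g) ->
  (forall g b, P g -> exists2 dg, P dg &
     forall x, U x -> is_derive x (ev b) g (dg x)) ->
  P f -> smooth_on U f.
Proof.
move=> oU Pc Pd Pf n.
suff : forall g, (exists2 h, P h & forall z, U z -> h z = g z) -> Ck_on n U g.
  by apply; exists f.
elim: n => [|n IH] g [h Ph hg] /=.
  move=> x Ux; rewrite /prop_for /continuous_at -(hg _ Ux).
  apply: cvg_trans (Pc _ Ph x Ux); apply: near_eq_cvg.
  have : nbhs x U by exact: open_nbhs_nbhs.
  by apply: filterS => z /hg.
have dg b x dh : U x -> is_derive x (ev b) h dh -> is_derive x (ev b) g dh.
  move=> Ux; apply: near_eq_is_derive.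
  have : nbhs x U by exact: open_nbhs_nbhs.
  by apply: filterS => z /hg.
have [h1 Ph1 dh1] := Pd h true Ph.
have [h2 Ph2 dh2] := Pd h false Ph.
split.
- move=> x Ux; split.
    by case: (dg true x _ Ux (dh1 x Ux)).
  by case: (dg false x _ Ux (dh2 x Ux)).
- apply: IH; exists h1 => // x Ux; rewrite d1E.
  by case: (dg true x _ Ux (dh1 x Ux)) => _ <-.
- apply: IH; exists h2 => // x Ux; rewrite d2E.
  by case: (dg false x _ Ux (dh2 x Ux)) => _ <-.
Qed.

End Calculus.
Opaque D.

Section Lines.
Context {R : realType}.
Implicit Types (f g : R * R -> R) (x y z k : R * R) (U : set (R * R)) (b c : bool).

Lemma is_derive_line f (df : R) x k (t : R) :
  is_derive (x + t *: k) k f df -> is_derive t 1 (fun s => f (x + s *: k)) df.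
Proof.
have E : (fun h : R => h^-1 *: (f (x + (h *: 1 + t) *: k) - f (x + t *: k))) =
         (fun h : R => h^-1 *: (f (h *: k + (x + t *: k)) - f (x + t *: k))).
  apply/funext => h; congr (_ *: (f _ - _)).
  by rewrite scalerDl addrCA; congr (_ *: _ + _); rewrite /GRing.scale/= mulr1.
move=> [H1 H2]; apply: DeriveDef.
  by move: H1; rewrite /derivable -E.
by rewrite -H2 /derive -E.
Qed.

Lemma line_is_derive f (df : R) x k :
  is_derive (0 : R) 1 (fun s : R => f (x + s *: k)) df -> is_derive x k f df.
Proof.
have E : (fun h : R => h^-1 *: (f (x + (h *: 1 + 0) *: k) - f (x + (0:R) *: k))) =
         (fun h : R => h^-1 *: (f (h *: k + x) - f x)).
  apply/funext => h; congr (_ *: (f _ - f _)); last by rewrite scale0r addr0.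
  by rewrite addrC; congr (_ *: _ + _); rewrite addr0 /GRing.scale/= mulr1.
move=> [H1 H2]; apply: DeriveDef.
  by move: H1; rewrite /derivable E.
by rewrite -H2 /derive E.
Qed.

(** Mean value theorem along a line, with |s| <= |t| so that both signs of t are
    covered by one statement. *)
Lemma line_mvt f (df : R * R -> R) x k (t : R) :
  (forall s : R, `|s| <= `|t| -> is_derive (x + s *: k) k f (df (x + s *: k))) ->
  exists2 s : R, `|s| <= `|t| & f (x + t *: k) - f x = t * df (x + s *: k).
Proof.
move=> H.
pose p (s : R) := f (x + s *: k).
have dp (s : R) : `|s| <= `|t| -> is_derive s 1 p (df (x + s *: k)).
  by move=> /H; exact: is_derive_line.
have p0 : p 0 = f x by rewrite /p scale0r addr0.
rewrite -p0.
have cp (u v : R) : (forall s : R, u <= s <= v -> `|s| <= `|t|) ->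
    {within `[u, v], continuous p}.
  move=> uv; apply: derivable_within_continuous => s; rewrite in_itv/= => /uv/dp.
  by case.
have [t0|t0] := leP 0 t.
  have B (s : R) : 0 <= s <= t -> `|s| <= `|t| by move=> /andP[s0 st]; rewrite !ger0_norm.
  have [||s sin E] := @MVT_segment R p (fun s : R => df (x + s *: k)) 0 t t0.
  - by move=> s; rewrite in_itv/= => /andP[s0 st]; apply/dp/B; rewrite !ltW.
  - exact: cp.
  exists s; first by apply: B; rewrite in_itv/= in sin.
  by rewrite E subr0 mulrC.
have B (s : R) : t <= s <= 0 -> `|s| <= `|t|.
  by move=> /andP[st s0]; rewrite !ler0_norm// ?lerN2// ltW.
have [||s sin E] := @MVT_segment R p (fun s : R => df (x + s *: k)) t 0 (ltW t0).
- by move=> s; rewrite in_itv/= => /andP[s0 st]; apply/dp/B; rewrite !ltW.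
- exact: cp.
exists s; first by apply: B; rewrite in_itv/= in sin.
by apply: oppr_inj; rewrite opprB E sub0r mulrN mulrC.
Qed.

Lemma norm_scale_ev b (s : R) : `|s *: ev b| = `|s|.
Proof.
rewrite normrZ (_ : `|ev b| = 1) ?mulr1//.
case: b; rewrite prod_normE /ev /e1 /e2 /= normr0 normr1.
  exact: (max_l ler01).
exact: (max_r ler01).
Qed.

Lemma pt_split x k (h : R) :
  x + h *: k = (x + (h * k.2) *: ev false) + (h * k.1) *: ev true.
Proof.
case: x k => [x1 x2] [k1 k2] /=; rewrite /ev /e1 /e2.
apply: injective_projections; rewrite /= /GRing.scale/= ?mulr0 ?mulr1 ?addr0//.
Qed.

Lemma le_lincomb (e k1 k2 a a' b b' : R) : 0 <= e ->
  let M := `|k1| + `|k2| + 1 in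
  `|a - a'| <= e / M -> `|b - b'| <= e / M ->
  `|k1 * a' + k2 * b' - (k1 * a + k2 * b)| <= e.
Proof.
move=> e0 M ha hb.
have M0 : 0 < M by rewrite ltr_wpDl// addr_ge0.
have -> : k1 * a' + k2 * b' - (k1 * a + k2 * b) = - (k1 * (a - a') + k2 * (b - b')).
  ring.
rewrite normrN (le_trans (ler_normD _ _))// !normrM.
apply: (@le_trans _ _ ((`|k1| + `|k2|) * (e / M))).
  by rewrite mulrDl; apply: lerD; apply: ler_wpM2l.
rewrite mulrA ler_pdivrMr// mulrC ler_wpM2l// /M.
by rewrite lerDl.
Qed.

(** Chain rule along an arbitrary direction.  Only partial derivatives are given
    by smoothness; an increment along k is split into two coordinate steps, each
    treated by the mean value theorem, and continuity of the partial derivatives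
    concludes. *)
Lemma smooth_dir U f x k : open U -> smooth_on U f -> U x ->
  is_derive x k f (k.1 * D true f x + k.2 * D false f x).
Proof.
move=> oU sf Ux.
set L := _ + _.
suff H : (fun h : R => h^-1 *: (f (h *: k + x) - f x)) @ 0^' --> L.
  apply: DeriveDef; first by apply/cvg_ex; exists L.
  exact: (cvg_lim _ H).
apply/cvgrPdist_le => e e0.
pose M := `|k.1| + `|k.2| + 1.
have M0 : 0 < M by rewrite ltr_wpDl// addr_ge0.
have eM : 0 < e / M by rewrite divr_gt0.
have [d0 d00 Ud0] := open_eps oU Ux.
have [dt dt0 Ht] := cont_eps (smooth_cont (smooth_D true sf) Ux) eM.
have [df df0 Hf] := cont_eps (smooth_cont (smooth_D false sf) Ux) eM.
pose d := Num.min d0 (Num.min dt df).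
have dgt0 : 0 < d by rewrite !lt_min d00 dt0 df0.
have [dd0 ddt ddf] : [/\ d <= d0, d <= dt & d <= df].
  by rewrite !ge_min !lexx !orbT.
near=> h.
have h0 : h != 0 by near: h; exact: nbhs_dnbhs_neq.
have hM : `|h| * M <= d.
  rewrite -ler_pdivlMr//; near: h.
  by apply: (@dnbhs0_le R R); exact: divr_gt0.
have hk1 : `|h * k.1| <= `|h| * M.
  by rewrite normrM ler_wpM2l// /M -addrA lerDl addr_ge0.
have hk2 : `|h * k.2| <= `|h| * M.
  by rewrite normrM ler_wpM2l// /M addrAC lerDr addr_ge0.
have hk12 : `|h * k.1| + `|h * k.2| <= `|h| * M.
  by rewrite !normrM -mulrDr ler_wpM2l// /M lerDl.
rewrite (addrC _ x) pt_split.
set z := x + (h * k.2) *: ev false.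
have zx : `|z - x| <= `|h * k.2| by rewrite addrAC subrr add0r norm_scale_ev.
have B1 (s : R) : `|s| <= `|h * k.1| -> `|z + s *: ev true - x| <= d.
  move=> sh; rewrite addrAC (le_trans (ler_normD _ _))// norm_scale_ev.
  apply: le_trans hM; apply: le_trans hk12.
  by rewrite [leRHS]addrC; apply: lerD.
have B2 (s : R) : `|s| <= `|h * k.2| -> `|x + s *: ev false - x| <= d.
  move=> sh; rewrite addrAC subrr add0r norm_scale_ev.
  exact: le_trans (le_trans sh hk2) hM.
have [|s1 s1h E1] := @line_mvt f (D true f) z (ev true) (h * k.1).
  move=> s /B1 sd; apply: smooth_derive sf _; apply: Ud0; exact: le_trans dd0.
have [|s2 s2h E2] := @line_mvt f (D false f) x (ev false) (h * k.2).
  move=> s /B2 sd; apply: smooth_derive sf _; apply: Ud0; exact: le_trans dd0.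
have -> : f (z + (h * k.1) *: ev true) - f x =
    h * (k.1 * D true f (z + s1 *: ev true) + k.2 * D false f (x + s2 *: ev false)).
  rewrite mulrDr !mulrA -E1 -E2 /z; ring.
rewrite /GRing.scale/= mulKf// /L.
move: (Ht _ (le_trans (B1 _ s1h) ddt)) (Hf _ (le_trans (B2 _ s2h) ddf)).
move: (D true f _) (D true f _) (D false f _) (D false f _) => p1 p2 p3 p4.
exact: (le_lincomb (ltW e0)).
Unshelve. all: by end_near. Qed.

Lemma is_derive_shift f (df : R) x k a :
  is_derive (x + a) k f df -> is_derive x k (fun z => f (z + a)) df.
Proof.
have E : (fun h : R => h^-1 *: (f (h *: k + x + a) - f (x + a))) =
         (fun h : R => h^-1 *: (f (h *: k + (x + a)) - f (x + a))).
  by apply/funext => h; rewrite addrA.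
move=> [H1 H2]; apply: DeriveDef.
  by move: H1; rewrite /derivable -E.
by rewrite -H2 /derive -E.
Qed.

(** Both mixed partial derivatives are limits of the same second difference; this
    is what schwarz rests on. *)
Lemma second_difference b c U f x (h d : R) : smooth_on U f ->
  0 < h -> 2 * h <= d -> (forall z, `|z - x| <= d -> U z) ->
  exists2 z, `|z - x| <= 2 * h &
    f (x + h *: ev b + h *: ev c) - f (x + h *: ev b) -
     (f (x + h *: ev c) - f x) = h * (h * D c (D b f) z).
Proof.
move=> sf h0 hd UP.
have nh : `|h| = h by rewrite gtr0_norm.
pose g z := f (z + h *: ev c) - f z.
have B (s1 s2 : R) : `|s1| <= `|h| -> `|s2| <= `|h| ->
    `|x + s1 *: ev b + s2 *: ev c - x| <= 2 * h.
  move=> H1 H2; rewrite -[x + _ + _]addrA [x + _]addrC addrK.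
  rewrite (le_trans (ler_normD _ _))// !norm_scale_ev mulrDl mul1r.
  by rewrite -nh lerD.
have B1 (s1 s2 : R) : `|s1| <= `|h| -> `|s2| <= `|h| -> U (x + s1 *: ev b + s2 *: ev c).
  by move=> H1 H2; apply: UP; apply: le_trans hd; exact: B.
have [|s1 s1h E1] := @line_mvt g (fun z => D b f (z + h *: ev c) - D b f z) x (ev b) h.
  move=> s sh; apply: is_deriveB.
    apply: is_derive_shift; apply: smooth_derive sf _; exact: B1.
  apply: smooth_derive sf _.
  by have := B1 s 0 sh; rewrite normr0 scale0r addr0; apply.
have [|s2 s2h E2] := @line_mvt (D b f) (D c (D b f)) (x + s1 *: ev b) (ev c) h.
  move=> s sh; apply: smooth_derive (smooth_D b sf) _; exact: B1.
exists (x + s1 *: ev b + s2 *: ev c); first exact: B.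
by rewrite -E2 -E1 /g.
Qed.

Lemma schwarz b c U f x : open U -> smooth_on U f -> U x ->
  D b (D c f) x = D c (D b f) x.
Proof.
move=> oU sf Ux; apply/eqP; rewrite -subr_eq0 -normr_le0.
apply/ler_addgt0Pl => e e0; rewrite addr0.
have e20 : 0 < e / 2 by rewrite divr_gt0.
have [d0 d00 Ud0] := open_eps oU Ux.
have [d1 d10 H1] := cont_eps (smooth_cont (smooth_D b (smooth_D c sf)) Ux) e20.
have [d2 d20 H2] := cont_eps (smooth_cont (smooth_D c (smooth_D b sf)) Ux) e20.
pose d := Num.min d0 (Num.min d1 d2).
have dgt0 : 0 < d by rewrite !lt_min d00 d10 d20.
have [dd0 dd1 dd2] : [/\ d <= d0, d <= d1 & d <= d2].
  by rewrite !ge_min !lexx !orbT.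
pose h := d / 2.
have h0 : 0 < h by rewrite divr_gt0.
have hd : 2 * h <= d by rewrite /h mulrC divfK.
have [z1 z1x E1] := second_difference b c sf h0 (le_trans hd dd0) Ud0.
have [z2 z2x E2] := second_difference c b sf h0 (le_trans hd dd0) Ud0.
have E : D c (D b f) z1 = D b (D c f) z2.
  have hn : h != 0 by rewrite gt_eqF.
  move: E1 E2; rewrite (addrAC x (h *: ev c)).
  move: (D c _ z1) (D b _ z2) (f _) (f _) (f _) (f _) => D1 D2 p1 p2 p3 p4.
  clear - hn => E1 E2; apply: (mulfI hn); apply: (mulfI hn).
  by rewrite -E1 -E2; ring.
have := H1 _ (le_trans z2x (le_trans hd dd1)).
have := H2 _ (le_trans z1x (le_trans hd dd2)).
rewrite E; move: (D b _ z2) (D c _ x) (D b _ x) => p1 p2 p3; clear.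
by rewrite !ler_norml => /andP[? ?] /andP[? ?]; apply/andP; split; lra.
Qed.

Lemma smooth_eq U f g : open U -> (forall z, U z -> f z = g z) ->
  smooth_on U f -> smooth_on U g.
Proof.
move=> oU fg sf.
apply: (@smooth_coind R U (fun g => exists2 f, smooth_on U f &
  forall z, U z -> f z = g z)) => //; last by exists f.
  move=> {f g fg sf} g [f sf fg] x Ux.
  rewrite /prop_for /continuous_at -(fg _ Ux).
  apply: cvg_trans (smooth_cont sf Ux); apply: near_eq_cvg.
  have : nbhs x U by exact: open_nbhs_nbhs.
  by apply: filterS => z /fg.
move=> {f g fg sf} g b [f sf fg]; exists (D b f).
  by exists (D b f) => //; exact: smooth_D.
move=> x Ux; apply: near_eq_is_derive (smooth_derive b sf Ux).
have : nbhs x U by exact: open_nbhs_nbhs.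
by apply: filterS => z /fg.
Qed.

Lemma smooth_lin U f g (a a' : R) : open U -> smooth_on U f -> smooth_on U g ->
  smooth_on U (fun x => a * f x + a' * g x).
Proof.
move=> oU sf sg.
apply: (@smooth_coind R U (fun h => exists f g, [/\ smooth_on U f, smooth_on U g &
  h = fun x => a * f x + a' * g x])) => //; last by exists f, g.
  move=> {f g sf sg} _ [f [g [sf sg ->]]] x Ux.
  apply: cvgD; apply: cvgMr; [exact: (smooth_cont sf Ux)|exact: (smooth_cont sg Ux)].
move=> {f g sf sg} _ b [f [g [sf sg ->]]].
exists (fun x => a * D b f x + a' * D b g x).
  by exists (D b f), (D b g); split => //; exact: smooth_D.
move=> x Ux; have df := smooth_derive b sf Ux; have dg := smooth_derive b sg Ux.
exact: is_deriveD (is_deriveZ a df) (is_deriveZ a' dg).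
Qed.

Lemma D_lin b U f g (a a' : R) x : smooth_on U f -> smooth_on U g -> U x ->
  D b (fun x => a * f x + a' * g x) x = a * D b f x + a' * D b g x.
Proof.
move=> sf sg Ux; have df := smooth_derive b sf Ux; have dg := smooth_derive b sg Ux.
by case: (is_deriveD (is_deriveZ a df) (is_deriveZ a' dg)).
Qed.

Lemma is_derive_aff f (df : R) x y k (l : R) :
  is_derive (x + l *: y) k f df ->
  is_derive y k (fun z => f (x + l *: z)) (l * df).
Proof.
move=> H; apply: line_is_derive.
have H0 : is_derive (l * 0 : R) 1 (fun s : R => f ((x + l *: y) + s *: k)) df.
  by apply: is_derive_line; rewrite mulr0 scale0r addr0.
have H1 : is_derive (0 : R) 1 (fun s : R => l * s) l.
  by have := is_deriveZ l (@is_derive_id R R 0 1); rewrite /GRing.scale/= mulr1.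
have := is_derive1_comp H0 H1; rewrite mulrC.
rewrite (_ : (_ \o _) = (fun s : R => f (x + l *: (y + s *: k))))//.
by apply/funext => s /=; rewrite scalerDr scalerA addrA.
Qed.

Lemma cont_aff f x y (l : R) : {for x + l *: y, continuous f} ->
  {for y, continuous (fun z => f (x + l *: z))}.
Proof.
move=> cf; apply: (@continuous_comp _ _ _ (fun z => x + l *: z) f) => //.
by apply: cvgD; [exact: cvg_cst|apply: cvgZr; exact: cvg_id].
Qed.

Lemma smooth_aff U V f x (l : R) : open U -> open V -> smooth_on U f ->
  (forall y, V y -> U (x + l *: y)) -> smooth_on V (fun y => f (x + l *: y)).
Proof.
move=> oU oV sf UV.
apply: (@smooth_coind R V (fun h => exists a f, smooth_on U f /\
  h = fun y => a * f (x + l *: y))) => //; last first.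
- by exists 1, f; split => //; apply/funext => y; rewrite mul1r.
- move=> {f sf} _ b [a [f [sf ->]]]; exists (fun y => a * (l * D b f (x + l *: y))).
    exists (a * l), (D b f); split; first exact: smooth_D.
    by apply/funext => y; rewrite mulrA.
  move=> y Vy; have := is_derive_aff (smooth_derive b sf (UV _ Vy)).
  exact: is_deriveZ.
- move=> {f sf} _ [c [f [sf ->]]] y Vy.
  by apply: cvgMr; apply: cont_aff; apply: smooth_cont sf _ _; exact: UV.
Qed.

Lemma D_aff b U f x y (l : R) : smooth_on U f -> U (x + l *: y) ->
  D b (fun y => f (x + l *: y)) y = l * D b f (x + l *: y).
Proof.
by move=> sf Uy; case: (is_derive_aff (smooth_derive b sf Uy)).
Qed.

End Lines.

(** * Integration on rectangles *)

Section BoxIntegral.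
Context {R : realType}.
Notation mu := (@lebesgue_measure R).
Notation mu2 := (mu \x mu)%E.
Implicit Types (F G : R * R -> R) (V : set (R * R)) (x y z : R * R) (a b c d : R).

(** An open set is the countable union of the rational open rectangles that it
    contains, hence measurable for the product sigma-algebra. *)
Lemma open_measurable2 V : open V -> measurable V.
Proof.
move=> oV.
pose B (i : rat * rat * (rat * rat)) : set (R * R) :=
  `]ratr i.1.1, ratr i.1.2[%classic `*` `]ratr i.2.1, ratr i.2.2[%classic.
pose G i := if pselect (B i `<=` V) then B i else set0.
have -> : V = \bigcup_i G i.
  apply/seteqP; split => [x Vx|x [i _]]; last first.
    by rewrite /G; case: pselect => // BV /BV.
  have [e e0 eV] := open_eps oV Vx.
  have lt1 (s : R) : s - e < s by rewrite ltrBlDr ltrDl.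
  have lt2 (s : R) : s < s + e by rewrite ltrDl.
  have [p1 /[!in_itv]/= /andP[p1l p1r]] := rat_in_itvoo (lt1 x.1).
  have [p2 /[!in_itv]/= /andP[p2l p2r]] := rat_in_itvoo (lt2 x.1).
  have [q1 /[!in_itv]/= /andP[q1l q1r]] := rat_in_itvoo (lt1 x.2).
  have [q2 /[!in_itv]/= /andP[q2l q2r]] := rat_in_itvoo (lt2 x.2).
  exists ((p1, p2), (q1, q2)) => //; rewrite /G; case: pselect => [BV|[]].
    by split; rewrite /= in_itv/= ?p1r ?q1r.
  move=> z [/=]; rewrite !in_itv/= => /andP[zp1 zp2] /andP[zq1 zq2].
  apply: eV; rewrite prod_normE/= ge_max !ler_norml.
  by apply/andP; split; apply/andP; split; lra.
apply: countable_bigcupT_measurable => // i; rewrite /G.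
by case: pselect => BV; [exact: measurableX|exact: measurable0].
Qed.

Lemma cont_measurable V F : open V -> cont_on V F -> measurable_fun V F.
Proof.
move=> oV cF; apply: (measurability _ (RGenOpens.measurableE R)).
move=> _ [_ [u [w ->] <-]]; apply: open_measurable2.
rewrite openE => x [Vx Fx]; apply: filterI; first exact: open_nbhs_nbhs.
by apply: (cF _ Vx); apply: open_nbhs_nbhs; split => //; exact: interval_open.
Qed.

Definition rect a b c d : set (R * R) := `[a, b]%classic `*` `[c, d]%classic.

Lemma rect_compact a b c d : compact (rect a b c d).
Proof. by apply: compact_setX; exact: segment_compact. Qed.

Lemma measurable_rect a b c d : measurable (rect a b c d).
Proof. exact: measurableX. Qed.

Lemma cont_within V F A : A `<=` V -> cont_on V F -> {within A, continuous F}.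
Proof.
move=> AV cF; apply: continuous_in_subspaceT => x /set_mem/AV; exact: cF.
Qed.

Lemma rect_integrable V F a b c d : open V -> rect a b c d `<=` V ->
  cont_on V F -> mu2.-integrable (rect a b c d) (EFin \o F).
Proof.
move=> oV RV cF; apply: measurable_bounded_integrable.
- exact: measurable_rect.
- rewrite [X in (X < _)%E](_ : _ = mu `[a, b]%classic * mu `[c, d]%classic)%E; last first.
    exact: product_measure1E.
  rewrite lte_mul_pinfty//.
    by rewrite ge0_fin_numE//; exact: compact_finite_measure (@segment_compact _ _ _).
  exact: compact_finite_measure (@segment_compact _ _ _).
- by apply: measurable_funS (cont_measurable oV cF) => //; exact: open_measurable2.
- have := continuous_compact (cont_within RV cF) (@rect_compact a b c d).
  move=> /compact_bounded[M [Mr MP]]; exists M; split => // N MN x Rx.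
  by apply: (MP _ MN); exists x.
Qed.

(** With box, this makes a single statement of both orders of integration. *)
Definition pt (e : bool) (s t : R) : R * R := if e then (s, t) else (t, s).

Definition box e a b c d := if e then rect a b c d else rect c d a b.

Lemma boxE e a b c d s t :
  box e a b c d (pt e s t) <-> (a <= s <= b /\ c <= t <= d).
Proof. by case: e; rewrite /box /rect /pt /= !in_itv/=; tauto. Qed.

Lemma cont_pt e V F (s t : R) : cont_on V F -> V (pt e s t) ->
  {for t, continuous (fun t => F (pt e s t))}.
Proof.
move=> cF Vst; apply: continuous_comp (cF _ Vst).
by case: e Vst => _; [exact: (cvg_pair (cvg_cst s) cvg_id)|exact: (cvg_pair cvg_id (cvg_cst s))].
Qed.

Lemma cont_within1 (f : R -> R) a b : (forall s, a <= s <= b -> {for s, continuous f}) ->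
  {within `[a, b], continuous f}.
Proof.
move=> cf; apply: continuous_in_subspaceT => s /set_mem/=; rewrite in_itv/=.
exact: cf.
Qed.

Lemma cont_integrable1 (f : R -> R) a b :
  (forall s, a <= s <= b -> {for s, continuous f}) ->
  mu.-integrable `[a, b] (EFin \o f).
Proof.
move=> cf; apply: continuous_compact_integrable; first exact: segment_compact.
exact: cont_within1.
Qed.

Lemma swap_cont V F : open V -> cont_on V F ->
  open [set y : R * R | V (y.2, y.1)] /\
  cont_on [set y : R * R | V (y.2, y.1)] (fun y => F (y.2, y.1)).
Proof.
move=> oV cF.
have cs : continuous (fun y : R * R => (y.2, y.1)).
  by move=> y; exact: (cvg_pair (@cvg_snd _ _ _ _ _) (@cvg_fst _ _ _ _ _)).
split; first by apply: open_comp oV => y _; exact: cs.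
by move=> y Vy; apply: continuous_comp; [exact: cs|exact: cF].
Qed.

Lemma measurable_box e a b c d : measurable (box e a b c d).
Proof. by case: e; exact: measurable_rect. Qed.

Lemma integrable_patch e V F a b c d : open V -> box e a b c d `<=` V ->
  cont_on V F -> mu2.-integrable setT ((EFin \o F) \_ (box e a b c d)).
Proof.
move=> oV RV cF; apply/integrable_restrict => //; first exact: measurable_box.
by rewrite setTI; move: RV; case: e => RV; exact: rect_integrable cF.
Qed.

Lemma patch_inner e V F a b c d s : box e a b c d `<=` V -> cont_on V F ->
  (\int[mu]_t ((EFin \o F) \_ (box e a b c d)) (pt e s t) =
    ((EFin \o (fun s => \int[mu]_(t in `[c, d]) F (pt e s t))%R) \_ `[a, b]) s)%E.
Proof.
move=> RV cF; rewrite patchE; case: ifPn => [/set_mem/= sab|sab].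
  rewrite in_itv/= in sab.
  rewrite (_ : (fun t => _) = (EFin \o (fun t => F (pt e s t))) \_ `[c, d]).
    rewrite -integral_mkcond /= /Rintegral fineK//.
    apply: (integrable_fin_num (mu := mu)) => //.
    apply: cont_integrable1 => t tcd; apply: (cont_pt cF).
    by apply: RV; apply/boxE.
  apply/funext => t; rewrite !patchE.
  rewrite (_ : (pt e s t \in _) = (t \in `[c, d]%classic))//.
  apply/idP/idP => /set_mem H; apply/mem_set.
    by move/boxE : H => [_]; rewrite /= in_itv.
  by apply/boxE; split => //; rewrite /= in_itv in H.
apply: integral0_eq => t _; rewrite patchE; case: ifPn => // /set_mem/boxE[sab' _].
by case/negP: sab; apply/mem_set; rewrite /= in_itv.
Qed.

Lemma integrable_inner e V F a b c d : open V -> box e a b c d `<=` V ->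
  cont_on V F ->
  mu.-integrable `[a, b] (EFin \o (fun s => \int[mu]_(t in `[c, d]) F (pt e s t))).
Proof.
wlog -> : e V F / e = true.
  move=> H; case: e => [|oV RV cF]; first exact: (H true).
  have [oV' cF'] := swap_cont oV cF.
  apply: (H true _ _ erefl oV' _ cF') => -[s t] [/= sab tcd].
  by apply: RV; split.
move=> oV RV cF.
have : mu.-integrable setT
    ((EFin \o (fun s => \int[mu]_(t in `[c, d]) F (pt true s t))) \_ `[a, b]).
  have := integrable_fubini_F (integrable_patch oV RV cF).
  congr (mu.-integrable _ _).
  by apply/funext => s; rewrite -(patch_inner _ RV cF).
by move/integrable_restrict; rewrite setTI; apply.
Qed.

Lemma fubini_box e V F a b c d : open V -> box e a b c d `<=` V -> cont_on V F ->
  \int[mu2]_(y in box e a b c d) F y =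
  \int[mu]_(s in `[a, b]) \int[mu]_(t in `[c, d]) F (pt e s t).
Proof.
move=> oV RV cF; have iF := integrable_patch oV RV cF.
rewrite /Rintegral integral_mkcond [in RHS]integral_mkcond; congr fine.
transitivity (\int[mu]_s \int[mu]_t ((EFin \o F) \_ (box e a b c d)) (pt e s t))%E.
  move: iF; case: (e) => iF.
    by rewrite -(integral12_prod_meas1 iF).
  by rewrite -(integral21_prod_meas1 iF).
by apply: eq_integral => s _; rewrite (patch_inner _ RV cF).
Qed.

(** Change of variables, from the uniqueness of Lebesgue measure: the image of the
    measure under s |-> c + l s, multiplied by l, gives intervals their length. *)
Lemma integral_affine1 (l c : R) (g : R -> \bar R) : 0 < l ->
  measurable_fun setT g -> (forall s, 0 <= g s)%E ->
  (\int[mu]_s g s = l%:E * \int[mu]_s g (c + l * s)%R)%E.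
Proof.
move=> l0 mg g0.
pose phi : R -> measurableTypeR R := fun s => c + l * s.
have mphi : measurable_fun setT phi.
  apply: continuous_measurable_fun => s; apply: cvgD; first exact: cvg_cst.
  by apply: cvgMr; exact: cvg_id.
have [pm pmE] : exists pm : {measure set (measurableTypeR R) -> \bar R},
    forall A, pm A = mu (phi @^-1` A).
  by unshelve eexists [the measure (measurableTypeR R) R of pushforward mu phi].
pose m := mscale (NngNum (ltW l0)) pm.
have E A : measurable A -> mu A = m A.
  apply: lebesgue_measure_unique => _ [[a b]] _ <-.
  transitivity (l%:E * mu (phi @^-1` [set` Interval (BRight a) (BRight b)]))%E; last first.
    by rewrite /m /mscale/=; congr (_ * _)%E; exact/esym/pmE.
  rewrite (_ : phi @^-1` _ = `](a - c) / l, (b - c) / l]%classic); last first.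
    apply/seteqP; split => s; rewrite /phi /= !in_itv/= ltr_pdivrMr// ler_pdivlMr//.
      by clear; move=> /andP[? ?]; apply/andP; split; lra.
    by clear; move=> /andP[? ?]; apply/andP; split; lra.
  rewrite !lebesgue_measure_itv/= !lte_fin ltr_pM2r ?invr_gt0// ltrD2r.
  case: ifPn => _; last by rewrite mule0.
  rewrite -!EFinD -EFinM; congr EFin.
  by field; rewrite gt_eqF.
rewrite (eq_measure_integral m); last by move=> A mA _; exact: E.
rewrite ge0_integral_mscale//=; congr (_ * _)%E.
rewrite (eq_measure_integral (pushforward mu phi)); last by move=> A _ _; exact: pmE.
by rewrite ge0_integral_pushforward.
Qed.

Lemma integral_affine2 (l : R) x (g : R * R -> \bar R) : 0 < l ->
  measurable_fun setT g -> (forall y, 0 <= g y)%E ->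
  (\int[mu2]_y g y = (l ^+ 2)%:E * \int[mu2]_y g (x + l *: y)%R)%E.
Proof.
move=> l0 mg g0.
have msl s : measurable_fun setT (fun t => g (s, t)).
  by apply: measurableT_comp mg _; exact: measurable_pair1.
have maff (u : R) : measurable_fun setT (fun s : R => u + l * s).
  apply: continuous_measurable_fun => s; apply: cvgD; first exact: cvg_cst.
  by apply: cvgMr; exact: cvg_id.
have mphi : measurable_fun setT (fun y : R * R => x + l *: y).
  apply/measurable_fun_pairP; split.
    exact: measurableT_comp (maff x.1) measurable_fst.
  exact: measurableT_comp (maff x.2) measurable_snd.
have mgphi : measurable_fun setT (fun y : R * R => g (x + l *: y)).
  exact: measurableT_comp mg mphi.
rewrite fubini_tonelli1// fubini_tonelli1//.
rewrite (@integral_affine1 l x.1)//; last 2 first.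
- exact: measurable_fun_fubini_tonelli_F.
- by move=> s; apply: integral_ge0 => t _.
rewrite expr2 EFinM -muleA; congr (_ * _)%E.
rewrite -ge0_integralZl//; last 3 first.
- exact: (measurable_fun_fubini_tonelli_F (m2 := mu) (fun y : R * R => g (x + l *: y)) mgphi (fun y => g0 _)).
- by move=> s _; apply: integral_ge0.
- by rewrite lee_fin ltW.
by apply: eq_integral => s _; rewrite /fubini_F (@integral_affine1 l x.2)//.
Qed.
End BoxIntegral.

(** * Integration on the unit square *)

Section ContOn.
Context {R : realType}.
Implicit Types (F G f g : R * R -> R) (V : set (R * R)) (x y z k : R * R) (a b c d : R).

Lemma contD V f g : cont_on V f -> cont_on V g -> cont_on V (fun x => f x + g x).
Proof. by move=> cf cg x Vx; apply: cvgD; [exact: cf|exact: cg]. Qed.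

Lemma contN V f : cont_on V f -> cont_on V (fun x => - f x).
Proof. by move=> cf x Vx; apply: cvgN; exact: cf. Qed.

Lemma contM V f g : cont_on V f -> cont_on V g -> cont_on V (fun x => f x * g x).
Proof. by move=> cf cg x Vx; apply: cvgM; [exact: cf|exact: cg]. Qed.

Lemma cont_cst V a : cont_on V (fun=> a).
Proof. by move=> x Vx; exact: cvg_cst. Qed.

Lemma contX V f n : cont_on V f -> cont_on V (fun x => f x ^+ n).
Proof.
move=> cf; elim: n => [|n IH]; first exact: cont_cst.
rewrite (_ : (fun x => _) = (fun x => f x * f x ^+ n)); first exact: contM.
by apply/funext => x; rewrite exprS.
Qed.

Lemma cont_abs V f : cont_on V f -> cont_on V (fun x => `|f x|).
Proof. by move=> cf x Vx; apply: cvg_norm; exact: cf. Qed.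

Lemma cont_co V e : cont_on V (co e).
Proof. by move=> x _; case: e; [exact: cvg_fst|exact: cvg_snd]. Qed.

Lemma cont_comp1 V (h : R -> R) f : cont_on V f ->
  (forall x, V x -> {for f x, continuous h}) -> cont_on V (fun x => h (f x)).
Proof. by move=> cf ch x Vx; apply: continuous_comp; [exact: cf|exact: ch]. Qed.

Lemma cont_scale V W f (s : R) : (forall x, W x -> V (s *: x)) -> cont_on V f ->
  cont_on W (fun x => f (s *: x)).
Proof.
move=> WV cf x Wx; apply: (@continuous_comp _ _ _ (fun z : R * R => s *: z) f).
  by apply: cvgZr; exact: cvg_id.
exact: cf (WV _ Wx).
Qed.

Lemma cont_sub V W f : W `<=` V -> cont_on V f -> cont_on W f.
Proof. by move=> WV cf x /WV; exact: cf. Qed.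

Lemma is_derive_comp1 (h : R -> R) f (dh df : R) x k :
  is_derive (f x) 1 h dh -> is_derive x k f df ->
  is_derive x k (fun z => h (f z)) (dh * df).
Proof.
move=> H1 H2; apply: line_is_derive.
have G2 : is_derive (0 : R) 1 (fun s : R => f (x + s *: k)) df.
  by apply: is_derive_line; rewrite scale0r addr0.
have G1 : is_derive (f (x + (0 : R) *: k)) 1 h dh by rewrite scale0r addr0.
exact: (@is_derive1_comp R h (fun s : R => f (x + s *: k)) 0 dh df G1 G2).
Qed.

Lemma is_derive_co (e c : bool) x : is_derive x (ev c) (co e) ((e == c)%:R : R).
Proof.
apply: line_is_derive.
rewrite (_ : (fun s : R => _) = (fun s : R => s * (e == c)%:R + co e x)).
  have := is_deriveD (is_deriveZ ((e == c)%:R : R) (@is_derive_id R R 0 1))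
     (@is_derive_cst R R R (co e x) 0 1).
  rewrite addr0 /GRing.scale/= mulr1; congr is_derive.
  by apply/funext => s /=; rewrite mulrC.
apply/funext => s; rewrite addrC; case: e; case: c; rewrite /co /ev /e1 /e2 /= /GRing.scale/=; ring.
Qed.

End ContOn.

(* Proves continuity by recursion on the shape of the integrand; ct_leaf is
   redefined below once the kernels have been introduced. *)
Ltac ct_leaf := try assumption.

Ltac ct := match goal with
  | |- cont_on _ (fun _ => ?a) => exact: cont_cst
  | |- cont_on _ (fun x => @?f x + @?g x) => apply: contD; ct
  | |- cont_on _ (fun x => - @?f x) => apply: contN; ct
  | |- cont_on _ (fun x => @?f x * @?g x) => apply: contM; ct
  | |- cont_on _ (fun x => (@?f x) ^+ _) => apply: contX; ct
  | |- cont_on _ (fun x => `|@?f x|) => apply: cont_abs; ct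
  | |- cont_on _ (fun x => co ?e x) => exact: cont_co
  | |- cont_on _ (co ?e) => exact: cont_co
  | _ => ct_leaf
  end.

Section UnitBox.
Context {R : realType}.
Notation mu := (@lebesgue_measure R).
Notation mu2 := (mu \x mu)%E.
Implicit Types (F G f g : R * R -> R) (x y z : R * R) (a b c d : R).

(** These are balls of the sup norm, that is, squares.  Functions are integrated
    over the closed ball of radius 1 and are required to be regular on the open
    ball of radius 2, so that the boundary of the square lies inside the
    domain. *)
Definition ball2 : set (R * R) := [set y | `|y| < 2].
Definition ball1 : set (R * R) := rect (-1) 1 (-1) 1.
Definition bint F : R := \int[mu2]_(y in ball1) F y.

Lemma open_ball_norm (r : R) : open [set x : R * R | `|x| < r].
Proof.
rewrite (_ : [set x | _] = (fun x : R * R => `|x|) @^-1` [set t | t < r])//.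
by apply: open_comp; [move=> x _; exact: norm_continuous|exact: open_lt].
Qed.

Lemma open_ball2 : open ball2. Proof. exact: open_ball_norm. Qed.

Lemma ball1P y : ball1 y <-> `|y| <= 1.
Proof.
rewrite /ball1 /rect /= !in_itv/= prod_normE/= ge_max !ler_norml.
by split => [[-> ->]|/andP[-> ->]].
Qed.

Lemma ball1_sub2 : ball1 `<=` ball2.
Proof. by move=> y /ball1P y1; rewrite /ball2 /= (le_lt_trans y1)// ltr1n. Qed.

Lemma co_ball1 e y : ball1 y -> `|co e y| <= 1.
Proof. by move=> /ball1P; rewrite prod_normE/= ge_max => /andP[]; case: e. Qed.

Lemma scale_ball1 (s : R) y : `|s| <= 1 -> ball1 y -> ball1 (s *: y).
Proof. by move=> s1 /ball1P Qy; apply/ball1P; rewrite normrZ mulr_ile1. Qed.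

Let mQ : measurable ball1. Proof. exact: measurable_rect. Qed.

Lemma bint_integrable F : cont_on ball2 F -> mu2.-integrable ball1 (EFin \o F).
Proof. by move=> cF; apply: rect_integrable open_ball2 ball1_sub2 cF. Qed.

Lemma bint_eq F G : (forall y, ball1 y -> F y = G y) -> bint F = bint G.
Proof. by move=> FG; apply: eq_Rintegral => y /set_mem; exact: FG. Qed.

Lemma bintD F G : cont_on ball2 F -> cont_on ball2 G ->
  bint (fun y => F y + G y) = bint F + bint G.
Proof. by move=> cF cG; rewrite /bint RintegralD//; exact: bint_integrable. Qed.

Lemma bintB F G : cont_on ball2 F -> cont_on ball2 G ->
  bint (fun y => F y - G y) = bint F - bint G.
Proof. by move=> cF cG; rewrite /bint RintegralB//; exact: bint_integrable. Qed.

Lemma bintZ F a : cont_on ball2 F -> bint (fun y => a * F y) = a * bint F.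
Proof. by move=> cF; rewrite /bint RintegralZl//; exact: bint_integrable. Qed.

Lemma bint_le F G : cont_on ball2 F -> cont_on ball2 G ->
  (forall y, ball1 y -> F y <= G y) -> bint F <= bint G.
Proof. by move=> cF cG FG; apply: le_Rintegral => //; exact: bint_integrable. Qed.

Lemma bint_cst a : bint (fun=> a) = 4 * a.
Proof.
rewrite /bint Rintegral_cst// mulrC; congr (_ * _).
have E : mu2 ball1 = ((2 : R)%:E * (2 : R)%:E)%E.
  have l2 : mu `[(-1)%R, 1%R]%classic = (2 : R)%:E.
    by rewrite lebesgue_measure_itv/= lte_fin gtrN// -EFinB opprK.
  transitivity (mu `[(-1)%R, 1%R]%classic * mu `[(-1)%R, 1%R]%classic)%E.
    exact: product_measure1E.
  by rewrite l2.
change (fine (mu2 ball1) = 4); rewrite E -EFinM /=; ring.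
Qed.

Lemma bint_abs F : cont_on ball2 F -> `|bint F| <= bint (fun y => `|F y|).
Proof. by move=> cF; apply: le_normr_Rintegral => //; exact: bint_integrable. Qed.

Lemma bint_bound F M : cont_on ball2 F -> (forall y, ball1 y -> `|F y| <= M) ->
  `|bint F| <= 4 * M.
Proof.
move=> cF FM; rewrite (le_trans (bint_abs cF))// -bint_cst.
by apply: bint_le; [ct|ct|exact: FM].
Qed.

Lemma ftc (f g : R -> R) a b : a < b -> (forall s : R, a <= s <= b -> is_derive s 1 f (g s)) ->
  (forall s, a <= s <= b -> {for s, continuous g}) ->
  \int[mu]_(s in `[a, b]) g s = f b - f a.
Proof.
move=> ab df cg.
have cf s : a <= s <= b -> {for s, continuous f}.
  move=> /df[H _]; apply: differentiable_continuous; exact/derivable1_diffP.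
rewrite /Rintegral (@continuous_FTC2 R g f a b)//; first exact: cont_within1.
- split.
  + move=> s; rewrite in_itv/= => /andP[sa sb].
    by have [] := df s; rewrite ?ltW.
  + by apply: cvg_at_right_filter; apply: cf; rewrite lexx ltW.
  + by apply: cvg_at_left_filter; apply: cf; rewrite lexx ltW.
- move=> s; rewrite in_itv/= => /andP[sa sb].
  by rewrite derive1E; have [|_] := df s; rewrite ?ltW.
Qed.

(** Fubini with the inner integral in direction e, and the fundamental theorem of
    calculus on each line. *)
Lemma bint_D0 e F dF : (forall y, ball2 y -> is_derive y (ev e) F (dF y)) ->
  cont_on ball2 dF -> (forall y, ball1 y -> `|co e y| = 1 -> F y = 0) -> bint dF = 0.
Proof.
move=> HF cdF F0.
have QE : ball1 = box (~~ e) (-1) 1 (-1) 1 by case: (e).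
rewrite /bint QE (fubini_box open_ball2 _ cdF) -?QE; last exact: ball1_sub2.
rewrite (_ : (fun s => _) = (fun s => \int[mu]_(t in `[-1, 1]) dF (pt (~~ e) s t)))//.
transitivity (\int[mu]_(s in `[-1, 1]) (0 : R)); last by rewrite Rintegral_cst// mul0r.
apply: eq_Rintegral => s /set_mem/=; rewrite in_itv/= => s1.
have Qst t : -1 <= t <= 1 -> ball1 (pt (~~ e) s t) by move=> t1; rewrite QE boxE.
transitivity (F (pt (~~ e) s 1) - F (pt (~~ e) s (-1))); last first.
  by rewrite !F0 ?subr0//; first [apply: Qst; rewrite !lexx ?andbT ?andTb; lra
   | case: (e) => /=; rewrite ?normrN normr1].
apply: (@ftc (fun t => F (pt (~~ e) s t))).
- lra.
- move=> t t1.
  have E u : pt (~~ e) s u = pt (~~ e) s 0 + u *: ev e.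
    by case: (e); rewrite /pt /ev /e1 /e2 /=; apply: injective_projections;
      rewrite /= /GRing.scale/= ?mulr0 ?mulr1 ?addr0 ?add0r.
  rewrite (_ : (fun t => _) = (fun u : R => F (pt (~~ e) s 0 + u *: ev e))); last first.
    by apply/funext => u; rewrite E.
  apply: is_derive_line; rewrite -E; apply: HF; apply: ball1_sub2; exact: Qst.
- move=> t t1; apply: cont_pt cdF _; apply: ball1_sub2; exact: Qst.
Qed.

Lemma bint_ibp e f df g dg :
  (forall y, ball2 y -> is_derive y (ev e) f (df y)) ->
  (forall y, ball2 y -> is_derive y (ev e) g (dg y)) ->
  cont_on ball2 f -> cont_on ball2 df -> cont_on ball2 g -> cont_on ball2 dg ->
  (forall y, ball1 y -> `|co e y| = 1 -> g y = 0) ->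
  bint (fun y => df y * g y) = - bint (fun y => f y * dg y).
Proof.
move=> Hf Hg cf cdf cg cdg g0; apply/eqP; rewrite -subr_eq0 opprK.
rewrite -bintD; [|by ct|by ct]; apply/eqP.
apply: (@bint_D0 e (fun y => f y * g y)); last 1 first.
- by move=> y Qy y1; rewrite g0 ?mulr0.
- move=> y Oy; have := is_deriveM (Hf _ Oy) (Hg _ Oy).
  by congr is_derive; rewrite /GRing.scale/= addrC (mulrC (g y)).
- by ct.
Qed.

Lemma bint_param (F dF : R -> R * R -> R) (u v M t0 : R) : u < t0 < v ->
  (forall t, u < t < v -> cont_on ball2 (F t)) ->
  (forall t y, u < t < v -> ball1 y -> is_derive t 1 (F ^~ y) (dF t y)) ->
  (forall t y, u < t < v -> ball1 y -> `|dF t y| <= M) ->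
  is_derive t0 1 (fun t => bint (F t)) (bint (dF t0)).
Proof.
move=> t0uv cF dF' FM.
have int t : t \in `]u, v[ -> mu2.-integrable ball1 (EFin \o F t).
  by rewrite in_itv/= => /cF; exact: bint_integrable.
have t0' : t0 \in `]u, v[ by rewrite in_itv.
have G0 y : 0 <= `|M| by [].
have dE t y : t \in `]u, v[ -> ball1 y -> partial1of2 F t y = dF t y.
  by rewrite in_itv/= => tuv Qy; rewrite partial1of2E; have [_ ->] := dF' t y tuv Qy.
have der t y : t \in `]u, v[ -> ball1 y -> derivable (F ^~ y) t 1.
  by rewrite in_itv/= => tuv Qy; have [] := dF' t y tuv Qy.
have intG : mu2.-integrable ball1 (EFin \o (fun=> `|M|)) by apply: bint_integrable; ct.
have bd t y : t \in `]u, v[ -> ball1 y -> `|partial1of2 F t y| <= `|M|.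
  move=> tuv Qy; rewrite dE//; rewrite in_itv/= in tuv.
  by rewrite (le_trans (FM _ _ tuv Qy))// ler_norm.
split.
  exact: (@derivable_under_integral R _ _ mu2 F ball1 mQ t0 u v t0' int der (fun=> `|M|) G0 intG bd).
rewrite -derive1E (@differentiation_under_integral R _ _ mu2 F ball1 mQ t0 u v t0' int der (fun=> `|M|) G0 intG bd).
by apply: bint_eq => y Qy; exact: dE.
Qed.

End UnitBox.

(** * The kernels *)

Section Kernel.
Context {R : realType}.
Implicit Types (F G f g u : R * R -> R) (x y z : R * R) (a b d t s : R) (e c : bool).

Definition pos t : R := Num.max t 0.

Lemma pos_ge0 t : 0 <= pos t. Proof. by rewrite /pos le_max lexx orbT. Qed.

(** From the second power on, the positive part is differentiable at 0 too. *)
Lemma is_derive_pos n t :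
  is_derive t 1 (fun s => pos s ^+ n.+2) (n.+2%:R * pos t ^+ n.+1).
Proof.
have [t0|t0|->] := ltgtP t 0.
- rewrite /pos (max_r (ltW t0)) expr0n /= mulr0.
  apply: (@near_eq_is_derive _ _ _ (fun=> 0)).
  near=> s; rewrite /pos max_r ?expr0n// ltW//.
  by near: s; exact: lt_nbhsl.
- rewrite /pos (max_l (ltW t0)).
  apply: (@near_eq_is_derive _ _ _ (fun s => s ^+ n.+2)).
    near=> s; rewrite /pos max_l// ltW//.
    by near: s; exact: lt_nbhsr.
  have := @is_deriveX R _ id n.+2 t 1 1 (is_derive_id t 1).
  congr is_derive; last by rewrite /GRing.scale/= mulr1.
  by apply/funext => s; rewrite exprfctE.
- rewrite {2}/pos maxxx expr0n /= mulr0.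
  suff H : (fun h : R => h^-1 *: (pos (h *: 1 + 0) ^+ n.+2 - pos 0 ^+ n.+2)) @ 0^' --> (0:R).
    apply: DeriveDef; first by apply/cvg_ex; exists 0.
    exact: (cvg_lim _ H).
  apply/cvgrPdist_le => eps eps0; near=> h.
  rewrite addr0 /GRing.scale/= mulr1 {2}/pos maxxx expr0n /= subr0 sub0r normrN.
  have h1 : `|h| <= 1 by near: h; apply: (@dnbhs0_le R R).
  have he : `|h| <= eps by near: h; exact: (@dnbhs0_le R R).
  have h0 : h != 0 by near: h; exact: nbhs_dnbhs_neq.
  rewrite normrM normfV ler_pdivrMl ?normr_gt0//.
  have p0 : `|pos h| <= `|h|.
    by rewrite (ger0_norm (pos_ge0 h)) /pos ge_max ler_norm normr_ge0.
  rewrite normrX (le_trans (lerXn2r _ _ _ p0)) ?nnegrE// exprS ler_wpM2l// exprS.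
  by rewrite (le_trans _ he)// ler_piMr// exprn_ile1.
Unshelve. all: by end_near. Qed.

(** The kernels k2 and k3 below are powers of the positive part of 1 - |y|^2 (Euclidean norm).
    They vanish on the boundary of the square, and the gradient of kap^3 is
    -6 y kap^2: the radial factor y in the derivative of a dilation is thereby a
    gradient, which can be integrated by parts. *)
Definition kap y : R := pos (1 - co true y ^+ 2 - co false y ^+ 2).

Lemma kap_ge0 y : 0 <= kap y. Proof. exact: pos_ge0. Qed.

Lemma kap_le1 y : kap y <= 1.
Proof.
rewrite /kap /pos ge_max ler01 andbT.
by rewrite lerBlDr (le_trans (y := 1))// ?lerDl ?lerBlDr ?lerDl sqr_ge0.
Qed.

Lemma kap_edge e y : `|co e y| = 1 -> kap y = 0.
Proof.
move=> y1; rewrite /kap /pos max_r//.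
have : co e y ^+ 2 = 1 by rewrite -real_normK ?num_real// y1 expr1n.
have := sqr_ge0 (co (~~ e) y).
by case: (e) => /= H1 H2; lra.
Qed.

Lemma cont_kap (V : set (R * R)) : cont_on V kap.
Proof.
apply: (@cont_comp1 _ _ pos) => [|y _].
  by ct.
by apply: continuous_max => //; exact: cvg_cst.
Qed.

Lemma is_derive_kap e n y : is_derive y (ev e) (fun y => kap y ^+ n.+2)
  (- (2 * n.+2%:R) * (co e y * kap y ^+ n.+1)).
Proof.
have dq c : is_derive y (ev e) (fun y => co c y ^+ 2) (2 * co c y * (c == e)%:R).
  have := is_deriveM (is_derive_co c e y) (is_derive_co c e y).
  by congr is_derive; rewrite /GRing.scale/=; ring.
have dr : is_derive y (ev e) (fun y => 1 - co true y ^+ 2 - co false y ^+ 2) (- 2 * co e y).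
  have := is_deriveB (is_deriveB (is_derive_cst (1:R) y (ev e)) (dq true)) (dq false).
  by congr is_derive; case: (e) => /=; ring.
have := is_derive_comp1 (is_derive_pos n (1 - co true y ^+ 2 - co false y ^+ 2)) dr.
by congr is_derive; rewrite /kap; ring.
Qed.

Definition k2 y : R := kap y ^+ 2.
Definition dk2 e y : R := - 4 * (co e y * kap y).
Definition k3 y : R := kap y ^+ 3.
Definition dk3 e y : R := - 6 * (co e y * k2 y).
Definition ddk3 e c y : R := - 6 * ((e == c)%:R * k2 y + co e y * dk2 c y).

Lemma cont_k2 (V : set (R * R)) : cont_on V k2.
Proof. by apply: contX; exact: cont_kap. Qed.
Lemma cont_k3 (V : set (R * R)) : cont_on V k3.
Proof. by apply: contX; exact: cont_kap. Qed.
Lemma cont_dk2 e (V : set (R * R)) : cont_on V (dk2 e).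
Proof. have := @cont_kap V; rewrite /dk2 => ?; by ct. Qed.
Lemma cont_dk3 e (V : set (R * R)) : cont_on V (dk3 e).
Proof. have := @cont_k2 V; rewrite /dk3 => ?; by ct. Qed.
Lemma cont_ddk3 e c (V : set (R * R)) : cont_on V (ddk3 e c).
Proof.
have := @cont_k2 V; have := @cont_dk2 c V; rewrite /ddk3 => ? ?; by ct.
Qed.

Lemma is_derive_k2 e y : is_derive y (ev e) k2 (dk2 e y).
Proof.
have := is_derive_kap e 0 y; congr is_derive; rewrite /dk2 expr1; ring.
Qed.

Lemma is_derive_k3 e y : is_derive y (ev e) k3 (dk3 e y).
Proof.
have := is_derive_kap e 1 y; congr is_derive; rewrite /dk3 /k2; ring.
Qed.

Lemma is_derive_dk3 e c y : is_derive y (ev c) (dk3 e) (ddk3 e c y).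
Proof.
have := is_deriveZ (- 6 : R) (is_deriveM (is_derive_co e c y) (is_derive_k2 c y)).
by congr is_derive; rewrite /ddk3 /GRing.scale/=; ring.
Qed.

Lemma k2_ge0 y : 0 <= k2 y. Proof. exact: sqr_ge0. Qed.
Lemma k2_le1 y : k2 y <= 1. Proof. by rewrite exprn_ile1 ?kap_ge0 ?kap_le1. Qed.
Lemma k3_ge0 y : 0 <= k3 y. Proof. by rewrite exprn_ge0 ?kap_ge0. Qed.
Lemma k3_le1 y : k3 y <= 1. Proof. by rewrite exprn_ile1 ?kap_ge0 ?kap_le1. Qed.
Lemma k2_edge e y : `|co e y| = 1 -> k2 y = 0.
Proof. by move=> /kap_edge; rewrite /k2 => ->; rewrite expr0n. Qed.
Lemma k3_edge e y : `|co e y| = 1 -> k3 y = 0.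
Proof. by move=> /kap_edge; rewrite /k3 => ->; rewrite expr0n. Qed.
Lemma dk3_edge c e y : `|co e y| = 1 -> dk3 c y = 0.
Proof. by move=> /k2_edge; rewrite /dk3 => ->; rewrite !mulr0. Qed.

Lemma dk2_le e y : ball1 y -> `|dk2 e y| <= 4.
Proof.
move=> Qy; rewrite /dk2 normrM (_ : `|- 4| = 4); last by rewrite normrN ger0_norm.
apply: ler_piMr => //.
rewrite normrM mulr_ile1 ?normr_ge0 ?co_ball1//.
by rewrite ger0_norm ?kap_ge0 ?kap_le1.
Qed.

Lemma dk3_le e y : ball1 y -> `|dk3 e y| <= 6.
Proof.
move=> Qy; rewrite /dk3 normrM (_ : `|- 6| = 6); last by rewrite normrN ger0_norm.
apply: ler_piMr => //.
rewrite normrM mulr_ile1 ?normr_ge0 ?co_ball1//.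
by rewrite ger0_norm ?k2_ge0 ?k2_le1.
Qed.

Lemma ddk3_le e c y : ball1 y -> `|ddk3 e c y| <= 30.
Proof.
move=> Qy; rewrite /ddk3 normrM (_ : `|- 6| = 6); last by rewrite normrN ger0_norm.
have H1 : `|(e == c)%:R * k2 y| <= 1.
  rewrite normrM mulr_ile1 ?normr_ge0//.
    by case: (_ == _); rewrite ?normr1 ?normr0.
  by rewrite ger0_norm ?k2_ge0 ?k2_le1.
have H2 : `|co e y * dk2 c y| <= 4.
  rewrite normrM -[leRHS]mul1r ler_pM ?normr_ge0 ?co_ball1//.
  exact: dk2_le.
have := ler_normD ((e == c)%:R * k2 y) (co e y * dk2 c y).
move: H1 H2; move: (`|_ * k2 y|) (`|_ * dk2 c y|) (`|_ + _|) => p1 p2 p3; clear.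
lra.
Qed.

Definition c0 : R := bint k2.

Lemma bint_co2 e : bint (fun y => co e y ^+ 2) = 4 / 3 :> R.
Proof.
have : bint (fun y => 3 * co e y ^+ 2 - 1) = 0 :> R.
  apply: (@bint_D0 _ e (fun y => co e y * co e y ^+ 2 - co e y)).
  - move=> y _.
    have d1 := is_derive_co e e y.
    have := is_deriveB (is_deriveM d1 (is_deriveM d1 d1)) d1.
    by congr is_derive; rewrite eqxx ?mulrfctE /GRing.scale/=; ring.
  - by ct.
  - move=> y _ y1.
    have -> : co e y ^+ 2 = 1 by rewrite -real_normK ?num_real// y1 expr1n.
    by rewrite mulr1 subrr.
rewrite bintB; [|by ct|by ct]; rewrite bintZ; last by ct.
by rewrite bint_cst => H; lra.
Qed.

(** For all s one has s^2 >= 2/3 s - 1/9; applied to the quadratic below kap,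
    this bounds kap^2 from below by a polynomial whose integral is 4/9. *)
Lemma c0_gt0 : 0 < c0.
Proof.
apply: (@lt_le_trans _ _ (4 / 9)); first by rewrite divr_gt0.
have -> : 4 / 9 = bint (fun y => 5 / 9 - 2 / 3 * (co true y ^+ 2 + co false y ^+ 2)) :> R.
  rewrite bintB; [|by ct|by ct].
  rewrite (@bintZ _ (fun y => co true y ^+ 2 + co false y ^+ 2)); last by ct.
  rewrite bintD; [|by ct|by ct]; rewrite bint_cst !bint_co2.
  by field.
apply: bint_le; [by ct|exact: cont_k2|].
move=> y _; rewrite /k2.
have H : 1 - co true y ^+ 2 - co false y ^+ 2 <= kap y by rewrite /kap /pos le_max lexx.
have := sqr_ge0 (kap y - 1 / 3); rewrite sqrrB.
move: H; move: (kap y) (co true y ^+ 2) (co false y ^+ 2) => k a b; clear.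
rewrite !expr2; lra.
Qed.

End Kernel.

Ltac ct_leaf ::= match goal with
  | |- cont_on _ (fun x => k2 x) => exact: cont_k2
  | |- cont_on _ (fun x => k3 x) => exact: cont_k3
  | |- cont_on _ (fun x => dk2 _ x) => exact: cont_dk2
  | |- cont_on _ (fun x => dk3 _ x) => exact: cont_dk3
  | |- cont_on _ (fun x => ddk3 _ _ x) => exact: cont_ddk3
  | |- cont_on _ k2 => exact: cont_k2
  | |- cont_on _ k3 => exact: cont_k3
  | |- cont_on _ (dk2 _) => exact: cont_dk2
  | |- cont_on _ (dk3 _) => exact: cont_dk3
  | |- cont_on _ (ddk3 _ _) => exact: cont_ddk3
  | _ => try assumption
  end.

(** * Kernel means at scale t *)

Section LocalEstimates.
Context {R : realType}.
Implicit Types (F G f g u w : R * R -> R) (x y z : R * R) (a b d t s : R) (e c : bool).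

(** Larger than ball2, so that the dilations y |-> t y with |t| < 2 map ball2
    into it; t = 1 is then interior to the range of admissible scales. *)
Definition ball4 : set (R * R) := [set y | `|y| < 4].

Lemma open_ball4 : open ball4. Proof. exact: open_ball_norm. Qed.

Lemma ball2_sub4 : ball2 `<=` ball4.
Proof. by move=> y; rewrite /ball2 /ball4 /= => /lt_trans; apply; rewrite ltr_nat. Qed.

Lemma scale_ball4 s y : `|s| < 2 -> ball2 y -> ball4 (s *: y).
Proof.
move=> s2; rewrite /ball2 /ball4 /= normrZ => y2.
rewrite (_ : 4 = 2 * 2); last by ring.
exact: ltr_pM.
Qed.

Lemma rect_sym r y : rect (- r) r (- r) r y <-> `|y| <= r.
Proof.
rewrite /rect /= !in_itv/= prod_normE/= ge_max !ler_norml.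
by split => [[-> ->]|/andP[-> ->]].
Qed.

Lemma cont_bounded V f r : 0 <= r -> cont_on V f -> (forall y, `|y| <= r -> V y) ->
  exists M, forall y, `|y| <= r -> f y <= M.
Proof.
move=> r0 cf rV.
have [|||c _ cP] := @compact_EVT_max (R * R)%type R f (rect (- r) r (- r) r).
- by exists 0; apply/rect_sym; rewrite normr0.
- exact: rect_compact.
- by apply: cont_within cf => y /rect_sym; exact: rV.
by exists (f c) => y yr; apply: cP; apply/mem_set/rect_sym.
Qed.

Lemma is_derive_scale V u e s y : smooth_on V u -> V (s *: y) ->
  is_derive y (ev e) (fun y => u (s *: y)) (s * D e u (s *: y)).
Proof.
move=> su Vy; have := @is_derive_aff _ u (D e u (s *: y)) 0 y (ev e) s.
rewrite add0r => /(_ (smooth_derive e su Vy)); congr is_derive.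
by apply/funext => z; rewrite add0r.
Qed.

Lemma cont_smooth_scale u s : smooth_on ball4 u -> `|s| < 2 -> cont_on ball2 (fun y => u (s *: y)).
Proof.
by move=> su s2; apply: cont_scale (smooth_cont su) => y; exact: scale_ball4.
Qed.

Definition lap u : R * R -> R := fun x => D true (D true u) x + D false (D false u) x.

Lemma smooth_add V f g : open V -> smooth_on V f -> smooth_on V g ->
  smooth_on V (fun x => f x + g x).
Proof.
move=> oV sf sg; apply: smooth_eq (smooth_lin 1 1 oV sf sg) => // x _.
by rewrite !mul1r.
Qed.

Lemma smooth_lap V u : open V -> smooth_on V u -> smooth_on V (lap u).
Proof. by move=> oV su; apply: smooth_add => //; do 2 apply: smooth_D. Qed.

Lemma D_add e V f g x : open V -> smooth_on V f -> smooth_on V g -> V x ->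
  D e (fun x => f x + g x) x = D e f x + D e g x.
Proof.
move=> oV sf sg Vx.
have E z : V z -> f z + g z = 1 * f z + 1 * g z by rewrite !mul1r.
by rewrite (D_eq e oV E Vx) (D_lin e 1 1 sf sg Vx) !mul1r.
Qed.

Lemma lap_D e V u x : open V -> smooth_on V u -> V x -> lap (D e u) x = D e (lap u) x.
Proof.
move=> oV su Vx; rewrite /lap.
rewrite (D_add e oV (smooth_D true (smooth_D true su)) (smooth_D false (smooth_D false su)) Vx).
have E c : D c (D c (D e u)) x = D e (D c (D c u)) x.
  rewrite (D_eq c oV (fun z Vz => schwarz c e oV su Vz) Vx).
  exact: schwarz oV (smooth_D c su) Vx.
exact: (congr2 +%R (E true) (E false)).
Qed.

(** At t = 0 this is the value at the origin times the mass c0 of the kernel, at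
    t = 1 a mean over the unit square: bounding the derivative in t compares the
    two, and replaces a representation formula with the Green function. *)
Definition kmean u t : R := bint (fun y => u (t *: y) * k2 y).

Lemma kmean0 u : kmean u 0 = u 0 * c0.
Proof.
rewrite /kmean -bintZ; last by ct.
by apply: bint_eq => y _; rewrite scale0r.
Qed.

Lemma kmean_derive0 u t : smooth_on ball4 u -> `|t| <= 1 ->
  is_derive t 1 (kmean u) (bint (fun y => (co true y * D true u (t *: y)
                                      + co false y * D false u (t *: y)) * k2 y)).
Proof.
move=> su t1.
have [M MP] : exists M, forall y, `|y| <= 3 / 2 ->
    `|D true u y| + `|D false u y| <= M.
  apply: (@cont_bounded ball4); first by rewrite divr_ge0.
    have := smooth_cont (smooth_D true su); have := smooth_cont (smooth_D false su).
    by move=> ? ?; ct.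
  move=> y y32; rewrite /ball4 /= (le_lt_trans y32)//; lra.
have tuv : - (3 / 2) < t < 3 / 2.
  by move: t1; rewrite ler_norml => /andP[? ?]; apply/andP; split; lra.
have t2 s : - (3 / 2) < s < 3 / 2 -> `|s| < 3 / 2 by rewrite ltr_norml.
have lt2 : (3 / 2 < 2 :> R) by lra.
apply: (@bint_param R (fun s y => u (s *: y) * k2 y)
  (fun s y => (co true y * D true u (s *: y) + co false y * D false u (s *: y)) * k2 y)
  (- (3 / 2)) (3 / 2) M t tuv).
- move=> s /t2 s2; have := cont_smooth_scale su (lt_trans s2 lt2) => ?; by ct.
- move=> s y /t2 s2 Qy.
  have H : is_derive (0 + s *: y) y u (y.1 * D true u (0 + s *: y) + y.2 * D false u (0 + s *: y)).
    apply: smooth_dir open_ball4 su _; rewrite add0r; apply: scale_ball4 (ball1_sub2 Qy).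
    exact: lt_trans lt2.
  have := is_deriveZ (k2 y) (is_derive_line H); rewrite add0r.
  congr is_derive; last by rewrite /GRing.scale/= mulrC.
  apply/funext => z; change (k2 y * u (0 + z *: y) = u (z *: y) * k2 y).
  by rewrite add0r mulrC.
- move=> s y /t2 s2 Qy; rewrite normrM (ger0_norm (k2_ge0 y)).
  apply: (@le_trans _ _ (`|D true u (s *: y)| + `|D false u (s *: y)|)); last first.
    apply: MP; rewrite normrZ -[leRHS]mulr1 ler_pM//; first exact: ltW.
    by apply/ball1P.
  apply: (@le_trans _ _ (`|co true y * D true u (s *: y) + co false y * D false u (s *: y)|)).
    by rewrite ler_piMr ?k2_le1.
  by rewrite (le_trans (ler_normD _ _))// !normrM lerD// ler_piMl// co_ball1.
Qed.

Lemma bint_ibp3 e u s : smooth_on ball4 u -> `|s| < 2 ->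
  bint (fun y => s * D e u (s *: y) * k3 y) = - bint (fun y => u (s *: y) * dk3 e y).
Proof.
move=> su s2.
have c1 := cont_smooth_scale su s2.
have c2 := cont_smooth_scale (smooth_D e su) s2.
apply: bint_ibp; [|move=> y _; exact: is_derive_k3|by ct|by ct|by ct|by ct|].
  by move=> y Oy; apply: is_derive_scale su _; exact: scale_ball4.
by move=> y _; exact: k3_edge.
Qed.

Lemma bint_ibp2 e u s : smooth_on ball4 u -> `|s| < 2 ->
  bint (fun y => s * D e u (s *: y) * k2 y) = - bint (fun y => u (s *: y) * dk2 e y).
Proof.
move=> su s2.
have c1 := cont_smooth_scale su s2.
have c2 := cont_smooth_scale (smooth_D e su) s2.
apply: bint_ibp; [|move=> y _; exact: is_derive_k2|by ct|by ct|by ct|by ct|].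
  by move=> y Oy; apply: is_derive_scale su _; exact: scale_ball4.
by move=> y _; exact: k2_edge.
Qed.

Lemma bint_ibpd3 e c u s : smooth_on ball4 u -> `|s| < 2 ->
  bint (fun y => s * D c u (s *: y) * dk3 e y) = - bint (fun y => u (s *: y) * ddk3 e c y).
Proof.
move=> su s2.
have c1 := cont_smooth_scale su s2.
have c2 := cont_smooth_scale (smooth_D c su) s2.
apply: bint_ibp; [|move=> y _; exact: is_derive_dk3|by ct|by ct|by ct|by ct|].
  by move=> y Oy; apply: is_derive_scale su _; exact: scale_ball4.
by move=> y _; exact: dk3_edge.
Qed.

(** Since y k2(y) = - grad k3(y) / 6, the radial derivative of u integrates by
    parts into the Laplacian. *)
Lemma kmean_derive u t : smooth_on ball4 u -> `|t| <= 1 ->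
  is_derive t 1 (kmean u) (6^-1 * bint (fun y => t * lap u (t *: y) * k3 y)).
Proof.
move=> su t1; have := kmean_derive0 su t1; congr is_derive.
have t2 : `|t| < 2 by rewrite (le_lt_trans t1)// ltr1n.
have c1 e := cont_smooth_scale (smooth_D e su) t2.
have c2 e := cont_smooth_scale (smooth_D e (smooth_D e su)) t2.
have ct1 := c1 true; have cf1 := c1 false; have ct2 := c2 true; have cf2 := c2 false.
transitivity (bint (fun y => - 6^-1 * (D true u (t *: y) * dk3 true y +
    D false u (t *: y) * dk3 false y))).
  by apply: bint_eq => y _; rewrite /dk3; field.
rewrite bintZ; last by ct.
rewrite bintD; [|by ct|by ct].
have E e : bint (fun y => D e u (t *: y) * dk3 e y) =
   - bint (fun y => t * D e (D e u) (t *: y) * k3 y).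
  by rewrite (bint_ibp3 e (smooth_D e su) t2) opprK.
rewrite (E true) (E false).
transitivity (6^-1 * (bint (fun y => t * D true (D true u) (t *: y) * k3 y) +
  bint (fun y => t * D false (D false u) (t *: y) * k3 y))); first by
  rewrite mulNr -opprD mulrN opprK.
rewrite -bintD; [|by ct|by ct]; congr (_ * _); apply: bint_eq => y _.
by rewrite /lap mulrDr mulrDl.
Qed.

(** When the Laplacian is a derivative of F, a further integration by parts
    leaves F itself, and the factor t that the dilation put in front is consumed. *)
Lemma kmean_derive_div e u F t : smooth_on ball4 u -> smooth_on ball4 F ->
  (forall y, ball4 y -> lap u y = D e F y) -> `|t| <= 1 ->
  is_derive t 1 (kmean u) (- 6^-1 * bint (fun y => F (t *: y) * dk3 e y)).
Proof.
move=> su sF uF t1; have := kmean_derive su t1; congr is_derive.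
have t2 : `|t| < 2 by rewrite (le_lt_trans t1)// ltr1n.
rewrite mulNr -mulrN -(bint_ibp3 e sF t2); congr (_ * _).
by apply: bint_eq => y Qy; rewrite uF//; apply: scale_ball4 t2 _; exact: ball1_sub2.
Qed.

End LocalEstimates.

(** * Interior gradient estimates *)

Section Gradient.
Context {R : realType}.
Implicit Types (F G f g u w : R * R -> R) (x y z : R * R) (a b d t s : R) (e c : bool).

Lemma derive_le (f df h dh : R -> R) a b : a <= b ->
  (forall s, a <= s <= b -> is_derive s 1 f (df s)) ->
  (forall s, a <= s <= b -> is_derive s 1 h (dh s)) ->
  (forall s, a <= s <= b -> `|df s| <= dh s) ->
  `|f b - f a| <= h b - h a.
Proof.
move=> ab Hf Hh fh.
have mono (k dk : R -> R) : (forall s, a <= s <= b -> is_derive s 1 k (dk s)) ->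
    (forall s, a <= s <= b -> 0 <= dk s) -> k a <= k b.
  move=> Hk dk0; rewrite -subr_ge0.
  have [||c cab ->] := @MVT_segment R k dk a b ab.
  - by move=> s; rewrite in_itv/= => /andP[sa sb]; apply: Hk; rewrite !ltW.
  - apply: derivable_within_continuous => s; rewrite in_itv/= => /Hk; by case.
  by rewrite mulr_ge0 ?subr_ge0// dk0//; rewrite in_itv/= in cab.
have H1 := mono (fun s => h s - f s) (fun s => dh s - df s)
  (fun s i => is_deriveB (Hh s i) (Hf s i)).
have H2 := mono (fun s => h s + f s) (fun s => dh s + df s)
  (fun s i => is_deriveD (Hh s i) (Hf s i)).
rewrite ler_norml; apply/andP; split.
  have := H2 _; move=> /(_ (fun s i => _)) => H.
  suff : h a + f a <= h b + f b by clear; lra.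
  by apply: H2 => s /fh; rewrite ler_norml => /andP[? ?]; lra.
suff : h a - f a <= h b - f b by clear; lra.
by apply: H1 => s /fh; rewrite ler_norml => /andP[? ?]; lra.
Qed.

Lemma derive_bound (f df : R -> R) M a b : a <= b ->
  (forall s, a <= s <= b -> is_derive s 1 f (df s)) ->
  (forall s, a <= s <= b -> `|df s| <= M) ->
  `|f b - f a| <= M * (b - a).
Proof.
move=> ab Hf fM; rewrite mulrBr.
apply: (@derive_le f df (fun s => M * s) (fun=> M)) => // s _.
have := is_deriveZ M (is_derive_id s (1 : R)).
by congr is_derive; rewrite /GRing.scale/= mulr1.
Qed.

Lemma ler_norm_trans a b M N : `|b - a| <= M -> `|b| <= N -> `|a| <= N + M.
Proof.
move=> H1 H2; rewrite (_ : a = b - (b - a)); last by rewrite opprB addrC subrK.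
by rewrite (le_trans (ler_normB _ _))// lerD.
Qed.

(** The derivative of u is a solution of lap (D e u) = D e (lap u), to which
    kmean_derive_div applies; the mean at scale 1 is moved from D e u to u. *)
Lemma poisson_gradient e u a b : smooth_on ball4 u ->
  (forall y, ball1 y -> `|u y| <= a) -> (forall y, ball1 y -> `|lap u y| <= b) ->
  c0 * `|D e u 0| <= 16 * a + 4 * b.
Proof.
move=> su ua lb.
have sl := smooth_lap open_ball4 su.
have sD := smooth_D e su.
have dJ t : 0 <= t <= 1 -> is_derive t 1 (kmean (D e u))
    (- 6^-1 * bint (fun y => lap u (t *: y) * dk3 e y)).
  move=> /andP[t0 t1]; apply: kmean_derive_div sD sl _ _.
    by move=> y; exact: lap_D open_ball4 su.
  by rewrite ger0_norm.
have lt12 : `|1 : R| < 2 by rewrite normr1 ltr1n.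
have B1 : `|kmean (D e u) 1 - kmean (D e u) 0| <= 4 * b * (1 - 0).
  apply: derive_bound dJ _ => // t /andP[t0 t1].
  have nt : `|t| <= 1 by rewrite ger0_norm.
  have t2 : `|t| < 2 by rewrite (le_lt_trans nt)// ltr1n.
  have cl := cont_smooth_scale sl t2.
  rewrite normrM normrN (ger0_norm (_ : 0 <= 6^-1)) ?invr_ge0// ler_pdivrMl//.
  rewrite (_ : 6 * (4 * b) = 4 * (b * 6)); last by ring.
  apply: bint_bound => [|y Qy]; first by ct.
  rewrite normrM ler_pM ?dk3_le//; apply: lb; exact: scale_ball1.
have B2 : `|kmean (D e u) 1| <= 16 * a.
  have -> : kmean (D e u) 1 = - bint (fun y => u (1 *: y) * dk2 e y).
    rewrite -(bint_ibp2 e su lt12) /kmean; apply: bint_eq => y _.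
    by rewrite mul1r.
  have cu := cont_smooth_scale su lt12.
  rewrite normrN (_ : 16 * a = 4 * (a * 4)); last by ring.
  apply: bint_bound => [|y Qy]; first by ct.
  by rewrite normrM ler_pM ?dk2_le// scale1r ua.
have := ler_norm_trans B1 B2.
by rewrite kmean0 normrM (ger0_norm (ltW c0_gt0)) mulrC subr0 mulr1.
Qed.

Lemma c0_le4 : c0 <= 4 :> R.
Proof.
rewrite -[4]mulr1 -bint_cst; apply: bint_le; [by ct|by ct|].
by move=> y _; exact: k2_le1.
Qed.

Lemma smooth_shift u x s : smooth_on ball4 u -> (forall y, ball4 y -> ball4 (x + s *: y)) ->
  smooth_on ball4 (fun y => u (x + s *: y)).
Proof. by move=> su H; apply: smooth_aff su H; exact: open_ball4. Qed.

Lemma lap_shift V W u x s y : open W -> smooth_on V u ->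
  (forall y, W y -> V (x + s *: y)) -> W y ->
  lap (fun y => u (x + s *: y)) y = s ^+ 2 * lap u (x + s *: y).
Proof.
move=> oW su VW Wy.
have E e : D e (D e (fun y => u (x + s *: y))) y = s ^+ 2 * D e (D e u) (x + s *: y).
  have E1 z : W z -> D e (fun y => u (x + s *: y)) z = s * D e u (x + s *: z).
    by move=> Wz; exact: D_aff su (VW _ Wz).
  rewrite (D_eq e oW E1 Wy).
  have := is_deriveZ s (is_derive_aff (smooth_derive e (smooth_D e su) (VW _ Wy))).
  by move=> [_ H]; rewrite [LHS]H expr2 -mulrA.
by rewrite /lap (E true) (E false) mulrDr.
Qed.

Definition grad_l1 u y : R := `|D true u y| + `|D false u y|.

Lemma grad_l1_ge0 u y : 0 <= grad_l1 u y. Proof. by rewrite /grad_l1 addr_ge0. Qed.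

Lemma near_center y z l r : 0 < l -> `|z| <= r -> `|y + l *: z| <= `|y| + l * r.
Proof.
move=> l0 zr; rewrite (le_trans (ler_normD _ _))// lerD2l normrZ (gtr0_norm l0).
by rewrite ler_pM2l.
Qed.

Lemma ball1_sub4 y : ball1 y -> ball4 y. Proof. by move=> /ball1_sub2; exact: ball2_sub4. Qed.

Lemma drift_lap_bound u (b1 b2 : R * R -> R) V x : 0 <= V ->
  `|b1 x| <= V -> `|b2 x| <= V ->
  lap u x = b1 x * D true u x + b2 x * D false u x -> `|lap u x| <= V * grad_l1 u x.
Proof.
move=> V0 H1 H2 ->; rewrite (le_trans (ler_normD _ _))// !normrM /grad_l1 mulrDr.
by apply: lerD; apply: ler_wpM2r.
Qed.

(** The Poisson estimate at x on the square of half-side l = th (1 - |x|), on which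
    the distance to the boundary is at least half of that at x; S bounds
    the gradient weighted by that distance. *)
Lemma gradient_step e u (b1 b2 : R * R -> R) m V S x th : smooth_on ball4 u ->
  0 <= V -> (forall y, ball1 y -> `|b1 y| <= V) -> (forall y, ball1 y -> `|b2 y| <= V) ->
  (forall y, ball1 y -> `|u y| <= m) ->
  (forall y, ball1 y -> lap u y = b1 y * D true u y + b2 y * D false u y) ->
  (forall y, ball1 y -> (1 - `|y|) * grad_l1 u y <= S) ->
  `|x| < 1 -> 0 < th -> th <= 1 / 8 ->
  forall l, l = th * (1 - `|x|) ->
  c0 * (l * `|D e u x|) <= 16 * m + 4 * (l ^+ 2 * (2 * V * S / (1 - `|x|))).
Proof.
move=> su V0 b1V b2V um eq gS x1 th0 th8 l lE.
have [dd ddE] : exists dd, dd = 1 - `|x| by exists (1 - `|x|).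
have dd0 : 0 < dd by rewrite ddE subr_gt0.
have dd1 : dd <= 1 by rewrite ddE lerBlDr lerDl.
have Qx : ball1 x by apply/ball1P; exact: ltW.
have l0 : 0 < l by rewrite lE -ddE mulr_gt0.
have l8 : l <= dd / 8.
  by move: th8; rewrite mul1r => th8; rewrite lE -ddE mulrC ler_wpM2l// ltW.
rewrite -ddE.
have H4 y : ball4 y -> ball4 (x + l *: y).
  move=> /ltW /(near_center x l0) yl; rewrite /ball4 /= (le_lt_trans yl)//.
  by move: l8 dd0 dd1; rewrite ddE; move: (`|x|) => r; clear; lra.
have near1 y : ball1 y -> `|x + l *: y| <= 1 - dd / 2.
  move=> /ball1P /(near_center x l0) yl; rewrite (le_trans yl)//.
  by move: l8 dd0; rewrite ddE; move: (`|x|) => r; clear; lra.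
have Q1 y : ball1 y -> ball1 (x + l *: y).
  by move=> /near1 yl; apply/ball1P; rewrite (le_trans yl)// lerBlDr lerDl divr_ge0// ltW.
have lapb y : ball1 y -> `|lap (fun y => u (x + l *: y)) y| <= l ^+ 2 * (2 * V * S / dd).
  move=> Qy; rewrite (lap_shift open_ball4 su H4 (ball1_sub4 Qy)) normrM (ger0_norm (sqr_ge0 l)).
  apply: ler_wpM2l; first exact: sqr_ge0.
  apply: (le_trans (drift_lap_bound V0 (b1V _ (Q1 _ Qy)) (b2V _ (Q1 _ Qy)) (eq _ (Q1 _ Qy)))).
  rewrite (_ : 2 * V * S / dd = V * (2 * S / dd)); last by ring.
  apply: ler_wpM2l => //; rewrite ler_pdivlMr//.
  have := gS _ (Q1 _ Qy); have := near1 _ Qy; have := grad_l1_ge0 u (x + l *: y).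
  move: (grad_l1 u _) (`|x + _|) => p r; clear - dd0 => p0 H1 H2.
  have : p * (dd / 2) <= p * (1 - r) by apply: ler_wpM2l => //; lra.
  by rewrite (mulrC p (1 - r)); lra.
have um' y : ball1 y -> `|u (x + l *: y)| <= m by move=> /Q1; exact: um.
have := @poisson_gradient e _ m _ (smooth_shift su H4) um' lapb.
rewrite (D_aff e su); last by rewrite scaler0 addr0; exact: ball1_sub4.
by rewrite scaler0 addr0 normrM (gtr0_norm l0).
Qed.

(** With th = k / (32 V) the term in S on the right is at most half of the left
    side and is absorbed. *)
Lemma gradient_step_arith (k V m S dd : R) : 0 < k -> 0 < V -> 0 < dd -> dd <= 1 ->
  0 <= S ->
  forall th, th = k / (32 * V) ->
  k * (th * S) <= 32 * m + 8 * ((th * dd) ^+ 2 * (2 * V * S / dd)) ->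
  S <= 64 * 32 / k ^+ 2 * (V * m).
Proof.
move=> k0 V0 dd0 dd1 S0 th thE H.
have V32 : 0 < 32 * V by rewrite mulr_gt0// ltr0n.
have th0 : 0 < th by rewrite thE divr_gt0.
have VE : V * th = k / 32 by rewrite thE; field; rewrite gt_eqF.
have [P PE] : exists P, P = th * S by exists (th * S).
have P0 : 0 <= P by rewrite PE mulr_ge0// ltW.
have E : (th * dd) ^+ 2 * (2 * V * S / dd) = 2 * (V * th) * P * dd.
  by rewrite PE; field; rewrite gt_eqF.
rewrite -PE E VE in H.
have Q1 : k * P * dd <= k * P by rewrite ler_piMr// mulr_ge0// ltW.
have H2 : k * P <= 64 * m.
  move: H Q1; rewrite (_ : 2 * (k / 32) * P * dd = (k * P * dd) / 16); last by field.
  by move: (k * P) (k * P * dd) => A B; clear; lra.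
have SE : S = P * (32 * V) / k.
  by rewrite PE thE; field; rewrite !gt_eqF.
rewrite (_ : 64 * 32 / k ^+ 2 * (V * m) = (64 * m) * (32 * V) / k ^+ 2); last by ring.
rewrite ler_pdivlMr ?exprn_gt0// SE (_ : P * _ / k * k ^+ 2 = (k * P) * (32 * V)).
  by rewrite ler_wpM2r// ltW.
by field; rewrite gt_eqF.
Qed.

Lemma two_steps (k th dd p r A m : R) :
  k * (th * dd * p) <= 16 * m + 4 * A -> k * (th * dd * r) <= 16 * m + 4 * A ->
  k * (th * (dd * (p + r))) <= 32 * m + 8 * A.
Proof.
rewrite (_ : k * (th * (dd * (p + r))) = k * (th * dd * p) + k * (th * dd * r)); last by ring.
by move: (k * (_ * p)) (k * (_ * r)) => X Y; lra.
Qed.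

(** The gradient weighted by the distance to the boundary has a maximum; at the
    maximum point, gradient_step at a scale of order 1 / V bounds it by itself
    with a small factor. *)
Lemma drift_gradient e u (b1 b2 : R * R -> R) m V : smooth_on ball4 u ->
  1 <= V -> (forall y, ball1 y -> `|b1 y| <= V) -> (forall y, ball1 y -> `|b2 y| <= V) ->
  (forall y, ball1 y -> `|u y| <= m) ->
  (forall y, ball1 y -> lap u y = b1 y * D true u y + b2 y * D false u y) ->
  `|D e u 0| <= 64 * 32 / c0 ^+ 2 * (V * m).
Proof.
move=> su V1 b1V b2V um eq.
have V0 : 0 < V by exact: lt_le_trans V1.
pose g y := (1 - `|y|) * grad_l1 u y.
have cgr : cont_on ball4 (grad_l1 u).
  have := smooth_cont (smooth_D true su); have := smooth_cont (smooth_D false su).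
  by move=> ? ?; rewrite /grad_l1; ct.
have cg : cont_on ball4 g.
  have cn : cont_on ball4 (fun y : R * R => `|y|) by move=> y _; exact: norm_continuous.
  by rewrite /g; ct.
have Q0 : ball1 (0 : R * R) by apply/ball1P; rewrite normr0.
have [|||ys /set_mem Qys max] := @compact_EVT_max (R * R)%type R g ball1.
- by exists 0.
- exact: rect_compact.
- by apply: cont_within cg => y; exact: ball1_sub4.
have gmax y : ball1 y -> g y <= g ys by move=> Qy; apply: max; exact: mem_set.
have ys1 : `|ys| <= 1 by exact/ball1P.
have S0 : 0 <= g ys by rewrite mulr_ge0 ?grad_l1_ge0// subr_ge0.
have m0 : 0 <= m by apply: le_trans (um 0 Q0).
suff H : g ys <= 64 * 32 / c0 ^+ 2 * (V * m).
  apply: le_trans H; apply: le_trans (gmax 0 Q0).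
  rewrite /g normr0 subr0 mul1r /grad_l1.
  by case: (e); [rewrite lerDl|rewrite lerDr].
have [yss1|yss1] := ltP `|ys| 1; last first.
  have -> : g ys = 0 by rewrite /g (@le_anti _ _ `|ys| 1) ?ys1// subrr mul0r.
  apply: mulr_ge0; first by apply: divr_ge0 (sqr_ge0 _); rewrite mulr_ge0// ler0n.
  exact: mulr_ge0 (ltW V0) m0.
have V32 : 0 < 32 * V by rewrite mulr_gt0// ltr0n.
have [th thE] : exists th : R, th = c0 / (32 * V) by exists (c0 / (32 * V)).
have th0 : 0 < th by rewrite thE; exact: divr_gt0 c0_gt0 V32.
have th8 : th <= 1 / 8.
  rewrite thE ler_pdivrMr//; apply: (le_trans c0_le4).
  by move: V1; clear; lra.
have main c := gradient_step c su (ltW V0) b1V b2V um eq gmax yss1 th0 th8 erefl.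
have dd0 : 0 < 1 - `|ys| by rewrite subr_gt0.
have dd1 : 1 - `|ys| <= 1 by rewrite lerBlDr lerDl.
apply: (gradient_step_arith c0_gt0 V0 dd0 dd1 S0 thE).
exact: two_steps (main true) (main false).
Qed.

(** Below the scale d the derivative of the kernel mean is bounded through D c g;
    above d a second integration by parts trades the derivative of g for a factor
    1 / t, whose integral is the logarithm. *)
Lemma log_gradient e c w g m M d : smooth_on ball4 w -> smooth_on ball4 g ->
  (forall y, ball4 y -> lap w y = D c g y) ->
  (forall y, ball1 y -> `|g y| <= m) -> 0 < d -> d <= 1 ->
  (forall y, `|y| <= d -> `|D c g y| <= M) ->
  c0 * `|D e w 0| <= bint (fun y => `|D e w y|) + 4 * M * d + 20 * m * - ln d.
Proof.
move=> sw sg wg gm d0 d1 dM.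
have sDw := smooth_D e sw. have sDg := smooth_D c sg.
have lapE y : ball4 y -> lap (D e w) y = D e (D c g) y.
  by move=> Oy; rewrite (lap_D e open_ball4 sw Oy); exact: D_eq open_ball4 wg Oy.
pose dJ t := - 6^-1 * bint (fun y => D c g (t *: y) * dk3 e y).
have HJ t : 0 <= t <= 1 -> is_derive t 1 (kmean (D e w)) (dJ t).
  by move=> /andP[t0 t1]; apply: kmean_derive_div sDw sDg lapE _; rewrite ger0_norm.
have norm6 (r : R) : `|- 6^-1 * r| = `|r| / 6.
  by rewrite normrM normrN (ger0_norm (_ : 0 <= 6^-1)) ?invr_ge0// mulrC.
have lt2 t : 0 <= t <= 1 -> `|t| < 2.
  by move=> /andP[t0 t1]; rewrite ger0_norm// (le_lt_trans t1)// ltr1n.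
have B1 : `|kmean (D e w) d - kmean (D e w) 0| <= 4 * M * (d - 0).
  have H01 s : 0 <= s <= d -> 0 <= s <= 1.
    by move=> /andP[-> sd]; rewrite (le_trans sd).
  apply: (@derive_bound _ dJ) (ltW d0) _ _ => s /[dup] /H01 s01 /andP[s0 sd].
    exact: HJ.
  rewrite /dJ norm6 ler_pdivrMr//.
  have cg := cont_smooth_scale sDg (lt2 _ s01).
  rewrite (_ : 4 * M * 6 = 4 * (M * 6)); last by ring.
  apply: bint_bound => [|y Qy]; first by ct.
  rewrite normrM ler_pM ?dk3_le//; apply: dM.
  move/ball1P : Qy => Qy; rewrite normrZ (ger0_norm s0) -[leRHS]mulr1.
  by rewrite ler_pM.
have [K KE] : exists K, K = 20 * m by exists (20 * m).
have B2 : `|kmean (D e w) 1 - kmean (D e w) d| <= K * ln 1 - K * ln d.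
  have H01 s : d <= s <= 1 -> 0 < s /\ 0 <= s <= 1.
    by move=> /andP[sd ->]; have s0 := lt_le_trans d0 sd; rewrite (ltW s0).
  apply: (@derive_le _ dJ (fun s => K * ln s) (fun s => K * s^-1) d 1 d1) => s.
  - by move=> /H01[_ /HJ].
  - by move=> /H01[s0 _]; exact: (is_deriveZ K (is_derive1_ln s0)).
  move=> /H01[s0 s01]; have cg := cont_smooth_scale sg (lt2 _ s01).
  have cDg := cont_smooth_scale sDg (lt2 _ s01).
  rewrite /dJ norm6 ler_pdivrMr//.
  have E : s * bint (fun y => D c g (s *: y) * dk3 e y) =
      - bint (fun y => g (s *: y) * ddk3 e c y).
    rewrite -(bint_ibpd3 e c sg (lt2 _ s01)) -bintZ; last by ct.
    by apply: bint_eq => y _; rewrite mulrA.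
  rewrite KE (_ : 20 * m / s * 6 = 4 * (m * 30) / s); last by ring.
  rewrite ler_pdivlMr// mulrC -{1}(gtr0_norm s0) -normrM E normrN.
  apply: bint_bound => [|y Qy]; first by ct.
  rewrite normrM ler_pM ?ddk3_le//; apply: gm; apply: scale_ball1 => //.
  by case/andP: s01 => ? ?; rewrite ger0_norm.
have B3 : `|kmean (D e w) 1| <= bint (fun y => `|D e w y|).
  have cDw : cont_on ball2 (D e w) by apply: cont_sub ball2_sub4 (smooth_cont sDw).
  have E : kmean (D e w) 1 = bint (fun y => D e w y * k2 y).
    by apply: bint_eq => y _; rewrite scale1r.
  rewrite E; apply: (le_trans (bint_abs _)); first by ct.
  apply: bint_le; [by ct|by ct|move=> y _].
  by rewrite normrM (ger0_norm (k2_ge0 y)) ler_piMr// k2_le1.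
have := ler_norm_trans B1 (ler_norm_trans B2 B3).
rewrite kmean0 normrM (ger0_norm (ltW c0_gt0)) mulrC subr0 ln1 mulr0 sub0r mulrN -KE.
by rewrite addrAC.
Qed.

End Gradient.

(** * Supremum estimate for divergence-free drifts *)

Section OneDim.
Context {R : realType}.
Notation mu := (@lebesgue_measure R).
Implicit Types (f df : R -> R) (a b s t : R).

Lemma second_derivative_test f df (dd eta : R) : 0 < eta ->
  (forall t, `|t| < eta -> is_derive t 1 f (df t)) -> is_derive (0 : R) 1 df dd ->
  (forall t, `|t| < eta -> f t <= f 0) -> df 0 = 0 /\ dd <= 0.
Proof.
move=> eta0 Hf Hdf fmax.
have e2 t : t \in `]- eta, eta[ -> `|t| < eta by rewrite in_itv/= ltr_norml.
have df0 : df 0 = 0.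
  have z : (0 : R) \in `]- eta, eta[ by rewrite in_itv/= oppr_lt0 eta0.
  have ee : - eta <= eta by rewrite ge0_cp// ltW.
  have H0 : is_derive (0 : R) 1 f 0.
    apply: (@derive1_at_max R f (- eta) eta 0 ee) => //.
      by move=> t /e2 /Hf [].
    by move=> t /e2 /fmax.
  have H1 : is_derive (0 : R) 1 f (df 0) by apply: Hf; rewrite normr0.
  by case: H0 => _ H0; case: H1 => _ H1; rewrite -H1 H0.
split => //; rewrite leNgt; apply/negP => dd0.
have [Hd Hv] := Hdf.
have lim : (fun h : R => h^-1 *: (df (h *: 1 + 0) - df 0)) @ 0^' --> dd.
  by rewrite -Hv; exact: Hd.
have : \forall h \near 0^', dd / 2 < h^-1 *: (df (h *: 1 + 0) - df 0).
  apply: (cvgr_gt _ lim); rewrite ltr_pdivrMr// ltr_pMr// ltr1n//.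
rewrite near_withinE => /nbhs_ballP[r /= r0 rP].
pose t := Num.min (r / 2) (eta / 2).
have t0 : 0 < t by rewrite lt_min !divr_gt0.
have tr : t < r by rewrite gt_min ltr_pdivrMr// ltr_pMr// ltr1n.
have te : t < eta by rewrite gt_min orbC ltr_pdivrMr// ltr_pMr// ltr1n.
have pos s : 0 < s -> s <= t -> 0 < df s.
  move=> s0 st; have := rP s; rewrite -ball_normE /= sub0r normrN gtr0_norm//.
  move=> /(_ (le_lt_trans st tr)) /(_ (lt0r_neq0 s0)).
  rewrite addr0 /GRing.scale/= mulr1 df0 subr0 => H.
  have : 0 < s^-1 * df s by apply: lt_trans H; exact: divr_gt0.
  by rewrite pmulr_rgt0// invr_gt0.
have b s : 0 <= s <= t -> `|s| < eta.
  by move=> /andP[s0 st]; rewrite ger0_norm// (le_lt_trans st).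
have [||c /[!in_itv]/= /andP[c0 ct] E] := @MVT R f df 0 t t0.
- by move=> s; rewrite in_itv/= => /andP[s0 st]; apply: Hf; apply: b; rewrite !ltW.
- apply: derivable_within_continuous => s; rewrite in_itv/= => /b/Hf; by case.
have := fmax t; rewrite gtr0_norm// => /(_ te); rewrite -subr_le0 E subr0.
by rewrite leNgt mulr_gt0// pos// ltW.
Qed.

Lemma Rintegral_cst_itv a b r : a <= b -> \int[mu]_(s in `[a, b]) r = r * (b - a).
Proof.
move=> ab; have E : mu `[a, b]%classic = (b - a)%:E.
  rewrite lebesgue_measure_itv/= lte_fin.
  move: ab; rewrite le_eqVlt => /orP[/eqP ->|ab]; first by rewrite ltxx subrr.
  by rewrite ab -EFinB.
rewrite Rintegral_cst//; change (r * fine (mu `[a, b]%classic) = r * (b - a)).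
by rewrite E.
Qed.

Lemma int_sub f a b a' b' : a <= a' -> b' <= b ->
  (forall s, a <= s <= b -> {for s, continuous f}) -> (forall s, a <= s <= b -> 0 <= f s) ->
  \int[mu]_(s in `[a', b']) f s <= \int[mu]_(s in `[a, b]) f s.
Proof.
move=> aa bb cf f0.
have sub : `[a', b']%classic `<=` `[a, b]%classic.
  by move=> s /=; rewrite !in_itv/= => /andP[? ?]; rewrite (le_trans aa)// (le_trans _ bb).
have intf := cont_integrable1 cf.
apply: fine_le.
- by apply: (integrable_fin_num (mu := mu)) => //; exact: integrableS intf.
- exact: (integrable_fin_num (mu := mu)).
apply: ge0_subset_integral => //.
by have /integrableP[] := intf.
Qed.

Lemma le_chain (x y A B : R) : y <= A -> x - y <= B -> x <= A + B.
Proof. lra. Qed.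

(** On an interval of length 1, f is at most its minimum plus its total variation,
    and the minimum is at most the mean. *)
Lemma line_sup f df a t : (forall s, a <= s <= a + 1 -> is_derive s 1 f (df s)) ->
  (forall s, a <= s <= a + 1 -> {for s, continuous df}) ->
  a <= t <= a + 1 ->
  f t <= \int[mu]_(s in `[a, a + 1]) f s + \int[mu]_(s in `[a, a + 1]) `|df s|.
Proof.
move=> Hf cdf tab.
have cf s : a <= s <= a + 1 -> {for s, continuous f}.
  move=> /Hf[H _]; apply: differentiable_continuous; exact/derivable1_diffP.
have aa : a <= a + 1 by rewrite lerDl.
have cadf s : a <= s <= a + 1 -> {for s, continuous (fun s => `|df s|)}.
  by move=> /cdf H; apply: cvg_norm.
have [t0 /[!in_itv]/= t0ab t0min] := EVT_min aa (cont_within1 cf).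
have m0 : f t0 <= \int[mu]_(s in `[a, a + 1]) f s.
  have -> : f t0 = \int[mu]_(s in `[a, a + 1]) (f t0).
    by rewrite Rintegral_cst_itv// addrAC subrr add0r mulr1.
  apply: le_Rintegral => //.
  - by apply: cont_integrable1 => s _; exact: cvg_cst.
  - exact: cont_integrable1.
have step s1 s2 : a <= s1 <= a + 1 -> a <= s2 <= a + 1 -> s1 < s2 ->
    `|f s2 - f s1| <= \int[mu]_(s in `[a, a + 1]) `|df s|.
  move=> /andP[s1a s1b] /andP[s2a s2b] s12.
  have sub s : s1 <= s <= s2 -> a <= s <= a + 1.
    by move=> /andP[? ?]; rewrite (le_trans s1a)// (le_trans _ s2b).
  have <- : \int[mu]_(s in `[s1, s2]) df s = f s2 - f s1.
    by apply: (ftc s12) => s /sub; [exact: Hf|exact: cdf].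
  apply: (le_trans (le_normr_Rintegral _ _)) => //.
    by apply: cont_integrable1 => s /sub; exact: cdf.
  exact: int_sub.
have H : f t - f t0 <= \int[mu]_(s in `[a, a + 1]) `|df s|.
  have [tt0|tt0|->] := ltgtP t t0.
  - by rewrite (le_trans (ler_norm _))// distrC step.
  - by rewrite (le_trans (ler_norm _))// step.
  - by rewrite subrr; apply: Rintegral_ge0.
exact: le_chain m0 H.
Qed.

End OneDim.

Section SupEstimate.
Context {R : realType}.
Notation mu := (@lebesgue_measure R).
Notation mu2 := (mu \x mu)%E.
Implicit Types (F G f g u w : R * R -> R) (x y z : R * R) (e c : bool).

Lemma pt_ball1 e (s t : R) : ball1 (pt e s t) <-> (-1 <= s <= 1 /\ -1 <= t <= 1).
Proof. by rewrite -(boxE e); case: e. Qed.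

(** Pigeonhole: if the line integrals were larger than 8 A for all s in an interval of
    length 1/4, the integral over the square would be at least 2 A. *)
Lemma good_line e F (A a : R) : cont_on ball2 F -> (forall y, ball1 y -> 0 <= F y) ->
  bint F <= A -> 0 < A -> -1 <= a -> a + 1 / 4 <= 1 ->
  exists2 s, a <= s <= a + 1 / 4 &
    \int[mu]_(t in `[- (1 / 2), - (1 / 2) + 1]) F (pt e s t) <= 8 * A.
Proof.
move=> cF F0 FA A0 a1 b1; apply: contrapT => H.
have big s : a <= s <= a + 1 / 4 ->
    8 * A <= \int[mu]_(t in `[- (1 / 2), - (1 / 2) + 1]) F (pt e s t).
  by move=> sab; rewrite leNgt; apply/negP => L; apply: H; exists s => //; exact: ltW.
have sub : box e a (a + 1 / 4) (- (1 / 2)) (- (1 / 2) + 1) `<=` ball1.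
  move=> y; have -> : y = pt e (co e y) (co (~~ e) y) by case: y => ? ?; case: (e).
  move=> /boxE[/andP[H1 H2] /andP[H3 H4]]; apply/pt_ball1.
  split; apply/andP; split; move: H1 H2 H3 H4 a1 b1; clear; lra.
have subO := subset_trans sub ball1_sub2.
have : 2 * A <= bint F.
  apply: (@le_trans _ _ (\int[mu2]_(y in box e a (a + 1 / 4) (- (1 / 2)) (- (1 / 2) + 1)) F y)).
    rewrite (fubini_box open_ball2 subO cF).
    apply: (@le_trans _ _ (\int[mu]_(s in `[a, (a + 1 / 4)]) (8 * A))).
      rewrite Rintegral_cst_itv ?lerDl ?divr_ge0//.
      by move: A0; clear; lra.
    apply: le_Rintegral => //.
    - by apply: cont_integrable1 => s _; exact: cvg_cst.
    - exact: (integrable_inner open_ball2 subO cF).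
  have iF := bint_integrable cF.
  apply: fine_le.
  - apply: (integrable_fin_num (mu := mu2)); first exact: measurable_box.
    by apply: integrableS iF => //; [exact: measurable_rect|exact: measurable_box].
  - by apply: (integrable_fin_num (mu := mu2)) => //; exact: measurable_rect.
  apply: ge0_subset_integral => //.
  - exact: measurable_box.
  - exact: measurable_rect.
  - by have /integrableP[] := iF.
by move: FA A0; clear; lra.
Qed.

Lemma max_arith (r1 r2 bt bf g1 g2 V eps lam E : R) : lam = V + 1 ->
  0 < lam -> 0 < eps -> 0 < E -> bt <= V ->
  0 <= r1 + r2 - (bt * g1 + bf * g2) ->
  g1 + eps * (lam * E) = 0 -> g2 + eps * 0 = 0 ->
  r1 + eps * (lam * (lam * E)) <= 0 -> r2 + eps * 0 <= 0 -> False.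
Proof.
move=> lE lam0 eps0 E0 bV; rewrite !mulr0 !addr0 => H0 H1 g20 H2 H3.
have X0 : 0 < eps * (lam * E) by rewrite !mulr_gt0.
have g1E : g1 = - (eps * (lam * E)) by move: H1; move: (eps * _) => x; lra.
have BX : bt * (eps * (lam * E)) <= V * (eps * (lam * E)) by rewrite ler_wpM2r// ltW.
move: H0; rewrite g20 mulr0 addr0 g1E mulrN opprK => H0.
move: H2; rewrite (_ : eps * (lam * (lam * E)) = V * (eps * (lam * E)) + eps * (lam * E)).
  move: H0 BX X0 H3; move: (eps * _) => z; move: (bt * z) (V * z) => x y; clear; lra.
by rewrite {1}lE; ring.
Qed.

Lemma itv_arith (s : R) : -1 / 2 <= s -> s <= -1 / 2 + 1 / 4 ->
  [/\ -1 <= s, s < 0 & - (1 / 2) <= s].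
Proof. by move=> *; split; lra. Qed.

Lemma itv_arith2 (s : R) : 1 / 4 <= s -> s <= 1 / 4 + 1 / 4 ->
  [/\ 0 < s, s <= 1 & s <= 1 / 2].
Proof. by move=> *; split; lra. Qed.

Lemma half_itv (r : R) : (- (1 / 2) <= r <= - (1 / 2) + 1) = (`|r| <= 1 / 2).
Proof. by rewrite ler_norml; apply/idP/idP => /andP[? ?]; apply/andP; split; lra. Qed.

Lemma half_le1 (s : R) : `|s| <= 1 / 2 -> -1 <= s <= 1.
Proof. by rewrite ler_norml => /andP[? ?]; apply/andP; split; lra. Qed.

Lemma line_arith (a s : R) : -1 / 2 <= a -> a + 1 / 4 <= 1 / 2 -> a <= s <= a + 1 / 4 ->
  `|s| <= 1 / 2.
Proof. by rewrite ler_norml => ? ? /andP[? ?]; apply/andP; split; lra. Qed.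

Lemma start_arith (a : R) : -1 / 2 <= a -> a + 1 / 4 <= 1 / 2 -> -1 <= a /\ a + 1 / 4 <= 1.
Proof. by move=> *; split; lra. Qed.

Lemma kap_half (y : R * R) : `|co true y| <= 1 / 2 -> `|co false y| <= 1 / 2 -> 1 / 8 <= k3 y.
Proof.
have sq (x : R) : `|x| <= 1 / 2 -> x ^+ 2 <= 1 / 4.
  move=> x12; rewrite -real_normK ?num_real// expr2.
  by rewrite (_ : 1 / 4 = 1 / 2 * (1 / 2)); [exact: ler_pM|field].
move=> /sq H1 /sq H2.
have kh : 1 / 2 <= kap y.
  by rewrite /kap /pos le_max; apply/orP; left; move: H1 H2; clear; lra.
rewrite /k3 (_ : 1 / 8 = (1 / 2) ^+ 3); last by field.
by rewrite lerXn2r ?nnegrE ?kap_ge0// divr_ge0.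
Qed.

Lemma energy_arith (d1 d2 m1 m2 L : R) : d1 <= 30 -> d2 <= 30 -> m1 <= L * 6 ->
  m2 <= L * 6 -> 1 <= L -> d1 + d2 + (m1 + m2) <= 72 * L.
Proof. lra. Qed.

Lemma mean_arith (X lam w K : R) : X <= 72 * K * lam * w -> w <= lam * w ->
  (1 + lam) * w + X <= (2 + 72 * K) * lam * w.
Proof.
rewrite (_ : (2 + 72 * K) * lam * w = 2 * (lam * w) + 72 * K * lam * w); last by ring.
rewrite (_ : (1 + lam) * w = w + lam * w); last by ring.
by move: (lam * w) (72 * K * lam * w) => x y; lra.
Qed.

Lemma line_arith2 (w d k : R) : 0 <= d -> 0 < w -> 1 / 8 <= k -> w + d <= 8 * (w + k * d).
Proof.
move=> d0 w0 k8; have : 1 / 8 * d <= k * d by rewrite ler_wpM2r.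
by move: (k * d) => x; lra.
Qed.

Lemma line_arith3 (I A : R) : I <= 8 * A -> 8 * I <= 64 * A.
Proof. lra. Qed.

(** Weak maximum principle on a rectangle around the origin.  Adding
    eps exp((V + 1) y_1) makes the inequality strict, which excludes interior
    maxima by the second derivative test; then eps tends to 0. *)
Lemma max_principle (W : R * R -> R) (dW ddW : bool -> R * R -> R) (b : bool -> R * R -> R)
    (V M s1 s2 t1 t2 : R) :
  cont_on ball2 W ->
  (forall e y, ball2 y -> is_derive y (ev e) W (dW e y)) ->
  (forall e y, ball2 y -> is_derive y (ev e) (dW e) (ddW e y)) ->
  (forall y, ball1 y -> b true y <= V) -> 0 <= V ->
  (forall y, ball1 y -> 0 <= ddW true y + ddW false y
     - (b true y * dW true y + b false y * dW false y)) ->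
  -1 <= s1 -> s1 < 0 -> 0 < s2 -> s2 <= 1 -> -1 <= t1 -> t1 < 0 -> 0 < t2 -> t2 <= 1 ->
  (forall t, t1 <= t <= t2 -> W (s1, t) <= M /\ W (s2, t) <= M) ->
  (forall s, s1 <= s <= s2 -> W (s, t1) <= M /\ W (s, t2) <= M) ->
  W 0 <= M.
Proof.
move=> cW HW HdW bV V0 sub h1 h2 h3 h4 k1 k2 k3 k4 Ms Mt.
pose lam := V + 1.
have lam0 : 0 < lam by rewrite ltr_wpDl.
pose E y : R := expR (lam * co true y).
have dE y : is_derive y (ev true) E (lam * E y).
  have H := is_deriveZ lam (is_derive_co true true y).
  have := is_derive_comp1 (is_derive_expR (lam * co true y)) H.
  by congr is_derive; rewrite /E /GRing.scale/= mulr1 mulrC.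
have dE2 y : is_derive y (ev false) E 0.
  have H := is_deriveZ lam (is_derive_co true false y).
  have := is_derive_comp1 (is_derive_expR (lam * co true y)) H.
  by congr is_derive; rewrite /GRing.scale/= !mulr0.
have EM y : ball1 y -> E y <= expR lam.
  move=> /(co_ball1 true) y1.
  have {}y1 : co true y <= 1 by exact: le_trans (ler_norm _) y1.
  by rewrite ler_expR ler_piMr// ltW.
have E0 y : 0 < E y by exact: expR_gt0.
have cE : cont_on ball2 E.
  apply: (@cont_comp1 R ball2 expR) => [|y _]; last exact: continuous_expR.
  by ct.
apply/ler_addgt0Pl => eps' eps'0.
pose eps := eps' / expR lam.
have eps0 : 0 < eps by rewrite divr_gt0 ?expR_gt0.
pose Z y := W y + eps * E y.
have cZ : cont_on ball2 Z by rewrite /Z; ct.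
pose K := rect s1 s2 t1 t2.
have KQ : K `<=` ball1.
  move=> y [/=]; rewrite !in_itv/= => /andP[? ?] /andP[? ?]; split; rewrite /= in_itv/=.
    by rewrite (le_trans h1)// (le_trans _ h4).
  by rewrite (le_trans k1)// (le_trans _ k4).
have K0 : K 0 by split; rewrite /= in_itv/= !ltW.
have [|||z /set_mem Kz zmax] := @compact_EVT_max (R * R)%type R Z K.
- by exists 0.
- exact: rect_compact.
- by apply: cont_within cZ => y /KQ/ball1_sub2.
have Zmax y : K y -> Z y <= Z z by move=> Ky; apply: zmax; exact: mem_set.
have Qz := KQ _ Kz.
have Wz : W z <= M.
  apply: contrapT => nWz.
  have [s1z s2z t1z t2z] : [/\ s1 < z.1, z.1 < s2, t1 < z.2 & z.2 < t2].
    move: Kz nWz; case: (z) => zs zt [/=]; rewrite !in_itv/= => sab tab nW.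
    by split; rewrite lt_neqAle; (case/andP: (sab) => ? ?; case/andP: (tab) => ? ?);
      apply/andP; split => //; apply/eqP => E'; apply: nW;
      first [rewrite -E'|rewrite E']; have [] := Ms _ tab; have [] := Mt _ sab.
  pose eta := Num.min (Num.min (z.1 - s1) (s2 - z.1)) (Num.min (z.2 - t1) (t2 - z.2)).
  have eta0 : 0 < eta by rewrite !lt_min !subr_gt0 s1z s2z t1z t2z.
  have [et1 et2 et3 et4] : [/\ eta <= z.1 - s1, eta <= s2 - z.1, eta <= z.2 - t1 & eta <= t2 - z.2].
    by rewrite !ge_min !lexx !orbT.
  have Kl e t : `|t| < eta -> K (z + t *: ev e).
    rewrite ltr_norml => /andP[l1 l2].
    by case: e; split; rewrite /= in_itv/= /GRing.scale/= ?mulr0 ?mulr1 ?addr0;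
      apply/andP; split; move: l1 l2 et1 et2 et3 et4 s1z s2z t1z t2z; clear; lra.
  have tests e (dE1 ddE : R * R -> R) :
      (forall y, ball2 y -> is_derive y (ev e) E (dE1 y)) ->
      (forall y, ball2 y -> is_derive y (ev e) dE1 (ddE y)) ->
      dW e z + eps * dE1 z = 0 /\ ddW e z + eps * ddE z <= 0.
    move=> H1 H2.
    have OKl t : `|t| < eta -> ball2 (z + t *: ev e) by move=> /Kl/KQ/ball1_sub2.
    have := @second_derivative_test R (fun t => Z (z + t *: ev e))
      (fun t => dW e (z + t *: ev e) + eps * dE1 (z + t *: ev e))
      (ddW e z + eps * ddE z) eta eta0.
    rewrite scale0r addr0; apply.
    - move=> t /OKl Ot.
      apply: (is_derive_line (f := Z)).
      exact: is_deriveD (HW _ _ Ot) (is_deriveZ eps (H1 _ Ot)).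
    - apply: (is_derive_line (f := fun y => dW e y + eps * dE1 y)).
      have Oz : ball2 z by exact: ball1_sub2.
      rewrite scale0r addr0.
      exact: is_deriveD (HdW _ _ Oz) (is_deriveZ eps (H2 _ Oz)).
    - by move=> t /(Kl e); exact: Zmax.
  have [T1 T2] := tests true (fun y => lam * E y) (fun y => lam * (lam * E y))
    (fun y _ => dE y) (fun y _ => is_deriveZ lam (dE y)).
  have [F1 F2] := tests false (fun=> 0) (fun=> 0) (fun y _ => dE2 y)
    (fun y _ => is_derive_cst (0 : R) y (ev false)).
  exact: (max_arith (erefl lam) lam0 eps0 (E0 z) (bV _ Qz) (sub _ Qz) T1 F1 T2 F2).
apply: (@le_trans _ _ (Z 0)); first by rewrite /Z lerDl mulr_ge0// ltW.
apply: (le_trans (Zmax _ K0)); rewrite /Z addrC lerD// /eps mulrAC.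
rewrite ler_pdivrMr ?expR_gt0// ler_wpM2l ?(ltW eps'0)//; exact: EM.
Qed.

(** The argument uses only the differential inequality subsol with its dissipation
    E, the vanishing divergence of b, and the bound amgm of dW by W and E; the
    powers that realise W and E are substituted afterwards. *)
Section AbstractDriftSup.
Variables (W E : R * R -> R) (dW ddW b : bool -> R * R -> R) (db : bool -> R * R -> R) (lam K : R).
Hypotheses (lam1 : 1 <= lam) (K0 : 0 < K).
Hypotheses (W0 : forall y, 0 < W y) (E0 : forall y, 0 <= E y).
Hypotheses (HW : forall e y, ball2 y -> is_derive y (ev e) W (dW e y))
  (HdW : forall e y, ball2 y -> is_derive y (ev e) (dW e) (ddW e y))
  (Hb : forall e y, ball2 y -> is_derive y (ev e) (b e) (db e y)).
Hypotheses (cW : cont_on ball2 W) (cE : cont_on ball2 E) (cdW : forall e, cont_on ball2 (dW e))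
  (cddW : forall e, cont_on ball2 (ddW e)) (cb : forall e, cont_on ball2 (b e))
  (cdb : forall e, cont_on ball2 (db e)).
Hypothesis subsol : forall y, ball2 y ->
  E y <= ddW true y + ddW false y - (b true y * dW true y + b false y * dW false y).
Hypothesis bdiv : forall y, ball2 y -> db true y + db false y = 0.
Hypothesis blam : forall e y, ball1 y -> `|b e y| <= lam ^+ 2.
Hypothesis amgm : forall e y, `|dW e y| <= lam * W y + K / lam * E y.

Let Wb := bint W.
Hypothesis Wb0 : 0 < Wb.

(** Testing subsol against k3.  All derivatives fall on k3, because b is divergence
    free; the drift term is therefore no worse than lam^2 times the mean of W. *)
Let energy : bint (fun y => E y * k3 y) <= 72 * lam ^+ 2 * Wb.
Proof.
have c1 := cW; have c2 := @cdW true; have c3 := @cdW false.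
have c4 := @cddW true; have c5 := @cddW false; have c6 := @cb true; have c7 := @cb false.
have c8 := @cdb true; have c9 := @cdb false; have c10 := cE.
have I1 e : bint (fun y => ddW e y * k3 y) = bint (fun y => W y * ddk3 e e y).
  have ? := @cdW e; have ? := @cddW e.
  transitivity (- bint (fun y => dW e y * dk3 e y)).
    apply: bint_ibp; [exact: HdW| |by ct|by ct|by ct|by ct|].
      by move=> y _; exact: is_derive_k3.
    by move=> y _; exact: k3_edge.
  apply/eqP; rewrite eqr_oppLR; apply/eqP.
  apply: bint_ibp; [exact: HW| |by ct|by ct|by ct|by ct|].
    by move=> y _; exact: is_derive_dk3.
  by move=> y _; exact: dk3_edge.
have I2 e : bint (fun y => dW e y * (b e y * k3 y)) =
    - bint (fun y => W y * (db e y * k3 y + b e y * dk3 e y)).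
  have ? := @cdW e; have ? := @cb e; have ? := @cdb e.
  apply: bint_ibp; [exact: HW| |by ct|by ct|by ct|by ct|].
    move=> y Oy; have := is_deriveM (Hb e Oy) (is_derive_k3 e y).
    by congr is_derive; rewrite /GRing.scale/= addrC (mulrC (k3 y)).
  by move=> y _ /k3_edge ->; rewrite mulr0.
apply: (@le_trans _ _ (bint (fun y => (ddW true y * k3 y + ddW false y * k3 y)
    - (dW true y * (b true y * k3 y) + dW false y * (b false y * k3 y))))).
  apply: bint_le; [by ct|by ct|move=> y Qy].
  rewrite (_ : _ - _ = (ddW true y + ddW false y - (b true y * dW true y + b false y * dW false y)) * k3 y).
    by rewrite ler_wpM2r ?k3_ge0// subsol//; exact: ball1_sub2.
  by move: (ddW true y) (ddW false y) (dW true y) (dW false y) (k3 y); clear => *; ring.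
rewrite bintB; [|by ct|by ct]; rewrite bintD; [|by ct|by ct]; rewrite bintD; [|by ct|by ct].
rewrite (I1 true) (I1 false) (I2 true) (I2 false).
pose G1 e y := W y * ddk3 e e y.
pose G2 e y := W y * (db e y * k3 y + b e y * dk3 e y).
have cG1 e : cont_on ball2 (G1 e) by rewrite /G1; ct.
have cG2 e : cont_on ball2 (G2 e) by have ? := @cb e; have ? := @cdb e; rewrite /G2; ct.
have g1 := @cG1 true; have g2 := @cG1 false; have g3 := @cG2 true; have g4 := @cG2 false.
rewrite -/(G1 true) -/(G1 false) -/(G2 true) -/(G2 false).
have -> : bint (G1 true) + bint (G1 false) - (- bint (G2 true) + - bint (G2 false)) =
    bint (fun y => (G1 true y + G1 false y) + (G2 true y + G2 false y)).
  rewrite (@bintD _ (fun y => G1 true y + G1 false y) (fun y => G2 true y + G2 false y)); [|by ct|by ct].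
  rewrite (@bintD _ (G1 true) (G1 false) g1 g2) (@bintD _ (G2 true) (G2 false) g3 g4).
  by rewrite -opprD opprK.
rewrite /Wb -bintZ; last by ct.
apply: bint_le; [by ct|by ct|move=> y Qy].
have dv := bdiv (ball1_sub2 Qy).
rewrite /G1 /G2 (_ : _ + _ = W y * (ddk3 true true y + ddk3 false false y +
    (db true y + db false y) * k3 y
    + (b true y * dk3 true y + b false y * dk3 false y))); last first.
  by move: (W y) (ddk3 _ _ y) (ddk3 _ _ y) (db _ y) (db _ y) (k3 y) (b _ y * _) (b _ y * _);
    clear => *; ring.
rewrite dv mul0r addr0 mulrC ler_wpM2r ?(ltW (W0 y))//.
have H1 e : ddk3 e e y <= 30 by rewrite (le_trans (ler_norm _))// ddk3_le.
have H2 e : b e y * dk3 e y <= lam ^+ 2 * 6.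
  by rewrite (le_trans (ler_norm _))// normrM ler_pM// ?blam ?dk3_le.
have H3 : 1 <= lam ^+ 2 by rewrite exprn_ege1.
exact: energy_arith (H1 true) (H1 false) (H2 true) (H2 false) H3.
Qed.

(** The weight 1 / lam on E in amgm turns the energy bound lam^2 into lam. *)
Let dW_mean e : bint (fun y => W y + k3 y * `|dW e y|) <= (2 + 72 * K) * lam * Wb.
Proof.
have lam0 : 0 < lam by exact: lt_le_trans lam1.
have c1 := cW; have c2 := @cdW e; have c3 := cE.
apply: (@le_trans _ _ (bint (fun y => (1 + lam) * W y + K / lam * (E y * k3 y)))).
  apply: bint_le; [by ct|by ct|move=> y Qy].
  rewrite mulrDl mul1r -addrA lerD2l.
  apply: (@le_trans _ _ (k3 y * (lam * W y + K / lam * E y))).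
    by rewrite ler_wpM2l ?k3_ge0// amgm.
  rewrite mulrDr; apply: lerD.
    by rewrite ler_piMl ?k3_le1// mulr_ge0 ?ltW.
  by rewrite mulrCA (mulrC (k3 y)).
rewrite bintD; [|by ct|by ct]; rewrite bintZ; last by ct.
rewrite bintZ; last by ct.
rewrite -/Wb.
have X1 : K / lam * bint (fun y => E y * k3 y) <= 72 * K * lam * Wb.
  apply: (@le_trans _ _ (K / lam * (72 * lam ^+ 2 * Wb))).
    by rewrite ler_wpM2l ?energy// divr_ge0 ?ltW.
  by rewrite le_eqVlt; apply/orP; left; apply/eqP; field; rewrite gt_eqF.
have X2 : Wb <= lam * Wb by rewrite ler_peMl// ltW.
exact: mean_arith X1 X2.
Qed.

(** On the inner square |y| <= 1/2 the kernel k3 is at least 1/8, so a good line for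
    W + k3 |dW| is one for W + |dW|, and line_sup applies. *)
Let line e (a : R) : -1 / 2 <= a -> a + 1 / 4 <= 1 / 2 ->
  exists2 s, a <= s <= a + 1 / 4 &
    forall t, - (1 / 2) <= t <= 1 / 2 -> W (pt e s t) <= 64 * (2 + 72 * K) * lam * Wb.
Proof.
move=> a1 a2.
have lam0 : 0 < lam by exact: lt_le_trans lam1.
have c1 := cW; have c2 := @cdW (~~ e).
pose F y := W y + k3 y * `|dW (~~ e) y|.
have cF : cont_on ball2 F by rewrite /F; ct.
have F0 y : ball1 y -> 0 <= F y.
  by move=> _; rewrite addr_ge0 ?(ltW (W0 y))// mulr_ge0 ?k3_ge0.
have A0 : 0 < (2 + 72 * K) * lam * Wb by rewrite !mulr_gt0// addr_gt0// mulr_gt0.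
have [b1 b2] := start_arith a1 a2.
have [s sa sP] := @good_line e F _ a cF F0 (dW_mean (~~ e)) A0 b1 b2.
exists s => // t; rewrite -ler_norml -half_itv => t1.
have s12 := line_arith a1 a2 sa.
have ptQ r : - (1 / 2) <= r <= - (1 / 2) + 1 -> ball1 (pt e s r).
  by rewrite half_itv => r2; apply/pt_ball1; split; exact: half_le1.
have k38 r : - (1 / 2) <= r <= - (1 / 2) + 1 -> 1 / 8 <= k3 (pt e s r).
  by rewrite half_itv => r2; apply: kap_half; case: (e).
have Dl (r : R) : - (1 / 2) <= r <= - (1 / 2) + 1 ->
    is_derive r 1 (fun t => W (pt e s t)) (dW (~~ e) (pt e s r)).
  move=> /ptQ/ball1_sub2 Or.
  have ptE t' : pt e s t' = pt e s 0 + t' *: ev (~~ e).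
    by case: (e); rewrite /pt /ev /e1 /e2 /=; apply: injective_projections;
      rewrite /= /GRing.scale/= ?mulr0 ?mulr1 ?addr0 ?add0r.
  rewrite (_ : (fun t => _) = (fun t : R => W (pt e s 0 + t *: ev (~~ e)))); last first.
    by apply/funext => t'; rewrite ptE.
  by apply: is_derive_line; rewrite -ptE; exact: HW.
have cl g (r : R) : cont_on ball2 g -> - (1 / 2) <= r <= - (1 / 2) + 1 ->
    {for r, continuous (fun t => g (pt e s t))}.
  by move=> cg /ptQ/ball1_sub2 Or; exact: cont_pt cg Or.
apply: (le_trans (line_sup Dl _ t1)); first by move=> r; exact: cl.
have i1 := cont_integrable1 (fun r => @cl _ r c1).
have cF' : cont_on ball2 (fun y => `|dW (~~ e) y|) by ct.
have i2 := cont_integrable1 (fun r => @cl _ r cF').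
have i3 := cont_integrable1 (fun r => @cl _ r cF).
rewrite -RintegralD//.
apply: (@le_trans _ _ (\int[mu]_(t in `[- (1 / 2), - (1 / 2) + 1]) (8 * F (pt e s t)))).
  apply: le_Rintegral => //.
  - apply: cont_integrable1 => r rr.
    apply: (@cl (fun y => W y + `|dW (~~ e) y|)) => //; by ct.
  - apply: cont_integrable1 => r rr.
    apply: (@cl (fun y => 8 * F y)) => //; by ct.
  move=> r; rewrite /= in_itv/= => rr; rewrite /F.
  exact: line_arith2 (normr_ge0 _) (W0 _) (k38 r rr).
rewrite RintegralZl//.
by move: sP => /line_arith3; rewrite !mulrA.
Qed.

Lemma abstract_drift_sup : W 0 <= 64 * (2 + 72 * K) * lam * Wb.
Proof.
have q1 : -1 / 2 <= -1 / 2 :> R by [].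
have q2 : -1 / 2 + 1 / 4 <= 1 / 2 :> R by lra.
have q3 : -1 / 2 <= 1 / 4 :> R by lra.
have q4 : 1 / 4 + 1 / 4 <= 1 / 2 :> R by lra.
have [s1 /andP[s1a s1b] S1] := line true q1 q2.
have [s2 /andP[s2a s2b] S2] := line true q3 q4.
have [t1 /andP[t1a t1b] T1] := line false q1 q2.
have [t2 /andP[t2a t2b] T2] := line false q3 q4.
have [s11 s12 s13] := itv_arith s1a s1b.
have [t11 t12 t13] := itv_arith t1a t1b.
have [s21 s22 s23] := itv_arith2 s2a s2b.
have [t21 t22 t23] := itv_arith2 t2a t2b.
apply: (@max_principle W dW ddW b (lam ^+ 2) _ s1 s2 t1 t2 cW HW HdW _ (sqr_ge0 _) _
  s11 s12 s21 s22 t11 t12 t21 t22).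
- by move=> y Qy; rewrite (le_trans (ler_norm _))// blam.
- by move=> y Qy; apply: le_trans (E0 y) (subsol _); exact: ball1_sub2.
- move=> t /andP[h1 h2].
  have h : - (1 / 2) <= t <= 1 / 2 by rewrite (le_trans t13)// (le_trans h2).
  by split; [exact: S1|exact: S2].
- move=> s /andP[h1 h2].
  have h : - (1 / 2) <= s <= 1 / 2 by rewrite (le_trans s13)// (le_trans h2).
  by split; [exact: T1|exact: T2].
Qed.

End AbstractDriftSup.

(** Instantiation with W = (u^2 + del)^p.  The shift by del > 0 keeps the powers
    smooth at the zeros of u. *)
Section DriftSup.
Variables (u : R * R -> R) (b : bool -> R * R -> R) (p del lam : R).
Hypotheses (su : smooth_on ball4 u) (sb : forall e, smooth_on ball4 (b e)).
Hypotheses (p1 : 1 < p) (del0 : 0 < del) (lam1 : 1 <= lam).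
Hypothesis ueq : forall y, ball2 y ->
  lap u y = b true y * D true u y + b false y * D false u y.
Hypothesis bdiv : forall y, ball2 y -> D true (b true) y + D false (b false) y = 0.
Hypothesis blam : forall e y, ball1 y -> `|b e y| <= lam ^+ 2.

Let S y := u y ^+ 2 + del.
Let W y := S y `^ p.
Let dW e y := 2 * p * (S y `^ (p - 1) * (u y * D e u y)).
Let ddW e y := 2 * p * ((p - 1) * S y `^ (p - 2) * (2 * (u y * D e u y)) * (u y * D e u y)
   + S y `^ (p - 1) * (D e u y * D e u y + u y * D e (D e u) y)).
Let E y := 2 * p * S y `^ (p - 1) * (D true u y ^+ 2 + D false u y ^+ 2).

Let S0 y : 0 < S y.
Proof. by rewrite /S ltr_wpDl// sqr_ge0. Qed.

Let du e y : ball2 y -> is_derive y (ev e) u (D e u y).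
Proof. by move=> /ball2_sub4; exact: smooth_derive. Qed.

Let dSS e y : ball2 y -> is_derive y (ev e) S (2 * (u y * D e u y)).
Proof.
move=> Oy; have := is_deriveD (is_deriveM (du e Oy) (du e Oy)) (is_derive_cst del y (ev e)).
by congr is_derive; rewrite /GRing.scale/=; ring.
Qed.

Let dpow (a : R) e y : ball2 y ->
  is_derive y (ev e) (fun y => S y `^ a) (a * S y `^ (a - 1) * (2 * (u y * D e u y))).
Proof.
move=> Oy.
have H : is_derive (S y) 1 (fun x : R => x `^ a) (a * S y `^ (a - 1)).
  exact: is_derive1_powR (S0 y).
exact: is_derive_comp1 H (dSS e Oy).
Qed.

Let HW e y : ball2 y -> is_derive y (ev e) W (dW e y).
Proof.
by move=> Oy; have := dpow p e Oy; congr is_derive; rewrite /dW; ring.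
Qed.

Let HdW e y : ball2 y -> is_derive y (ev e) (dW e) (ddW e y).
Proof.
move=> Oy.
have H := is_deriveM (du e Oy) (smooth_derive e (smooth_D e su) (ball2_sub4 Oy)).
have := is_deriveZ (2 * p) (is_deriveM (dpow (p - 1) e Oy) H).
congr is_derive; rewrite /ddW /GRing.scale/= (_ : p - 1 - 1 = p - 2); last by ring.
rewrite ?mulrfctE; ring.
Qed.

Let cu : cont_on ball2 u.
Proof. exact: cont_sub ball2_sub4 (smooth_cont su). Qed.
Let cDu e : cont_on ball2 (D e u).
Proof. exact: cont_sub ball2_sub4 (smooth_cont (smooth_D e su)). Qed.
Let cDDu e : cont_on ball2 (D e (D e u)).
Proof. exact: cont_sub ball2_sub4 (smooth_cont (smooth_D e (smooth_D e su))). Qed.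
Let cb e : cont_on ball2 (b e).
Proof. exact: cont_sub ball2_sub4 (smooth_cont (sb e)). Qed.
Let cDb e : cont_on ball2 (D e (b e)).
Proof. exact: cont_sub ball2_sub4 (smooth_cont (smooth_D e (sb e))). Qed.

Let cpow (a : R) : cont_on ball2 (fun y => S y `^ a).
Proof.
apply: (@cont_comp1 R ball2 (fun x : R => x `^ a)) => [|y _]; first by have := cu => ?; rewrite /S; ct.
have [H _] := is_derive1_powR a (S0 y).
by apply: differentiable_continuous; exact/derivable1_diffP.
Qed.

Let cW : cont_on ball2 W. Proof. exact: cpow. Qed.
Let cdW e : cont_on ball2 (dW e).
Proof. by have := cu; have := @cDu e; have := @cpow (p - 1) => ? ? ?; rewrite /dW; ct. Qed.
Let cddW e : cont_on ball2 (ddW e).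
Proof.
by have := cu; have := @cDu e; have := @cDDu e; have := @cpow (p - 1); have := @cpow (p - 2);
  move=> ? ? ? ? ?; rewrite /ddW; ct.
Qed.
Let cE : cont_on ball2 E.
Proof.
by have := @cDu true; have := @cDu false; have := @cpow (p - 1) => ? ? ?; rewrite /E; ct.
Qed.

Let W0 y : 0 < W y. Proof. exact: powR_gt0. Qed.
Let E0 y : 0 <= E y.
Proof.
rewrite /E mulr_ge0 ?addr_ge0 ?sqr_ge0// mulr_ge0 ?powR_ge0// mulr_ge0// ltW//.
exact: lt_trans p1.
Qed.

(** The equation cancels second derivatives against the drift; what is left beyond E
    is 4 p (p - 1) S^(p-2) u^2 |grad u|^2 >= 0. *)
Let subsol y : ball2 y ->
  E y <= ddW true y + ddW false y - (b true y * dW true y + b false y * dW false y).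
Proof.
move=> Oy; have := ueq Oy; rewrite /lap /ddW /dW /E.
have pp : 0 <= S y `^ (p - 2) by exact: powR_ge0.
move: (S y `^ (p - 1)) (S y `^ (p - 2)) pp (b true y) (b false y) (u y) (D true u y) (D false u y)
  (D true (D true u) y) (D false (D false u) y) => A B B0 bt bf v v1 v2 v11 v22 eq.
have -> : v22 = bt * v1 + bf * v2 - v11 by rewrite -eq; clear; ring.
clear - p1 B0.
rewrite -subr_ge0.
set X := (X in 0 <= X).
have -> : X = 4 * (p * (p - 1) * B * (v ^+ 2 * (v1 ^+ 2 + v2 ^+ 2))) by rewrite /X; ring.
have p0 : 0 <= p by rewrite ltW// (lt_trans _ p1).
apply: mulr_ge0; first exact: ler0n.
apply: mulr_ge0; last exact: mulr_ge0 (sqr_ge0 _) (addr_ge0 (sqr_ge0 _) (sqr_ge0 _)).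
by apply: mulr_ge0 B0; apply: mulr_ge0 => //; rewrite subr_ge0 ltW.
Qed.

Let amgm e y : `|dW e y| <= lam * W y + p / 2 / lam * E y.
Proof.
have lam0 : 0 < lam by exact: lt_le_trans lam1.
have p0 : 0 < p by exact: lt_trans p1.
have WE : W y = S y `^ (p - 1) * S y.
  rewrite /W -{3}(@powRr1 _ (S y)) ?(ltW (S0 y))// -powRD ?subrK//.
  by rewrite gt_eqF ?S0// implybT.
have Ee : 2 * p * S y `^ (p - 1) * D e u y ^+ 2 <= E y.
  rewrite /E ler_wpM2l//.
    by rewrite mulr_ge0 ?powR_ge0// mulr_ge0// ltW.
  by case: (e); [rewrite lerDl sqr_ge0|rewrite lerDr sqr_ge0].
apply: (@le_trans _ _ (lam * W y + p / 2 / lam * (2 * p * S y `^ (p - 1) * D e u y ^+ 2))); last first.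
  by rewrite lerD2l ler_wpM2l// divr_ge0 ?divr_ge0 ?ltW.
have A0 : 0 <= S y `^ (p - 1) by exact: powR_ge0.
rewrite WE /dW normrM (ger0_norm (_ : 0 <= 2 * p)); last by rewrite mulr_ge0// ltW.
rewrite normrM (ger0_norm A0) normrM.
have -> : lam * (S y `^ (p - 1) * S y) + p / 2 / lam * (2 * p * S y `^ (p - 1) * D e u y ^+ 2)
   = S y `^ (p - 1) * (lam * S y + p ^+ 2 / lam * D e u y ^+ 2).
  by field; rewrite gt_eqF.
rewrite mulrCA ler_wpM2l//.
have uS : `|u y| ^+ 2 <= S y by rewrite real_normK ?num_real// /S lerDl ltW.
apply: (@le_trans _ _ (lam * `|u y| ^+ 2 + p ^+ 2 / lam * `|D e u y| ^+ 2)); last first.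
  by rewrite [in leLHS](@real_normK _ (D e u y)) ?num_real// lerD2r ler_wpM2l// ltW.
move: (`|u y|) (`|D e u y|) => v w; rewrite -subr_ge0.
have -> : lam * v ^+ 2 + p ^+ 2 / lam * w ^+ 2 - 2 * p * (v * w) = (lam * v - p * w) ^+ 2 / lam.
  by field; rewrite gt_eqF.
by rewrite divr_ge0 ?sqr_ge0// ltW.
Qed.

Let Wb0 : 0 < bint W.
Proof.
apply: (@lt_le_trans _ _ (4 * del `^ p)).
  by rewrite mulr_gt0 ?powR_gt0.
rewrite -bint_cst; apply: bint_le; [by ct|exact: cW|move=> y _].
rewrite /W ge0_ler_powR ?nnegrE ?(ltW del0) ?(ltW (S0 y))//.
  by rewrite ltW// (lt_trans _ p1).
by rewrite /S lerDr sqr_ge0.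
Qed.

Lemma drift_sup : (u 0 ^+ 2 + del) `^ p <=
  64 * (2 + 36 * p) * lam * bint (fun y => (u y ^+ 2 + del) `^ p).
Proof.
have K0 : 0 < p / 2 by rewrite divr_gt0// (lt_trans _ p1).
have := @abstract_drift_sup W E dW ddW b (fun e => D e (b e)) lam (p / 2) lam1 K0 W0 E0 HW HdW
  (fun e y Oy => smooth_derive e (sb e) (ball2_sub4 Oy)) cW cE (@cdW) (@cddW) (@cb) (@cDb) subsol bdiv blam amgm Wb0.
by rewrite (_ : 72 * (p / 2) = 36 * p)//; field.
Qed.

End DriftSup.
End SupEstimate.

(** * The Navier-Stokes system *)

Section Geometry.
Context {R : realType}.
Implicit Types (x y z : R * R).

Lemma norm_le_enorm x : `|x| <= enorm x.
Proof.
rewrite /enorm prod_normE/= ge_max; apply/andP; split.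
  by rewrite -sqrtr_sqr ler_wsqrtr// lerDl sqr_ge0.
by rewrite -sqrtr_sqr ler_wsqrtr// lerDr sqr_ge0.
Qed.

Lemma enorm_le_norm x : enorm x <= 2 * `|x|.
Proof.
have -> : 2 * `|x| = Num.sqrt ((2 * `|x|) ^+ 2) by rewrite sqrtr_sqr ger0_norm// mulr_ge0.
rewrite /enorm ler_wsqrtr//.
have H1 : `|x.1| <= `|x| by rewrite prod_normE/= le_max lexx.
have H2 : `|x.2| <= `|x| by rewrite prod_normE/= le_max lexx orbT.
have sq (a b : R) : `|a| <= b -> a ^+ 2 <= b ^+ 2.
  by move=> ab; rewrite -real_normK ?num_real// lerXn2r ?nnegrE// (le_trans _ ab).
have := sq _ _ H1; have := sq _ _ H2; have := sqr_ge0 (`|x|).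
rewrite exprMn; move: (`|x| ^+ 2) (x.1 ^+ 2) (x.2 ^+ 2) => a b c; clear.
by rewrite (_ : 2 ^+ 2 = 4); [lra|ring].
Qed.

Lemma continuous_enorm : continuous (enorm : R * R -> R).
Proof.
move=> x; apply: (@continuous_comp _ _ _ (fun x : R * R => x.1 ^+ 2 + x.2 ^+ 2) Num.sqrt).
  have H : cont_on setT (fun x : R * R => co true x ^+ 2 + co false x ^+ 2) by ct.
  exact: H.
exact: sqrt_continuous.
Qed.

Lemma open_exterior (r0 : R) : open (exterior r0).
Proof.
rewrite (_ : exterior r0 = enorm @^-1` [set t | r0 < t])//.
by apply: open_comp; [move=> x _; exact: continuous_enorm|exact: open_gt].
Qed.

Lemma exterior_norm (r0 : R) x : r0 < `|x| -> exterior r0 x.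
Proof. by move=> H; rewrite /exterior /=; exact: lt_le_trans H (norm_le_enorm x). Qed.

End Geometry.

Section Algebra.
Context {R : comRingType}.

Lemma mom_arith (l a b c d e f g h q : R) :
  - l + (a * b + c * d + (e * f + g * h)) + q = 0 ->
  - l + (d * c + a * b + (h * g + e * f)) + q = 0.
Proof. by move=> <-; ring. Qed.

Lemma vort_arith (L1 L2 P P' a1 a2 a2' a3 a3' a4 b1 b2 b3 b4 v1 v2 : R) :
  - L1 + (b2 * b1 + v1 * a2' + (b4 * b2 + v2 * a4)) + P' = 0 ->
  - L2 + (b1 * b3 + v1 * a1 + (b3 * b4 + v2 * a3')) + P = 0 ->
  b1 + b4 = 0 -> P' = P -> a2' = a2 -> a3' = a3 ->
  L2 - L1 = v1 * (a1 - a2) + v2 * (a3 - a4).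
Proof.
move=> M1 M2 B EP E2 E3; rewrite EP E2 in M1; rewrite E3 in M2.
have -> : L2 - L1 = L2 - L1 + (- L2 + (b1 * b3 + v1 * a1 + (b3 * b4 + v2 * a3)) + P)
    - (- L1 + (b2 * b1 + v1 * a2 + (b4 * b2 + v2 * a4)) + P) by rewrite M1 M2 addr0 subr0.
have -> : b4 = - b1 by rewrite -[LHS](addKr b1) B addr0.
ring.
Qed.

End Algebra.

Section NavierStokes.
Context {R : realType}.
Variables (r0 : R) (v : R * R -> R * R) (p : R * R -> R).
Hypothesis hNS : smooth_stationary_NS (exterior r0) v p.
Implicit Types (x y z : R * R).

Let U := exterior r0.
Let oU : open U. Proof. exact: open_exterior. Qed.

Definition vel (j : bool) : R * R -> R := if j then comp1 v else comp2 v.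

Lemma smooth_vel j : smooth_on U (vel j).
Proof. by case: hNS => s1 s2 _ _ _ _; case: j. Qed.

Lemma vorticityE x : vorticity v x = D true (vel false) x - D false (vel true) x.
Proof. by []. Qed.

Lemma divergence0 x : U x -> D true (vel true) x + D false (vel false) x = 0.
Proof. by case: hNS => _ _ _ _ _ H /H. Qed.

Lemma smooth_vorticity : smooth_on U (vorticity v).
Proof.
apply: smooth_eq (smooth_lin 1 (-1) oU (smooth_D true (smooth_vel false))
  (smooth_D false (smooth_vel true))) => // x _.
by rewrite vorticityE mul1r mulN1r.
Qed.

Lemma D_vorticity e x : U x ->
  D e (vorticity v) x = D e (D true (vel false)) x - D e (D false (vel true)) x.
Proof.
move=> Ux.
have E z : U z -> vorticity v z = 1 * D true (vel false) z + (-1) * D false (vel true) z.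
  by rewrite vorticityE mul1r mulN1r.
rewrite (D_eq e oU E Ux) (D_lin e 1 (-1) (smooth_D true (smooth_vel false)) (smooth_D false (smooth_vel true)) Ux).
by rewrite mul1r mulN1r.
Qed.

Lemma DD_vorticity e c x : U x -> D c (D e (vorticity v)) x =
  D c (D e (D true (vel false))) x - D c (D e (D false (vel true))) x.
Proof.
move=> Ux.
have E z : U z -> D e (vorticity v) z =
    1 * D e (D true (vel false)) z + (-1) * D e (D false (vel true)) z.
  by move=> Uz; rewrite D_vorticity// mul1r mulN1r.
rewrite (D_eq c oU E Ux).
rewrite (D_lin c 1 (-1) (smooth_D e (smooth_D true (smooth_vel false)))
  (smooth_D e (smooth_D false (smooth_vel true))) Ux).
by rewrite mul1r mulN1r.
Qed.

Lemma lap_vorticity x : U x ->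
  lap (vorticity v) x = D true (lap (vel false)) x - D false (lap (vel true)) x.
Proof.
move=> Ux; rewrite {1}/lap (DD_vorticity true true Ux) (DD_vorticity false false Ux).
rewrite -(lap_D true oU (smooth_vel false) Ux) -(lap_D false oU (smooth_vel true) Ux).
by rewrite /lap opprD addrACA.
Qed.

Lemma momentum j x : U x ->
  - lap (vel j) x + (vel true x * D true (vel j) x + vel false x * D false (vel j) x) + D j p x = 0.
Proof.
by case: hNS => _ _ _ m1 m2 _ Ux; case: j; [exact: m1|exact: m2].
Qed.

Lemma D_momentum e j x : U x ->
  - D e (lap (vel j)) x + (D e (vel true) x * D true (vel j) x + vel true x * D e (D true (vel j)) x
   + (D e (vel false) x * D false (vel j) x + vel false x * D e (D false (vel j)) x)) + D e (D j p) x = 0.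
Proof.
move=> Ux.
have sp : smooth_on U p by case: hNS.
have sv := smooth_vel.
have d1 := smooth_derive e (smooth_lap oU (sv j)) Ux.
have d2 := smooth_derive e (sv true) Ux.
have d3 := smooth_derive e (sv false) Ux.
have d4 := smooth_derive e (smooth_D true (sv j)) Ux.
have d5 := smooth_derive e (smooth_D false (sv j)) Ux.
have d6 := smooth_derive e (smooth_D j sp) Ux.
have H := is_deriveD (is_deriveD (is_deriveN d1) (is_deriveD (is_deriveM d2 d4) (is_deriveM d3 d5))) d6.
have Z : is_derive x (ev e) (fun z : R * R =>
    - lap (vel j) z + (vel true z * D true (vel j) z + vel false z * D false (vel j) z) + D j p z) 0.
  apply: (@near_eq_is_derive _ _ _ (fun=> 0)).
  have : nbhs x U by exact: open_nbhs_nbhs.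
  by apply: filterS => z Uz; rewrite momentum.
case: H => _ H; case: Z => _ Z.
exact: mom_arith (etrans (esym H) Z).
Qed.

(** The curl of the momentum equations: mixed derivatives of p cancel by symmetry, and
    the quadratic first-order terms add up to the vorticity times the
    divergence. *)
Lemma vorticity_eq x : U x ->
  lap (vorticity v) x = vel true x * D true (vorticity v) x + vel false x * D false (vorticity v) x.
Proof.
move=> Ux; rewrite (lap_vorticity Ux) (D_vorticity true Ux) (D_vorticity false Ux).
have sp : smooth_on U p by case: hNS.
exact: vort_arith (D_momentum false true Ux) (D_momentum true false Ux) (divergence0 Ux)
  (schwarz false true oU sp Ux) (schwarz false true oU (smooth_vel true) Ux)
  (schwarz true false oU (smooth_vel false) Ux).
Qed.

Lemma lap_velocity1 x : U x -> lap (vel true) x = - D false (vorticity v) x.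
Proof.
move=> Ux; rewrite (D_vorticity false Ux) /lap opprB.
have sv := smooth_vel.
have E z : U z -> D true (vel true) z = -1 * D false (vel false) z + 0 * D false (vel false) z.
  by move=> /divergence0/eqP; rewrite addr_eq0 => /eqP ->; rewrite mul0r addr0 mulN1r.
rewrite (D_eq true oU E Ux) (D_lin true _ _ (smooth_D false (sv false)) (smooth_D false (sv false)) Ux).
rewrite mul0r addr0 mulN1r (schwarz true false oU (sv false) Ux).
by rewrite addrC.
Qed.

Lemma lap_velocity2 x : U x -> lap (vel false) x = D true (vorticity v) x.
Proof.
move=> Ux; rewrite (D_vorticity true Ux) /lap.
have sv := smooth_vel.
have E z : U z -> D false (vel false) z = -1 * D true (vel true) z + 0 * D true (vel true) z.
  by move=> /divergence0/eqP; rewrite addrC addr_eq0 => /eqP ->; rewrite mul0r addr0 mulN1r.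
rewrite (D_eq false oU E Ux) (D_lin false _ _ (smooth_D true (sv true)) (smooth_D true (sv true)) Ux).
by rewrite mul0r addr0 mulN1r (schwarz false true oU (sv true) Ux).
Qed.

Lemma cont_grad_norm : cont_on U (grad_norm v).
Proof.
apply: (@cont_comp1 R U Num.sqrt); last by move=> y _; exact: sqrt_continuous.
have c e j := smooth_cont (smooth_D e (smooth_vel j)).
have c1 := c true true; have c2 := c true false; have c3 := c false true; have c4 := c false false.
change (cont_on U (fun x => D true (vel true) x ^+ 2 + D false (vel true) x ^+ 2
  + D true (vel false) x ^+ 2 + D false (vel false) x ^+ 2)).
by ct.
Qed.

End NavierStokes.

Section SumsOfSquares.
Context {R : realFieldType}.

Lemma sum4_ge (a b c d : R) : 0 <= a -> 0 <= b -> 0 <= c -> 0 <= d ->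
  [/\ a <= a + b + c + d, b <= a + b + c + d, c <= a + b + c + d & d <= a + b + c + d].
Proof. by move=> *; split; lra. Qed.

Lemma sum4_le (a b c d m : R) : a <= m -> b <= m -> c <= m -> d <= m ->
  a + b + c + d <= 4 * m.
Proof. lra. Qed.

Lemma curl_le (a b c d : R) : (c - b) ^+ 2 <= 2 * (a ^+ 2 + b ^+ 2 + c ^+ 2 + d ^+ 2).
Proof.
rewrite -subr_ge0 (_ : _ - _ = 2 * a ^+ 2 + 2 * d ^+ 2 + (c + b) ^+ 2); last by ring.
by rewrite !addr_ge0 ?sqr_ge0// mulr_ge0 ?sqr_ge0.
Qed.

End SumsOfSquares.

Section GradNorm.
Context {R : realType}.
Variables (v : R * R -> R * R).
Implicit Types (x y z : R * R).

Lemma grad_normE x : grad_norm v x = Num.sqrt (D true (vel v true) x ^+ 2 + D false (vel v true) x ^+ 2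
  + D true (vel v false) x ^+ 2 + D false (vel v false) x ^+ 2).
Proof. by []. Qed.

Lemma grad_norm_ge0 x : 0 <= grad_norm v x.
Proof. exact: sqrtr_ge0. Qed.

Lemma grad_norm_sqr x : grad_norm v x ^+ 2 = D true (vel v true) x ^+ 2 + D false (vel v true) x ^+ 2
  + D true (vel v false) x ^+ 2 + D false (vel v false) x ^+ 2.
Proof. by rewrite grad_normE sqr_sqrtr// !addr_ge0// sqr_ge0. Qed.

Lemma D_le_grad_norm e j x : `|D e (vel v j) x| <= grad_norm v x.
Proof.
rewrite -sqrtr_sqr grad_normE ler_wsqrtr//.
have [] := sum4_ge (sqr_ge0 (D true (vel v true) x)) (sqr_ge0 (D false (vel v true) x))
  (sqr_ge0 (D true (vel v false) x)) (sqr_ge0 (D false (vel v false) x)).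
move=> h1 h2 h3 h4; case: e; case: j; [exact: h1|exact: h3|exact: h2|exact: h4].
Qed.

Lemma vorticity_sqr_le x : vorticity v x ^+ 2 <= 2 * grad_norm v x ^+ 2.
Proof.
by rewrite grad_norm_sqr vorticityE; exact: curl_le.
Qed.

Lemma grad_norm_le x (M : R) : (forall e j, `|D e (vel v j) x| <= M) -> grad_norm v x <= 2 * M.
Proof.
move=> H; have M0 : 0 <= M by exact: le_trans (normr_ge0 _) (H true true).
rewrite grad_normE -(ger0_norm (_ : 0 <= 2 * M)); last by rewrite mulr_ge0.
rewrite -sqrtr_sqr ler_wsqrtr//.
have sq e j : D e (vel v j) x ^+ 2 <= M ^+ 2.
  by rewrite -real_normK ?num_real// lerXn2r ?nnegrE.
rewrite exprMn (_ : 2 ^+ 2 = 4); last by ring.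
exact: sum4_le (sq true true) (sq false true) (sq true false) (sq false false).
Qed.

End GradNorm.

(** * Means of the velocity gradient far out *)

Section SideArith.
Context {R : realFieldType}.

Lemma side_arith (x l s : R) : 0 < l -> -1 <= s <= 1 -> x - l <= x + l * s <= x + l.
Proof.
move=> l0 /andP[s1 s2].
have a1 : l * -1 <= l * s by rewrite ler_pM2l.
have a2 : l * s <= l * 1 by rewrite ler_pM2l.
by move: a1 a2; move: (l * s) => t *; apply/andP; split; lra.
Qed.

Lemma side_arith2 (x l s : R) : 0 < l -> x - l <= s <= x + l -> -1 <= l^-1 * (s - x) <= 1.
Proof.
move=> l0 /andP[s1 s2]; rewrite ler_pdivlMl// ler_pdivrMl//.
by apply/andP; split; lra.
Qed.

Lemma sub_eps_false (i e : R) : i <= i - e -> 0 < e -> False.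
Proof. lra. Qed.

Lemma tail_arith (i e f b : R) : i - e < f -> f + b <= i -> b <= e.
Proof. lra. Qed.

Lemma five_arith (z l : R) : z <= l -> 4 * l + z <= 5 * l.
Proof. lra. Qed.

End SideArith.

Section Tail.
Context {R : realType}.
Notation mu := (@lebesgue_measure R).
Notation mu2 := (mu \x mu)%E.
Implicit Types (x y z : R * R).
Variables (U : set (R * R)) (g : R * R -> R).
Hypotheses (oU : open U) (cg : cont_on U g) (g0 : forall x, 0 <= g x).
Hypothesis gfin : (\int[mu2]_(x in U) (g x)%:E < +oo)%E.

Let mg (B : set (R * R)) : measurable B -> B `<=` U -> measurable_fun B (EFin \o g).
Proof.
move=> mB BU; apply/measurable_EFinP.
by apply: measurable_funS (cont_measurable oU cg) => //; exact: open_measurable2.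
Qed.

Let gE0 x : (0 <= (EFin \o g) x)%E.
Proof. by rewrite lee_fin. Qed.

(** Monotone convergence along U intersected with growing balls. *)
Lemma tail_small (eps : R) : 0 < eps -> exists rho : R, forall B : set (R * R),
  measurable B -> B `<=` U -> (forall x, B x -> rho <= `|x|) ->
  (\int[mu2]_(x in B) (g x)%:E <= eps%:E)%E.
Proof.
move=> eps0.
pose F n := U `&` [set x : R * R | `|x| < n%:R].
have oF n : open (F n) by apply: openI => //; exact: open_ball_norm.
have mF n : measurable (F n) by exact: open_measurable2.
have FU n : F n `<=` U by move=> x [].
have mU : measurable U by exact: open_measurable2.
have cvgF : (\int[mu2]_(x in F i) (EFin \o g) x @[i --> \oo] -->
    \int[mu2]_(x in \bigcup_i F i) (EFin \o g) x)%E.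
  apply: ge0_nondecreasing_set_cvg_integral => //.
  - move=> n m nm; apply/subsetPset => x [Ux xn]; split => //=.
    by rewrite (lt_le_trans xn)// ler_nat.
  - by move=> n; apply: mg.
have UF : \bigcup_i F i = U.
  apply/seteqP; split => [x [n _ []]//|x Ux].
  by exists (Num.truncn `|x|).+1 => //; split => //=; exact: truncnS_gt.
rewrite UF in cvgF.
set I := (\int[mu2]_(x in U) (EFin \o g) x)%E in cvgF.
have I0 : (0 <= I)%E by apply: integral_ge0.
have Ifin : I \is a fin_num by rewrite ge0_fin_numE.
have [n nP] : exists n, (I - eps%:E < \int[mu2]_(x in F n) (EFin \o g) x)%E.
  apply: contrapT => H.
  have le n : (\int[mu2]_(x in F n) (EFin \o g) x <= I - eps%:E)%E.
    by rewrite leNgt; apply/negP => L; apply: H; exists n.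
  have : (I <= I - eps%:E)%E.
    rewrite -{1}(cvg_lim _ cvgF)//; apply: lime_le; first by apply/cvg_ex; exists I.
    by apply: nearW => n; exact: le.
  rewrite -(fineK Ifin) -EFinB lee_fin => H2.
  exact: sub_eps_false H2 eps0.
exists n%:R => B mB BU Bn.
have dis : [disjoint F n & B].
  apply/disj_setPS => x [[_ /= xn] /Bn]; rewrite leNgt; by rewrite xn.
have sum : (\int[mu2]_(x in F n) (EFin \o g) x + \int[mu2]_(x in B) (EFin \o g) x <= I)%E.
  have sU : F n `|` B `<=` U by move=> x [/FU|/BU].
  have mFB : measurable (F n `|` B) by exact: measurableU.
  have H : (\int[mu2]_(x in F n `|` B) (EFin \o g) x <= \int[mu2]_(x in U) (EFin \o g) x)%E.
    by apply: ge0_subset_integral => //; exact: mg.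
  have H2 : (\int[mu2]_(x in F n `|` B) (EFin \o g) x =
      \int[mu2]_(x in F n) (EFin \o g) x + \int[mu2]_(x in B) (EFin \o g) x)%E.
    apply: ge0_integral_setU; [exact: mF|exact: mB|exact: mg| |exact: dis].
    by move=> x _; exact: gE0.
  by rewrite -H2; exact: H.
have B0 : (0 <= \int[mu2]_(x in B) (EFin \o g) x)%E by apply: integral_ge0.
have F0 : (0 <= \int[mu2]_(x in F n) (EFin \o g) x)%E by apply: integral_ge0.
have Bfin : (\int[mu2]_(x in B) (EFin \o g) x)%E \is a fin_num.
  rewrite ge0_fin_numE// (le_lt_trans _ gfin)//; apply: le_trans sum; exact: leeDr.
have Ffin : (\int[mu2]_(x in F n) (EFin \o g) x)%E \is a fin_num.
  rewrite ge0_fin_numE// (le_lt_trans _ gfin)//; apply: le_trans sum; exact: leeDl.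
change (\int[mu2]_(x in B) (EFin \o g) x <= eps%:E)%E.
move: nP sum; rewrite -(fineK Ifin) -(fineK Bfin) -(fineK Ffin).
rewrite -EFinB -EFinD lte_fin !lee_fin.
exact: tail_arith.
Qed.

Lemma bint_box x (l : R) : 0 < l -> (forall y, ball2 y -> U (x + l *: y)) ->
  ((l ^+ 2 * bint (fun y => g (x + l *: y)))%:E =
   \int[mu2]_(z in [set (x + l *: y)%R | y in ball1]) (g z)%:E)%E /\
  measurable [set x + l *: y | y in ball1].
Proof.
move=> l0 OU; set B := [set _ | y in ball1].
have l1 : l != 0 by rewrite gt_eqF.
have BE : B = rect (x.1 - l) (x.1 + l) (x.2 - l) (x.2 + l).
  apply/seteqP; split => [_ [y [/= y1 y2] <-]|z [/= z1 z2]].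
    move: y1 y2; rewrite !in_itv/= => a b.
    by split; rewrite /= in_itv/=; apply: side_arith.
  move: z1 z2; rewrite !in_itv/= => a b.
  exists (l^-1 *: (z - x)); last by rewrite scalerA divff// scale1r addrC subrK.
  by split; rewrite /= in_itv/=; apply: side_arith2.
have mB : measurable B by rewrite BE; exact: measurable_rect.
have BU : B `<=` U by move=> _ [y Qy <-]; apply: OU; exact: ball1_sub2.
split => //.
change (\int[mu2]_(z in B) (g z)%:E)%E with (\int[mu2]_(z in B) (EFin \o g) z)%E.
rewrite integral_mkcond (@integral_affine2 R l x)//; last 2 first.
- by apply/(measurable_restrictT _ mB); exact: mg.
- by move=> y; rewrite patchE; case: ifPn.
have cgx : cont_on ball2 (fun y => g (x + l *: y)).
  by move=> y Oy; apply: cont_aff; apply: cg; exact: OU.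
have -> : (fun y => ((EFin \o g) \_ B) (x + l *: y)) = (EFin \o (fun y => g (x + l *: y))) \_ ball1.
  apply/funext => y; rewrite !patchE (_ : (x + l *: y \in B) = (y \in ball1))//.
  apply/idP/idP => /set_mem H; apply/mem_set; last by exists y.
  by case: H => z Qz /addrI /(scalerI l1) <-.
rewrite -integral_mkcond EFinM /bint /Rintegral fineK//.
apply: (integrable_fin_num (mu := mu2)); [exact: measurable_rect|exact: bint_integrable].
Qed.

End Tail.

Section Means.
Context {R : realType}.
Notation mu := (@lebesgue_measure R).
Notation mu2 := (mu \x mu)%E.
Implicit Types (x y z : R * R).

(** Young's inequality in the form that interpolates between a constant and a^q: if
    a > lam then a = a^(1-q) a^q <= lam^(1-q) a^q. *)
Lemma young_le (a lam q : R) : 0 <= a -> 0 < lam -> 1 < q ->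
  a <= lam + lam `^ (1 - q) * a `^ q.
Proof.
move=> a0 lam0 q1; have [al|la] := leP a lam.
  by rewrite (le_trans al)// lerDl mulr_ge0 ?powR_ge0.
have a00 : 0 < a by exact: lt_trans la.
apply: (@le_trans _ _ (lam `^ (1 - q) * a `^ q)); last by rewrite lerDr ltW.
have {1}-> : a = a `^ (1 - q) * a `^ q.
  rewrite -powRD; last by apply/implyP => _; rewrite gt_eqF.
  by rewrite subrK powRr1// ltW.
rewrite ler_wpM2r ?powR_ge0// -(opprK (1 - q)) opprB !powRN.
rewrite lef_pV2 ?posrE ?powR_gt0// ge0_ler_powR// ?nnegrE ltW//.
by rewrite subr_gt0.
Qed.

Variables (r0 q : R) (v : R * R -> R * R) (p : R * R -> R).
Hypotheses (hr0 : 0 < r0) (hq : 2 < q).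
Hypothesis hNS : smooth_stationary_NS (exterior r0) v p.
Hypothesis hint : (\int[mu2]_(x in exterior r0) ((grad_norm v x) `^ q)%:E < +oo)%E.

Let q0 : 0 < q. Proof. by apply: lt_trans hq. Qed.
Let q1 : 1 < q. Proof. by apply: lt_trans hq; rewrite ltr1n. Qed.

Lemma cont_powR (V : set (R * R)) (f : R * R -> R) (s : R) : 0 < s ->
  (forall x, 0 <= f x) -> cont_on V f ->
  cont_on V (fun x => f x `^ s).
Proof.
move=> s0 f0 cf x Vx; have := f0 x; rewrite le_eqVlt => /orP[/eqP fx0|fx0]; last first.
  apply: (@continuous_comp _ _ _ f (fun t : R => t `^ s)); first exact: cf.
  have [H _] := is_derive1_powR s fx0.
  by apply: differentiable_continuous; exact/derivable1_diffP.
rewrite /prop_for /continuous_at -fx0 powR0; last by rewrite gt_eqF.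
apply/cvgrPdist_le => e e0.
have es0 : 0 < e `^ s^-1 by exact: powR_gt0.
have /cvgrPdist_le /(_ _ es0) := cf x Vx.
apply: filterS => y; rewrite -fx0 !sub0r !normrN !ger0_norm ?powR_ge0// => fy.
have -> : e = (e `^ s^-1) `^ s by rewrite -powRrM mulVf ?gt_eqF// powRr1// ltW.
by apply: ge0_ler_powR => //; rewrite ?nnegrE ?powR_ge0// ltW.
Qed.

Let cgrad := cont_grad_norm hNS.
Let cgradq : cont_on (exterior r0) (fun x => grad_norm v x `^ q).
Proof. by apply: cont_powR => // x; exact: grad_norm_ge0. Qed.

Lemma far_box (rho l : R) x y : 0 < l -> rho <= `|x| - 2 * l -> `|y| <= 2 -> rho <= `|x + l *: y|.
Proof.
move=> l0 H y2; apply: le_trans H _; rewrite lerBlDr.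
rewrite -{1}(addrK (l *: y) x) (le_trans (ler_normB _ _))// lerD2l normrZ gtr0_norm//.
by rewrite mulrC ler_pM2r.
Qed.

Lemma mean_pow_small (eps : R) : 0 < eps -> exists2 rho : R, r0 < rho & forall x (l : R),
  0 < l -> rho <= `|x| - 2 * l ->
  bint (fun y => grad_norm v (x + l *: y) `^ q) <= eps / l ^+ 2.
Proof.
move=> eps0.
have [rho H] := tail_small (@open_exterior R r0) cgradq (fun x => powR_ge0 _ _) hint eps0.
exists (Num.max rho (r0 + 1)); first by rewrite lt_max ltrDl ltr01 orbT.
move=> x l l0; rewrite ge_max => /andP[h1 h2].
have OU y : ball2 y -> exterior r0 (x + l *: y).
  move=> Oy; apply: exterior_norm; have := far_box l0 h2 (ltW Oy).
  by apply: lt_le_trans; rewrite ltrDl.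
have [E mB] := bint_box (@open_exterior R r0) cgradq (fun x => powR_ge0 _ _) l0 OU.
rewrite ler_pdivlMr ?exprn_gt0// mulrC -lee_fin E; apply: H => //.
  by move=> _ [y Qy <-]; apply: OU; exact: ball1_sub2.
move=> _ [y Qy <-]; apply: (far_box l0 h1); exact: ltW (ball1_sub2 Qy).
Qed.

(** young_le with lam = eta l^(-2/q), which balances the two terms; the factor 5 is
    the measure 4 of the unit square plus 1. *)
Lemma mean_small (eta : R) : 0 < eta -> exists2 rho : R, r0 < rho & forall x (l : R),
  0 < l -> rho <= `|x| - 2 * l ->
  bint (fun y => grad_norm v (x + l *: y)) <= 5 * eta * l `^ (- (2 / q)).
Proof.
move=> eta0.
have [rho r0rho H] := @mean_pow_small (eta `^ q) (powR_gt0 _ eta0).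
exists rho => // x l l0 xl.
have OU y : ball2 y -> exterior r0 (x + l *: y).
  move=> Oy; apply: exterior_norm; apply: lt_le_trans r0rho _.
  exact: far_box l0 xl (ltW Oy).
have cg : cont_on ball2 (fun y => grad_norm v (x + l *: y)).
  by move=> y Oy; apply: cont_aff; apply: cgrad; exact: OU.
have cgq := cont_powR q0 (fun y => grad_norm_ge0 v (x + l *: y)) cg.
have [lam lamE] : exists lam, lam = eta * l `^ (- (2 / q)) by eexists.
have lam0 : 0 < lam by rewrite lamE mulr_gt0 ?powR_gt0.
apply: (@le_trans _ _ (bint (fun y => lam + lam `^ (1 - q) * grad_norm v (x + l *: y) `^ q))).
  apply: bint_le; [by ct|by ct|move=> y _].
  by apply: young_le => //; exact: grad_norm_ge0.
rewrite bintD; [|by ct|by ct]; rewrite bint_cst bintZ; last by ct.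
have X : lam `^ (1 - q) * bint (fun y => grad_norm v (x + l *: y) `^ q) <= lam.
  apply: (@le_trans _ _ (lam `^ (1 - q) * (eta `^ q / l ^+ 2))).
    by rewrite ler_wpM2l ?powR_ge0// H.
  have lamq : lam `^ q = eta `^ q / l ^+ 2.
    rewrite lamE powRM ?powR_ge0 ?ltW//; congr (_ * _).
    rewrite -powRrM mulNr divfK ?gt_eqF// powRN; congr (_^-1).
    by rewrite -powR_mulrn ?ltW.
  rewrite -lamq -powRD; last by apply/implyP => _; rewrite gt_eqF.
  by rewrite subrK powRr1// ltW.
by rewrite -mulrA -lamE; exact: five_arith.
Qed.

End Means.

(** * Growth of the velocity *)

Section PowerLemmas.
Context {R : realType}.

Lemma pow_neg_le (k beta rho z : R) : 1 <= k -> 0 <= beta -> beta <= 1 -> 0 < rho ->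
  rho / k <= z -> z `^ (- beta) <= k * rho `^ (- beta).
Proof.
move=> k1 b0 b1 rho0 rz.
have k0 : 0 < k by exact: lt_le_trans k1.
have rk : 0 < rho / k by rewrite divr_gt0.
have z0 : 0 < z by exact: lt_le_trans rz.
rewrite !powRN -[k]invrK -invfM lef_pV2 ?posrE ?mulr_gt0 ?invr_gt0 ?powR_gt0//.
apply: (@le_trans _ _ ((rho / k) `^ beta)); last first.
  by apply: ge0_ler_powR => //; rewrite nnegrE ltW.
have -> : (rho / k) `^ beta = rho `^ beta * k^-1 `^ beta.
  by rewrite powRM ?invr_ge0 ?ltW.
rewrite [leLHS]mulrC; apply: ler_wpM2l; first exact: powR_ge0.
rewrite -(powR_inv1 (ltW k0)) -powRrM mulN1r.
have H : -1 <= - beta by rewrite lerN2.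
exact: (ler_powR k1 H).
Qed.

Lemma pow_pos_le (beta y z : R) : 0 <= beta -> 0 <= y -> y <= z -> y `^ beta <= z `^ beta.
Proof.
by move=> b0 y0 yz; apply: ge0_ler_powR => //; rewrite nnegrE// (le_trans y0).
Qed.

Lemma pow_ge1 (beta z : R) : 0 <= beta -> 1 <= z -> 1 <= z `^ beta.
Proof.
by move=> b0 z1; have := pow_pos_le b0 ler01 z1; rewrite powR1.
Qed.

Lemma sweep_arith (rho t0 t s : R) : 0 < t0 -> rho <= t0 / 4 -> t0 / 2 < t -> t <= s ->
  rho <= s - 2 * (t * (1 / 8)).
Proof. lra. Qed.

Lemma sweep_arith2 (rho t0 s t : R) : t0 <= s -> 0 < t0 -> rho <= t0 / 4 -> t < s / 4 ->
  rho <= s - 2 * t.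
Proof. lra. Qed.

Lemma last_step (X Y K : R) : X <= 8 * Y -> K = 160 -> 4 * (5 * X) <= K * Y.
Proof. by move=> XY ->; lra. Qed.

Lemma quarter_half (t s : R) : t <= s -> 0 < t -> t / 4 + s / 2 <= s.
Proof. lra. Qed.

Lemma growth_arith (M k X : R) : 0 <= M -> 0 <= k -> 1 <= X ->
  4 * M + k * X + k * X <= (2 * k + 4 * M) * X.
Proof.
move=> M0 k0 X1; have : M <= M * X by rewrite ler_peMr.
rewrite (_ : (2 * k + 4 * M) * X = 2 * (k * X) + 4 * (M * X)); last by ring.
by move: (k * X) (M * X) => a b; lra.
Qed.

End PowerLemmas.

Section Growth.
Context {R : realType}.
Implicit Types (x y z P B : R * R).
Variables (r0 : R).

Lemma annulus_bounded (f : R * R -> R) (c C : R) : r0 < c -> 0 <= C ->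
  cont_on (exterior r0) f -> exists M, forall z, c <= `|z| -> `|z| <= C -> f z <= M.
Proof.
move=> rc C0 cf.
pose K := rect (- C) C (- C) C `&` [set z : R * R | c <= `|z|].
have cK : compact K.
  apply: compact_closedI; first exact: rect_compact.
  rewrite (_ : [set z | _] = (fun x : R * R => `|x|) @^-1` [set t | c <= t])//.
  by apply: closed_comp; [move=> x _; exact: norm_continuous|exact: closed_ge].
have KU : K `<=` exterior r0.
  by move=> z [_ /= cz]; apply: exterior_norm; exact: lt_le_trans cz.
have [[z0 Kz0]|K0] := pselect (K !=set0); last first.
  exists 0 => z cz zC; exfalso; apply: K0; exists z; split => //.
  exact/rect_sym.
have [|||m _ mP] := @compact_EVT_max (R * R)%type R f K.
- by exists z0.
- exact: cK.
- exact: cont_within KU cf.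
exists (f m) => z cz zC; apply: mP; apply: mem_set; split => //.
exact/rect_sym.
Qed.

(** For y in the unit square this runs through the square with centre P + t B and
    half-side t b.  The instance P = 0, |B| = 1, b = 1/8 moves outwards along a
    ray; P = x, B = 0, b = 1 shrinks to x as t decreases to 0. *)
Definition sweep (P B : R * R) (b t : R) y : R * R := (P + t *: B) + (t * b) *: y.

Lemma sweepE P B b t y : sweep P B b t y = P + t *: (B + b *: y).
Proof. by rewrite /sweep scalerDr scalerA addrA. Qed.

Lemma sweep_derive u P B (b ta tb c C t0 : R) : smooth_on (exterior r0) u ->
  ta < t0 < tb -> r0 < c -> 0 <= C ->
  (forall t y, ta < t < tb -> ball2 y -> c <= `|sweep P B b t y| <= C) ->
  is_derive t0 1 (fun t => bint (fun y => u (sweep P B b t y) * k2 y))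
    (bint (fun y => ((B + b *: y).1 * D true u (sweep P B b t0 y)
       + (B + b *: y).2 * D false u (sweep P B b t0 y)) * k2 y)).
Proof.
move=> su t0ab rc C0 reg.
have cu := smooth_cont su.
have c1 := smooth_cont (smooth_D true su); have c2 := smooth_cont (smooth_D false su).
have [M MP] : exists M, forall z, c <= `|z| -> `|z| <= C ->
    `|D true u z| + `|D false u z| <= M.
  by apply: (annulus_bounded rc C0); ct.
have ext t y : ta < t < tb -> ball2 y -> exterior r0 (sweep P B b t y).
  by move=> tab Oy; apply: exterior_norm; have /andP[h _] := reg t y tab Oy; exact: lt_le_trans h.
apply: (@bint_param R (fun t y => u (sweep P B b t y) * k2 y)
  (fun t y => ((B + b *: y).1 * D true u (sweep P B b t y)
       + (B + b *: y).2 * D false u (sweep P B b t y)) * k2 y)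
  ta tb ((`|B| + `|b|) * M) t0 t0ab).
- move=> t tab.
  have ? : cont_on ball2 (fun y => u (sweep P B b t y)).
    by move=> y Oy; apply: cont_aff; apply: cu; exact: ext.
  by ct.
- move=> t y tab Qy.
  have H : is_derive (P + t *: (B + b *: y)) (B + b *: y) u
      ((B + b *: y).1 * D true u (sweep P B b t y) + (B + b *: y).2 * D false u (sweep P B b t y)).
    rewrite -sweepE; apply: smooth_dir su _; first exact: open_exterior.
    exact: ext (ball1_sub2 Qy).
  have := is_deriveZ (k2 y) (is_derive_line H).
  congr is_derive; last by rewrite /GRing.scale/= mulrC.
  apply/funext => s; change (k2 y * u (P + s *: (B + b *: y)) = u (sweep P B b s y) * k2 y).
  by rewrite -sweepE mulrC.
- move=> t y tab Qy; rewrite normrM (ger0_norm (k2_ge0 y)).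
  have /andP[h1 h2] := reg t y tab (ball1_sub2 Qy).
  apply: (@le_trans _ _ ((`|B| + `|b|) * (`|D true u (sweep P B b t y)| + `|D false u (sweep P B b t y)|))); last first.
    by apply: ler_wpM2l; [rewrite addr_ge0|exact: MP].
  apply: (@le_trans _ _ `|(B + b *: y).1 * D true u (sweep P B b t y) + (B + b *: y).2 * D false u (sweep P B b t y)|).
    by apply: ler_piMr => //; exact: k2_le1.
  have nB : `|B + b *: y| <= `|B| + `|b|.
    rewrite (le_trans (ler_normD _ _))// lerD2l normrZ ler_piMr//; exact/ball1P.
  rewrite (le_trans (ler_normD _ _))// !normrM mulrDr; apply: lerD; apply: ler_wpM2r => //;
    apply: le_trans nB; rewrite [leRHS]prod_normE/= le_max lexx ?orbT//.
Qed.

End Growth.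

Section VelocityGrowth.
Context {R : realType}.
Implicit Types (x y z P B : R * R).
Variables (r0 q : R) (v : R * R -> R * R) (p : R * R -> R).
Hypotheses (hr0 : 0 < r0) (hq : 2 < q).
Hypothesis hNS : smooth_stationary_NS (exterior r0) v p.

Let q0 : 0 < q. Proof. by apply: lt_trans hq. Qed.

Lemma two_div_q : 0 < 2 / q /\ 2 / q < 1.
Proof. by rewrite divr_gt0// ltr_pdivrMr// mul1r. Qed.

Let kq := 1 - 2 / q.
Let kq0 : 0 < kq. Proof. by rewrite subr_gt0; case: two_div_q. Qed.
(* 160 = 4 * 5 * 8: 2 for each of the two components of B + b y, the
   constant 5 of the hypothesis small, and the factor lost from t to t b. *)
Variable K : R.
Hypothesis KE : K = 160.
Let hh (t : R) : R := K / kq * t `^ kq.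

Let hh_derive (t : R) : 0 < t -> is_derive t 1 hh (K * t `^ (- (2 / q))).
Proof.
move=> t0; have := is_deriveZ (K / kq) (is_derive1_powR kq t0).
congr is_derive; rewrite /GRing.scale/= (_ : kq - 1 = - (2 / q)); last first.
  by rewrite /kq addrAC subrr add0r.
by rewrite mulrA divfK// gt_eqF.
Qed.

Variable rho : R.
Hypothesis r0rho : r0 < rho.
Hypothesis small : forall x (l : R), 0 < l -> rho <= `|x| - 2 * l ->
  bint (fun y => grad_norm v (x + l *: y)) <= 5 * l `^ (- (2 / q)).

Let cgrad := cont_grad_norm hNS.

Lemma sweep_growth j P B (b ta tb t1 t2 : R) : 0 <= ta -> ta < t1 -> t1 <= t2 -> t2 < tb ->
  `|B| <= 1 -> 1 / 8 <= b -> b <= 1 ->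
  (forall t, ta < t < tb -> rho <= `|P + t *: B| - 2 * (t * b)) ->
  `|bint (fun y => vel v j (sweep P B b t2 y) * k2 y) -
    bint (fun y => vel v j (sweep P B b t1 y) * k2 y)| <= hh t2 - hh t1.
Proof.
move=> ta0 tat1 t12 t2b B1 b8 b1 reg.
have b0 : 0 < b by apply: lt_le_trans b8; rewrite divr_gt0.
have tb0 : 0 < tb by exact: le_lt_trans (le_trans ta0 (ltW (lt_le_trans tat1 t12))) t2b.
have su := smooth_vel hNS j.
have low t y : ta < t < tb -> `|y| <= 2 -> rho <= `|sweep P B b t y|.
  move=> tab y2; apply: (far_box _ (reg t tab) y2); apply: mulr_gt0 => //.
  by case/andP: tab => h _; exact: le_lt_trans h.
have reg' t y : ta < t < tb -> ball2 y -> rho <= `|sweep P B b t y| <= `|P| + 3 * tb.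
  move=> tab Oy; rewrite low ?(ltW Oy)//=.
  have /andP[at1 tbt] := tab.
  have t0 : 0 <= t by rewrite (le_trans ta0)// ltW.
  rewrite sweepE (le_trans (ler_normD _ _))// lerD2l normrZ (ger0_norm t0) mulrC.
  have : `|B + b *: y| <= 3.
    rewrite (le_trans (ler_normD _ _))// (_ : 3 = 1 + 1 * 2); last by ring.
    apply: lerD => //; rewrite normrZ (gtr0_norm b0); apply: ler_pM => //; first exact: ltW.
    exact: ltW.
  by move=> B3; apply: ler_pM => //; exact: ltW.
have in_ t : t1 <= t <= t2 -> ta < t < tb.
  by move=> /andP[h1 h2]; rewrite (lt_le_trans tat1)// (le_lt_trans h2).
have C0 : 0 <= `|P| + 3 * tb by rewrite addr_ge0// mulr_ge0// ltW.
apply: (@derive_le R (fun t => bint (fun y => vel v j (sweep P B b t y) * k2 y)) _ hh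
  (fun t => K * t `^ (- (2 / q))) t1 t2 t12).
- by move=> t /in_ tab; exact: (sweep_derive su tab r0rho C0 reg').
- by move=> t /in_ /andP[h _]; apply: hh_derive; exact: le_lt_trans h.
move=> t /in_ tab.
have t0 : 0 < t by have /andP[h _] := tab; exact: le_lt_trans h.
have ext y : ball2 y -> exterior r0 (sweep P B b t y).
  move=> Oy; apply: exterior_norm; apply: lt_le_trans r0rho _; apply: low => //; exact: ltW.
have cD e : cont_on ball2 (fun y => D e (vel v j) (sweep P B b t y)).
  move=> y Oy; apply: cont_aff; apply: (smooth_cont (smooth_D e su)); exact: ext.
have cg : cont_on ball2 (fun y => grad_norm v (sweep P B b t y)).
  by move=> y Oy; apply: cont_aff; apply: cgrad; exact: ext.
have c1 := cD true; have c2 := cD false.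
have cBy1 : cont_on ball2 (fun y => (B + b *: y).1).
  have : cont_on ball2 (fun y : R * R => B.1 + b * co true y) by ct.
  exact.
have cBy2 : cont_on ball2 (fun y => (B + b *: y).2).
  have : cont_on ball2 (fun y : R * R => B.2 + b * co false y) by ct.
  exact.
apply: (le_trans (bint_abs _)); first by ct.
apply: (@le_trans _ _ (bint (fun y => 4 * grad_norm v (sweep P B b t y)))).
  apply: bint_le; [by ct|by ct|move=> y Qy].
  rewrite normrM (ger0_norm (k2_ge0 y)).
  apply: (@le_trans _ _ `|(B + b *: y).1 * D true (vel v j) (sweep P B b t y)
     + (B + b *: y).2 * D false (vel v j) (sweep P B b t y)|).
    by apply: ler_piMr => //; exact: k2_le1.
  have nB : `|B + b *: y| <= 2.
    rewrite (le_trans (ler_normD _ _))// (_ : 2 = 1 + 1); last by ring.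
    apply: lerD => //; rewrite normrZ (gtr0_norm b0); apply: mulr_ile1 => //; first exact: ltW.
    exact/ball1P.
  have n1 : `|(B + b *: y).1| <= 2 by apply: le_trans nB; rewrite [leRHS]prod_normE/= le_max lexx.
  have n2 : `|(B + b *: y).2| <= 2 by apply: le_trans nB; rewrite [leRHS]prod_normE/= le_max lexx orbT.
  rewrite (_ : 4 = 2 + 2); last by ring.
  rewrite (le_trans (ler_normD _ _))// !normrM mulrDl; apply: lerD; apply: ler_pM => //;
    exact: D_le_grad_norm.
rewrite bintZ; last by ct.
have tb1 : 0 < t * b by rewrite mulr_gt0.
apply: (@le_trans _ _ (4 * (5 * (t * b) `^ (- (2 / q))))).
  by apply: ler_wpM2l => //; apply: small => //; exact: reg.
have [h1 h2] := two_div_q.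
have t8 : t / 8 <= t * b by rewrite ler_pM2l// -[leLHS]mul1r.
have e8 : (1 : R) <= 8 by rewrite ler1n.
exact: last_step (pow_neg_le e8 (ltW h1) (ltW h2) t0 t8) KE.
Qed.

(** Along the ray from the annulus at t0 out to x, then along the squares centred at
    x, from half-side |x| / 8 down to 0.  Both parts contribute hh(|x|), a
    multiple of |x|^(1 - 2/q); the continuity of the kernel mean at t = 0 closes
    the second part, where sweep_growth needs positive scales. *)
Lemma velocity_growth : exists V0 rho1 : R, [/\ 1 <= V0, rho <= rho1, 1 <= rho1 &
  forall j x, rho1 <= `|x| -> `|vel v j x| <= V0 * `|x| `^ (1 - 2 / q)].
Proof.
have rho0 : 0 < rho by exact: lt_trans r0rho.
pose t0 := 4 * rho + 1.
have t01 : 1 <= t0 by rewrite lerDr mulr_ge0 // ltW.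
have t00 : 0 < t0 by exact: lt_le_trans t01.
have rt0 : rho <= t0 / 4.
  by rewrite /t0 ler_pdivlMr// mulrC lerDl.
have [M0 MP] : exists M, forall z, t0 / 4 <= `|z| -> `|z| <= 2 * t0 ->
    `|vel v true z| + `|vel v false z| <= M.
  apply: (@annulus_bounded R r0); first exact: lt_le_trans rt0.
    by rewrite mulr_ge0// ltW.
  have := smooth_cont (smooth_vel hNS true); have := smooth_cont (smooth_vel hNS false).
  by move=> ? ?; ct.
have M00 : 0 <= `|M0| by [].
have K0 : 0 <= K by rewrite KE ler0n.
have kk : 0 <= K / kq by apply: divr_ge0 => //; exact: ltW.
pose V0 := (2 * (K / kq) + 4 * `|M0|) / c0 + 1.
exists V0, t0; split => //.
- by rewrite lerDr divr_ge0 ?(ltW c0_gt0)// addr_ge0// mulr_ge0.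
- by rewrite (le_trans rt0)// ler_pdivrMr// ler_peMr ?(ltW t00)// ler1n.
move=> j x t0x.
have x0 : 0 < `|x| by exact: lt_le_trans t0x.
have x1 : 1 <= `|x| by exact: le_trans t0x.
pose e := `|x|^-1 *: x.
have e1 : `|e| = 1 by rewrite normrZ normfV normr_id mulVf// gt_eqF.
have xe : `|x| *: e = x by rewrite scalerA divff ?gt_eqF// scale1r.
have eight1 : 1 / 8 <= 1 :> R by rewrite ler_pdivrMr// mul1r ler1n.
have hh0 t : 0 <= hh t by rewrite mulr_ge0 ?powR_ge0.
have hhle (s t : R) : 0 <= s -> s <= t -> hh s <= hh t.
  by move=> s0 st; apply: ler_wpM2l => //; apply: pow_pos_le => //; exact: ltW.
have T : `|bint (fun y => vel v j (sweep 0 e (1 / 8) `|x| y) * k2 y) -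
    bint (fun y => vel v j (sweep 0 e (1 / 8) t0 y) * k2 y)| <= hh `|x| - hh t0.
  apply: (@sweep_growth j 0 e (1 / 8) (t0 / 2) (`|x| + 1)) => //.
  - by rewrite divr_ge0// ltW.
  - by rewrite ltr_pdivrMr// ltr_pMr// ltr1n.
  - by rewrite ltrDl.
  - by rewrite e1.
  move=> t /andP[tt _]; rewrite add0r normrZ e1 mulr1.
  by apply: (sweep_arith t00 rt0 tt); rewrite ler_norm.
have T0 : `|bint (fun y => vel v j (sweep 0 e (1 / 8) t0 y) * k2 y)| <= 4 * `|M0|.
  have far y : ball2 y -> t0 / 4 <= `|sweep 0 e (1 / 8) t0 y|.
    move=> Oy; apply: (far_box _ _ (ltW Oy)); first by rewrite mulr_gt0// divr_gt0.
    by rewrite add0r normrZ e1 mulr1 gtr0_norm//; apply: (sweep_arith t00 (lexx _) _ (lexx _));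
      rewrite ltr_pdivrMr// ltr_pMr// ltr1n.
  have ext y : ball2 y -> exterior r0 (sweep 0 e (1 / 8) t0 y).
    move=> Oy; apply: exterior_norm; apply: lt_le_trans (far y Oy).
    exact: lt_le_trans rt0.
  have cv : cont_on ball2 (fun y => vel v j (sweep 0 e (1 / 8) t0 y)).
    by move=> y Oy; apply: cont_aff; apply: (smooth_cont (smooth_vel hNS j)); exact: ext.
  apply: bint_bound; first by ct.
  move=> y Qy; rewrite normrM (ger0_norm (k2_ge0 y)).
  have H1 : `|vel v j (sweep 0 e (1 / 8) t0 y)| <= `|M0|.
    apply: (@le_trans _ _ M0); last exact: ler_norm.
    apply: le_trans (MP _ (far y (ball1_sub2 Qy)) _).
      by case: (j); [rewrite lerDl|rewrite lerDr].
    rewrite sweepE add0r normrZ (gtr0_norm t00) mulrC ler_pM2r//.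
    rewrite (le_trans (ler_normD _ _))// e1 (_ : 2 = 1 + 1 :> R); last by [].
    rewrite lerD2l normrZ (ger0_norm (_ : 0 <= 1 / 8)) ?divr_ge0//.
    by apply: mulr_ile1 => //; exact/ball1P.
  by apply: le_trans H1; apply: ler_piMr => //; exact: k2_le1.
pose gL (t : R) := bint (fun y => vel v j (sweep x 0 1 t y) * k2 y).
have s8 : 0 < `|x| / 8 by rewrite divr_gt0.
have s84 : `|x| / 8 < `|x| / 4 by rewrite ltr_pM2l// ltf_pV2 ?posrE// ltr_nat.
have L1 (t : R) : 0 < t -> t <= `|x| / 8 -> `|gL (`|x| / 8) - gL t| <= hh `|x|.
  move=> tp t8; apply: (@le_trans _ _ (hh (`|x| / 8) - hh t)).
    apply: (@sweep_growth j x 0 1 0 (`|x| / 4)) => //.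
    - by rewrite normr0.
    move=> s /andP[sp s4]; rewrite scaler0 addr0 mulr1.
    exact: sweep_arith2 t0x t00 rt0 s4.
  rewrite lerBlDr (le_trans (y := hh `|x|)) ?lerDl//; apply: hhle; first exact: ltW.
  by rewrite ler_pdivrMr// ler_peMr ?(ltW x0)// ler1n.
have cL : {for 0, continuous gL}.
  have x40 : 0 < `|x| / 4 by rewrite divr_gt0.
  have reg t y : - (`|x| / 4) < t < `|x| / 4 -> ball2 y -> t0 / 4 <= `|sweep x 0 1 t y| <= 2 * `|x|.
    move=> tx Oy.
    have {}tx : `|t| < `|x| / 4 by rewrite ltr_norml.
    have h : `|t *: y| <= `|x| / 2.
      rewrite normrZ (_ : `|x| / 2 = `|x| / 4 * 2); last by field.
      by apply: ler_pM => //; exact: ltW.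
    rewrite /sweep scaler0 addr0 mulr1; apply/andP; split; last first.
      rewrite (le_trans (ler_normD _ _))// mulrDl mul1r lerD2l (le_trans h)//.
      by rewrite ler_pdivrMr// ler_peMr ?(ltW x0)// ler1n.
    have := lerB_normD x (t *: y) => H; apply: le_trans H.
    by rewrite lerBrDr; apply: (le_trans (lerD (lexx (t0 / 4)) h)); exact: quarter_half t0x t00.
  have zx : - (`|x| / 4) < 0 < `|x| / 4 by rewrite oppr_lt0 x40.
  have C0 : 0 <= 2 * `|x| by rewrite mulr_ge0.
  have [H _] := sweep_derive (smooth_vel hNS j) zx (lt_le_trans r0rho rt0) C0 reg.
  by apply: differentiable_continuous; exact/derivable1_diffP.
have L0 : `|gL (`|x| / 8) - gL 0| <= hh `|x|.
  apply/ler_addgt0Pl => eps eps0.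
  have /cvgrPdist_le /(_ _ eps0) /nbhs_ballP[d /= d0 dP] := cL.
  pose t := Num.min (d / 2) (`|x| / 8).
  have tp : 0 < t by rewrite lt_min divr_gt0.
  have t8 : t <= `|x| / 8 by rewrite ge_min lexx orbT.
  have td : t < d by rewrite gt_min ltr_pdivrMr// ltr_pMr// ltr1n.
  have := dP t; rewrite -ball_normE /= sub0r normrN gtr0_norm// => /(_ td) H.
  have := L1 t tp t8; move: H; rewrite distrC => H H1.
  rewrite (_ : gL (`|x| / 8) - gL 0 = (gL t - gL 0) + (gL (`|x| / 8) - gL t)).
    by rewrite (le_trans (ler_normD _ _))// lerD.
  by rewrite [RHS]addrC subrKA.
have E0 : gL 0 = c0 * vel v j x.
  rewrite /gL /c0 mulrC -bintZ; last by ct.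
  by apply: bint_eq => y _; rewrite /sweep mul0r !scale0r !addr0.
have E1 : gL (`|x| / 8) = bint (fun y => vel v j (sweep 0 e (1 / 8) `|x| y) * k2 y).
  by apply: bint_eq => y _; rewrite /sweep xe scaler0 addr0 add0r mulr1 mul1r.
have B2 : `|gL (`|x| / 8)| <= 4 * `|M0| + hh `|x|.
  rewrite E1; apply: ler_norm_trans T0; rewrite distrC; apply: (le_trans T).
  by rewrite lerBlDr lerDl.
have B3 := ler_norm_trans L0 B2.
rewrite E0 normrM (gtr0_norm c0_gt0) in B3.
have X1 : 1 <= `|x| `^ kq by apply: pow_ge1 => //; exact: ltW.
rewrite -(ler_pM2l (@c0_gt0 R)); apply: (le_trans B3).
have hhE : hh `|x| = K / kq * `|x| `^ kq by [].
apply: (@le_trans _ _ ((2 * (K / kq) + 4 * `|M0|) * `|x| `^ kq)).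
  rewrite hhE; apply: growth_arith => //.
rewrite [leRHS]mulrA; apply: (ler_wpM2r (powR_ge0 _ _)).
rewrite /V0 [leRHS]mulrDr mulr1 [X in _ <= X + _]mulrC divfK; last by rewrite gt_eqF// c0_gt0.
by rewrite lerDl ltW// c0_gt0.
Qed.

End VelocityGrowth.

(** * Decay of the vorticity and of the velocity gradient *)

Section PowerLemmas2.
Context {R : realType}.

Lemma pow_add_le (s t p : R) : 0 <= s -> 0 <= t -> 0 <= p ->
  (s + t) `^ p <= 2 `^ p * (s `^ p + t `^ p).
Proof.
move=> s0 t0 p0.
wlog st : s t s0 t0 / t <= s.
  move=> H; have [ts|st] := leP t s; first exact: H.
  by rewrite addrC [X in _ * X]addrC; apply: H => //; exact: ltW.
apply: (@le_trans _ _ ((2 * s) `^ p)).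
  apply: pow_pos_le => //; first exact: addr_ge0.
  by rewrite mulr2n mulrDl mul1r lerD2l.
by rewrite powRM// ler_wpM2l ?powR_ge0// lerDl powR_ge0.
Qed.

Lemma pow_le_inv (a b q : R) : 0 < q -> 0 <= b -> a `^ q <= b `^ q -> a <= b.
Proof.
move=> q0 b0; apply: contraTT; rewrite -!ltNge => ba.
by apply: gt0_ltr_powR => //; rewrite nnegrE// (le_trans b0)// ltW.
Qed.

Lemma sqr_powR (a q : R) : (a ^+ 2) `^ (q / 2) = `|a| `^ q.
Proof.
rewrite -real_normK ?num_real// -powR_mulrn// -powRrM.
by rewrite (_ : 2%:R * (q / 2) = q)// mulrC divfK.
Qed.

Lemma pow_double_le (z a : R) : 0 <= z -> 0 <= a -> a <= 1 -> (2 * z) `^ a <= 2 * z `^ a.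
Proof.
move=> z0 a0 a1; rewrite powRM// ler_wpM2r ?powR_ge0//.
have H : (1 : R) <= 2 by rewrite ler1n.
by have := ler_powR H a1; rewrite powRr1.
Qed.

Lemma half_le_sub8 (s : R) : 0 < s -> s / 2 <= s - 2 * (s / 8).
Proof. lra. Qed.

Lemma final_arith (eta X C L : R) : 0 <= C -> 0 <= eta * X -> 1 <= L ->
  40 * eta * X + 2 * C * eta * X + 80 * eta * X * L <= (120 + 2 * C) * (eta * X * L).
Proof.
move=> C0 eX L1.
have h1 : eta * X <= eta * X * L by rewrite ler_peMr.
have h2 : C * (eta * X) <= C * (eta * X * L) by rewrite ler_wpM2l.
rewrite (_ : (120 + 2 * C) * (eta * X * L) = 120 * (eta * X * L) + 2 * (C * (eta * X * L))); last by ring.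
rewrite (_ : 2 * C * eta * X = 2 * (C * (eta * X))); last by ring.
rewrite -!(mulrA 40) (_ : 80 * eta * X * L = 80 * (eta * X * L)); last by ring.
have [a aE] : exists a, a = C * (eta * X) by eexists.
have [b bE] : exists b, b = C * (eta * X * L) by eexists.
have [c cE] : exists c, c = eta * X * L by eexists.
have [e eE] : exists e, e = eta * X by eexists.
rewrite -aE -bE in h2 *; rewrite -cE -eE in h1 *.
by clear -h1 h2; lra.
Qed.

End PowerLemmas2.

Section Decay.
Context {R : realType}.
Notation mu := (@lebesgue_measure R).
Notation mu2 := (mu \x mu)%E.
Implicit Types (x y z : R * R).
Variables (r0 q : R) (v : R * R -> R * R) (p : R * R -> R).
Hypotheses (hr0 : 0 < r0) (hq : 2 < q).
Hypothesis hNS : smooth_stationary_NS (exterior r0) v p.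
Hypothesis hint : (\int[mu2]_(x in exterior r0) ((grad_norm v x) `^ q)%:E < +oo)%E.

Let q0 : 0 < q. Proof. by apply: lt_trans hq. Qed.
Let U := exterior r0.
Let oU : open U. Proof. exact: open_exterior. Qed.
Let om := vorticity v.
Let som : smooth_on U om. Proof. exact: smooth_vorticity hNS. Qed.
Let sv := smooth_vel hNS.

Lemma far_ball4 x y : 0 < `|x| -> ball4 y -> `|x| / 2 <= `|x + (`|x| / 8) *: y| <= 2 * `|x|.
Proof.
move=> x0 /ltW y4.
have h : `|(`|x| / 8) *: y| <= `|x| / 2.
  rewrite normrZ (ger0_norm (_ : 0 <= `|x| / 8)) ?divr_ge0//.
  by rewrite -mulrA ler_pM2l// ler_pdivrMl// (_ : 8 / 2 = 4 :> R)//; field.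
apply/andP; split.
  apply: le_trans (lerB_normD _ _); rewrite lerBrDr.
  by rewrite {3}(splitr `|x|) lerD2l.
rewrite (le_trans (ler_normD _ _))// mulr2n mulrDl mul1r lerD2l (le_trans h)//.
by rewrite ler_pdivrMr// ler_peMr ?(ltW x0)// ler1n.
Qed.

Section Scaled.
Variable x : R * R.
Hypothesis x2 : r0 < `|x| / 2.
Let l := `|x| / 8.

Let x0 : 0 < `|x|.
Proof. by have := lt_trans hr0 x2; rewrite ltr_pdivlMr// mul0r. Qed.
Let l0 : 0 < l. Proof. by rewrite divr_gt0. Qed.

Lemma scaled_in y : ball4 y -> U (x + l *: y).
Proof.
move=> Oy; apply: exterior_norm; apply: lt_le_trans x2 _.
by have /andP[] := far_ball4 x0 Oy.
Qed.

Lemma scaled_smooth f : smooth_on U f -> smooth_on ball4 (fun y => f (x + l *: y)).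
Proof. by move=> sf; exact: smooth_aff oU (@open_ball4 R) sf scaled_in. Qed.

Lemma scaled_D e f y : smooth_on U f -> ball4 y ->
  D e (fun y => f (x + l *: y)) y = l * D e f (x + l *: y).
Proof. by move=> sf Oy; exact: D_aff sf (scaled_in Oy). Qed.

(** The drift in the equation of the vorticity after rescaling by l = |x| / 8. *)
Definition drift e y : R := l * vel v e (x + l *: y).

Lemma smooth_drift e : smooth_on ball4 (drift e).
Proof.
have s1 := scaled_smooth (sv e).
apply: smooth_eq (smooth_lin l 0 (@open_ball4 R) s1 s1); first exact: open_ball4.
by move=> y _; rewrite mul0r addr0.
Qed.

Lemma D_drift e y : ball4 y -> D e (drift e) y = l * (l * D e (vel v e) (x + l *: y)).
Proof.
move=> Oy; have [_ H] := is_deriveZ l (is_derive_aff (smooth_derive e (sv e) (scaled_in Oy))).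
by rewrite [LHS]H.
Qed.

Lemma drift_div y : ball4 y -> D true (drift true) y + D false (drift false) y = 0.
Proof.
move=> Oy; rewrite (D_drift true Oy) (D_drift false Oy) -!mulrDr.
by rewrite (divergence0 hNS (scaled_in Oy)) !mulr0.
Qed.

Lemma scaled_vorticity_eq y : ball4 y -> let u := fun y => om (x + l *: y) in
  lap u y = drift true y * D true u y + drift false y * D false u y.
Proof.
move=> Oy u; rewrite /u (lap_shift (@open_ball4 R) som scaled_in Oy).
rewrite (scaled_D true som Oy) (scaled_D false som Oy) (vorticity_eq hNS (scaled_in Oy)).
rewrite /drift -/om.
move: (vel v true _) (vel v false _) (D true om _) (D false om _) => a b c d; ring.
Qed.

Lemma drift_le V0 e y : 1 <= V0 -> ball4 y ->
  (forall j z, `|x| / 2 <= `|z| -> `|vel v j z| <= V0 * `|z| `^ (1 - 2 / q)) ->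
  1 <= `|x| -> `|drift e y| <= (V0 * `|x| `^ (1 - 1 / q)) ^+ 2.
Proof.
move=> V1 Oy gr x1; rewrite /drift normrM (gtr0_norm l0).
have /andP[z1 z2] := far_ball4 x0 Oy.
have [k1 k2] := two_div_q hq.
have kq0 : 0 <= 1 - 2 / q by rewrite subr_ge0 ltW.
have kq1 : 1 - 2 / q <= 1 by rewrite lerBlDr lerDl ltW.
have V0p : 0 <= V0 by exact: le_trans V1.
have H1 : `|vel v e (x + l *: y)| <= V0 * (2 * `|x| `^ (1 - 2 / q)).
  apply: (le_trans (gr e _ z1)); apply: ler_wpM2l => //.
  apply: le_trans (pow_double_le (ltW x0) kq0 kq1).
  exact: pow_pos_le.
apply: (@le_trans _ _ (l * (V0 * (2 * `|x| `^ (1 - 2 / q))))).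
  by apply: ler_wpM2l => //; exact: ltW.
have E : (`|x| `^ (1 - 1 / q)) ^+ 2 = `|x| * `|x| `^ (1 - 2 / q).
  rewrite -powR_mulrn ?powR_ge0// -powRrM.
  rewrite (_ : (1 - 1 / q) * 2%:R = 1 + (1 - 2 / q)); last by field; rewrite gt_eqF.
  rewrite powRD; last by apply/implyP => _; rewrite gt_eqF.
  by rewrite powRr1// ltW.
rewrite exprMn E (_ : l * _ = (1 / 4) * V0 * (`|x| * `|x| `^ (1 - 2 / q))); last first.
  by rewrite /l; field.
apply: ler_wpM2r; first by rewrite mulr_ge0 ?powR_ge0.
rewrite expr2; apply: ler_wpM2r => //.
by apply: le_trans V1; rewrite ler_pdivrMr// mul1r ler1n.
Qed.

End Scaled.

Let beta := 1 / q + 1 / q ^+ 2.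

Let beta_q : beta * q = 1 + 1 / q.
Proof. by rewrite /beta; field; rewrite gt_eqF. Qed.

Let beta0 : 0 < beta.
Proof. by rewrite addr_gt0 ?divr_gt0 ?exprn_gt0. Qed.

Let inv_q : 1 / q < 1 / 2 /\ 0 < 1 / q.
Proof. by rewrite divr_gt0// !mul1r ltf_pV2 ?posrE. Qed.

Let beta_le : beta <= 2 / q.
Proof.
have [h1 h2] := inv_q.
have -> : beta = 1 / q + 1 / q * (1 / q) by rewrite /beta; field; rewrite gt_eqF.
have -> : 2 / q = 1 / q + 1 / q * 1 by field; rewrite gt_eqF.
rewrite lerD2l ler_pM2l//; apply: (le_trans (ltW h1)).
by rewrite ler_pdivrMr// mul1r ler1n.
Qed.

Let beta1 : beta <= 1.
Proof. by apply: (le_trans beta_le); rewrite ler_pdivrMr// mul1r ltW. Qed.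

Let growth : exists V0 rho1 : R, [/\ 1 <= V0, r0 < rho1, 1 <= rho1 &
  forall j x, rho1 <= `|x| -> `|vel v j x| <= V0 * `|x| `^ (1 - 2 / q)].
Proof.
have [rho r0rho H] := mean_small hq hNS hint ltr01.
have H' x (l : R) : 0 < l -> rho <= `|x| - 2 * l ->
    bint (fun y => grad_norm v (x + l *: y)) <= 5 * l `^ (- (2 / q)).
  by move=> l0 h; have := H x l l0 h; rewrite mulr1.
have [V0 [rho1 [h1 h2 h3 h4]]] := velocity_growth hr0 hq hNS erefl r0rho H'.
by exists V0, rho1; split => //; exact: lt_le_trans h2.
Qed.

(** The q-th power of the vorticity is controlled by that of the gradient; del is kept
    so small that its contribution is of the same order. *)
Lemma mean_W_le x (l del eps : R) : 0 < l -> (forall y, ball2 y -> U (x + l *: y)) -> 0 < del ->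
  bint (fun y => grad_norm v (x + l *: y) `^ q) <= eps -> del `^ (q / 2) <= eps ->
  bint (fun y => (om (x + l *: y) ^+ 2 + del) `^ (q / 2)) <=
    2 `^ (q / 2) * (2 `^ (q / 2) * eps + 4 * eps).
Proof.
move=> l0 OU del0 geps deps.
have p0 : 0 < q / 2 by rewrite divr_gt0.
have com : cont_on ball2 (fun y => om (x + l *: y)).
  by move=> y Oy; apply: cont_aff; apply: (smooth_cont som); exact: OU.
have cW : cont_on ball2 (fun y => (om (x + l *: y) ^+ 2 + del) `^ (q / 2)).
  apply: cont_powR => //; last by ct.
  by move=> y; rewrite addr_ge0 ?sqr_ge0// ltW.
have cg : cont_on ball2 (fun y => grad_norm v (x + l *: y)).
  by move=> y Oy; apply: cont_aff; apply: (cont_grad_norm hNS); exact: OU.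
have cgq : cont_on ball2 (fun y => grad_norm v (x + l *: y) `^ q).
  by apply: cont_powR => // y; exact: grad_norm_ge0.
have A0 : 0 <= 2 `^ (q / 2) :> R by exact: powR_ge0.
have [A AE] : exists A : R, A = 2 `^ (q / 2) by eexists.
rewrite -AE in A0 *.
apply: (@le_trans _ _ (bint (fun y => A * (A * grad_norm v (x + l *: y) `^ q + del `^ (q / 2))))).
  apply: bint_le; [by ct|by ct|move=> y Qy].
  apply: (@le_trans _ _ ((2 * grad_norm v (x + l *: y) ^+ 2 + del) `^ (q / 2))).
    apply: pow_pos_le; [exact: ltW|by rewrite addr_ge0 ?sqr_ge0// ltW|].
    by rewrite lerD2r; exact: vorticity_sqr_le.
  have s0 : 0 <= 2 * grad_norm v (x + l *: y) ^+ 2 by rewrite mulr_ge0 ?sqr_ge0.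
  apply: (le_trans (pow_add_le s0 (ltW del0) (ltW p0))).
  rewrite powRM ?sqr_ge0// sqr_powR (ger0_norm (grad_norm_ge0 v _)) -AE.
  exact: lexx.
rewrite bintZ; last by ct.
apply: ler_wpM2l => //; rewrite bintD; [|by ct|by ct].
rewrite bint_cst bintZ; last by ct.
by apply: lerD; apply: ler_wpM2l.
Qed.

(** drift_sup gives |om|^q <= C lam eps / |x|^2 with lam ~ |x|^(1 - 1/q), and
    1 - 1/q - 2 = - (1 + 1/q) = - beta q.  The arbitrary constant eta comes from
    the smallness eps of the integral over far squares. *)
Lemma vorticity_decay (eta : R) : 0 < eta -> exists rho : R, [/\ r0 < rho, 1 <= rho &
  forall x, rho <= `|x| -> `|om x| <= eta * `|x| `^ (- beta)].
Proof.
move=> eta0.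
have [V0 [rho1 [V1 r0rho1 rho11 gr]]] := growth.
have V0p : 0 < V0 by exact: lt_le_trans V1.
have p1 : 1 < q / 2 by rewrite ltr_pdivlMr// mul1r.
have p0 : 0 < q / 2 by exact: lt_trans p1.
have [C [C0 CE]] : exists C : R, 0 < C /\
    C = 64 * (2 + 36 * (q / 2)) * V0 * (2 `^ (q / 2) * (2 `^ (q / 2) * 64 + 4 * 64)).
  eexists; split; last reflexivity.
  have n64 : (0 : R) < 64 by rewrite ltr0n.
  have n4 : (0 : R) < 4 * 64 by rewrite mulr_gt0// ltr0n.
  have n36 : (0 : R) < 2 + 36 * (q / 2) by apply: addr_gt0 => //; apply: mulr_gt0 => //; rewrite ltr0n.
  have A0 : 0 < 2 `^ (q / 2) :> R by exact: powR_gt0.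
  by apply: mulr_gt0; [apply: mulr_gt0 V0p; exact: mulr_gt0|apply: mulr_gt0 A0 _; apply: addr_gt0 n4; exact: mulr_gt0].
have eps0 : 0 < eta `^ q / C by rewrite divr_gt0 ?powR_gt0.
have [eps [epsE {}eps0]] : exists eps, eps = eta `^ q / C /\ 0 < eps by eexists.
have [rho2 r0rho2 small] := mean_pow_small hq hNS hint eps0.
pose rho := 2 * Num.max rho1 rho2.
have rr1 : rho1 <= rho / 2 by rewrite /rho mulrC mulKf// le_max lexx.
have rr2 : rho2 <= rho / 2 by rewrite /rho mulrC mulKf// le_max lexx orbT.
have r01 : r0 < rho / 2 by exact: lt_le_trans rr1.
have rho0 : 0 < rho by have := lt_trans hr0 r01; rewrite ltr_pdivlMr// mul0r.
have half (t : R) : 0 < t -> t / 2 <= t.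
  by move=> t0; rewrite ler_pdivrMr// ler_peMr ?(ltW t0)// ler1n.
exists rho; split.
- exact: lt_le_trans r01 (half _ rho0).
- exact: le_trans (le_trans rho11 rr1) (half _ rho0).
move=> x rx.
have x0 : 0 < `|x| by exact: lt_le_trans rx.
have hx : rho / 2 <= `|x| / 2 by rewrite ler_pM2r.
have x2 : r0 < `|x| / 2 by exact: lt_le_trans hx.
have x1 : 1 <= `|x| by apply: le_trans rx; exact: le_trans (le_trans rho11 rr1) (half _ rho0).
have l0 : 0 < `|x| / 8 by rewrite divr_gt0.
have gr' j z : `|x| / 2 <= `|z| -> `|vel v j z| <= V0 * `|z| `^ (1 - 2 / q).
  by move=> xz; apply: gr; apply: le_trans xz; exact: le_trans hx.
pose lam := V0 * `|x| `^ (1 - 1 / q).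
have [iq1 iq0] := inv_q.
have lam1 : 1 <= lam.
  rewrite -[1]mulr1; apply: ler_pM => //; apply: pow_ge1 => //.
  by rewrite subr_ge0 (le_trans (ltW iq1))// ler_pdivrMr// mul1r ler1n.
pose del := (eps / `|x| ^+ 2) `^ (q / 2)^-1.
have xx0 : 0 < eps / `|x| ^+ 2 by rewrite divr_gt0 ?exprn_gt0.
have del0 : 0 < del by exact: powR_gt0.
have delE : del `^ (q / 2) = eps / `|x| ^+ 2.
  by rewrite /del -powRrM mulVf ?gt_eqF// powRr1// ltW.
have M : bint (fun y => grad_norm v (x + (`|x| / 8) *: y) `^ q) <= 64 * (eps / `|x| ^+ 2).
  rewrite (_ : 64 * (eps / `|x| ^+ 2) = eps / (`|x| / 8) ^+ 2); last by field; rewrite gt_eqF.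
  apply: small => //; apply: (le_trans rr2); apply: (le_trans hx).
  exact: half_le_sub8.
have D64 : del `^ (q / 2) <= 64 * (eps / `|x| ^+ 2).
  by rewrite delE ler_peMl ?(ltW xx0)// ler1n.
have OU y : ball2 y -> U (x + (`|x| / 8) *: y) by move=> /ball2_sub4; exact: scaled_in.
have W := mean_W_le l0 OU del0 M D64.
have S := drift_sup (scaled_smooth x2 som) (smooth_drift x2) p1 del0 lam1
  (fun y Oy => scaled_vorticity_eq x2 (ball2_sub4 Oy)) (fun y Oy => drift_div x2 (ball2_sub4 Oy))
  (fun e y Qy => drift_le x2 e V1 (ball1_sub4 Qy) gr' x1).
rewrite scaler0 addr0 in S.
have n0 : 0 <= 64 * (2 + 36 * (q / 2)) * lam.
  apply: mulr_ge0; last exact: le_trans lam1.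
  by apply: mulr_ge0; [rewrite ler0n|apply: addr_ge0 => //; apply: mulr_ge0; [rewrite ler0n|exact: ltW]].
have S2 := le_trans S (ler_wpM2l n0 W).
apply: (pow_le_inv q0); first by rewrite mulr_ge0 ?powR_ge0// ltW.
rewrite -sqr_powR.
apply: (@le_trans _ _ ((om x ^+ 2 + del) `^ (q / 2))).
  by apply: pow_pos_le; [exact: ltW|exact: sqr_ge0|rewrite lerDl ltW].
apply: (le_trans S2).
rewrite powRM ?powR_ge0 ?(ltW eta0)// -powRrM mulNr beta_q.
rewrite (_ : eta `^ q = C * eps); last by rewrite epsE mulrC divfK// gt_eqF.
rewrite CE /lam.
have -> : `|x| `^ (- (1 + 1 / q)) = `|x| `^ (1 - 1 / q) / `|x| ^+ 2.
  rewrite -powR_mulrn ?(ltW x0)// -powRN -powRD; last by apply/implyP => _; rewrite gt_eqF.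
  by congr (_ `^ _); rewrite opprD addrAC (_ : 1 - 2%:R = -1 :> R)//; ring.
move: (2 `^ (q / 2)) (`|x| `^ (1 - 1 / q)) (64 * (2 + 36 * (q / 2))) (`|x| ^+ 2)^-1 => A X K Y.
by rewrite le_eqVlt; apply/orP; left; apply/eqP; ring.
Qed.

Lemma scaled_vorticity_le x (eta rho : R) y : 0 < eta -> r0 < rho -> rho <= `|x| / 2 ->
  (forall z, rho <= `|z| -> `|om z| <= eta * `|z| `^ (- beta)) -> ball4 y ->
  `|om (x + (`|x| / 8) *: y)| <= eta * (2 * `|x| `^ (- beta)).
Proof.
move=> eta0 r0rho rx dec Oy.
have x0 : 0 < `|x|.
  by have := lt_le_trans (lt_trans hr0 r0rho) rx; rewrite ltr_pdivlMr// mul0r.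
have /andP[z1 z2] := far_ball4 x0 Oy.
apply: (le_trans (dec _ (le_trans rx z1))); apply: ler_wpM2l; first exact: ltW.
by apply: pow_neg_le => //; [rewrite ler1n|exact: ltW].
Qed.

(** A crude bound is enough: it enters log_gradient only multiplied by the scale
    d, which can be taken very small. *)
Lemma vorticity_gradient_decay : exists2 C : R, 0 < C & forall eta : R, 0 < eta ->
  exists rho : R, [/\ r0 < rho, 1 <= rho & forall e x, rho <= `|x| ->
    `|D e om x| <= C * eta * (`|x| * `|x| `^ (- beta))].
Proof.
have [V0 [rho1 [V1 r0rho1 rho11 gr]]] := growth.
have V0p : 0 < V0 by exact: lt_le_trans V1.
have [K [K0 KE]] : exists K : R, 0 < K /\ K = 64 * 32 / c0 ^+ 2.
  eexists; split; last reflexivity.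
  by apply: divr_gt0; [apply: mulr_gt0; rewrite ltr0n|rewrite exprn_gt0// c0_gt0].
have n16 : (0 : R) < 16 by rewrite ltr0n.
exists (16 * K * V0 ^+ 2); first by rewrite !mulr_gt0 ?exprn_gt0.
move=> eta eta0; have [rho2 [r0rho2 rho21 dec]] := vorticity_decay eta0.
exists (2 * Num.max rho1 rho2).
have m1 : rho1 <= Num.max rho1 rho2 by rewrite le_max lexx.
have m2 : rho2 <= Num.max rho1 rho2 by rewrite le_max lexx orbT.
have mm : 1 <= Num.max rho1 rho2 by exact: le_trans m1.
have mm2 : Num.max rho1 rho2 <= 2 * Num.max rho1 rho2.
  by rewrite ler_peMl ?ler1n// (le_trans ler01).
split; [by apply: lt_le_trans mm2; exact: lt_le_trans m1|exact: le_trans mm2|].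
move=> e x rx.
have hx : Num.max rho1 rho2 <= `|x| / 2 by rewrite ler_pdivlMr// mulrC.
have x2 : r0 < `|x| / 2 by apply: lt_le_trans hx; exact: lt_le_trans m1.
have x1 : 1 <= `|x| by apply: le_trans rx; exact: le_trans mm2.
have x0 : 0 < `|x| by exact: lt_le_trans x1.
have l0 : 0 < `|x| / 8 by rewrite divr_gt0.
have gr' j z : `|x| / 2 <= `|z| -> `|vel v j z| <= V0 * `|z| `^ (1 - 2 / q).
  by move=> xz; apply: gr; apply: le_trans xz; exact: le_trans hx.
have [iq1 iq0] := inv_q.
have eq0 : 0 <= 1 - 1 / q.
  by rewrite subr_ge0 (le_trans (ltW iq1))// ler_pdivrMr// mul1r ler1n.
have X1 := pow_ge1 eq0 x1.
have [lam [lamE lam1]] : exists lam, lam = V0 * `|x| `^ (1 - 1 / q) /\ 1 <= lam.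
  eexists; split; first reflexivity.
  by apply: (le_trans V1); rewrite ler_peMr// ltW.
have blam e' y : ball1 y -> `|drift x e' y| <= lam ^+ 2.
  by move=> Qy; rewrite lamE; exact: (drift_le x2 e' V1 (ball1_sub4 Qy) gr' x1).
have um y : ball1 y -> `|om (x + (`|x| / 8) *: y)| <= eta * (2 * `|x| `^ (- beta)).
  move=> Qy; apply: (scaled_vorticity_le eta0 r0rho2 _ dec (ball1_sub4 Qy)).
  exact: le_trans hx.
have lam2 : 1 <= lam ^+ 2 by rewrite exprn_ege1.
have H := drift_gradient e (scaled_smooth x2 som) lam2 (blam true) (blam false) um
  (fun y Qy => scaled_vorticity_eq x2 (ball1_sub4 Qy)).
have O0 : ball4 (0 : R * R) by rewrite /ball4 /= normr0 ltr0n.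
rewrite (scaled_D x2 e som O0) scaler0 addr0 normrM (gtr0_norm l0) -KE in H.
have lamX : lam ^+ 2 <= V0 ^+ 2 * `|x| ^+ 2.
  rewrite lamE exprMn; apply: ler_wpM2l; first exact: sqr_ge0.
  apply: lerXn2r; rewrite ?nnegrE ?powR_ge0//.
  have le1 : 1 - 1 / q <= 1 by rewrite lerBlDr lerDl ltW.
  by have := ler_powR x1 le1; rewrite powRr1.
have Y0 : 0 <= `|x| `^ (- beta) by exact: powR_ge0.
move: (`|x| `^ (- beta)) Y0 H => Y Y0 H {um dec}.
rewrite -(ler_pM2l l0); apply: (le_trans H).
apply: (@le_trans _ _ (K * (V0 ^+ 2 * `|x| ^+ 2 * (eta * (2 * Y))))).
  apply: ler_wpM2l; first exact: ltW.
  by apply: ler_wpM2r lamX; rewrite mulr_ge0 ?mulr_ge0// ltW.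
rewrite le_eqVlt; apply/orP; left; apply/eqP; by field.
Qed.

(** log_gradient applied to each velocity component, with d = |x|^(-2): this makes
    the term of the crude bound of order |x|^(- beta), and - ln d = 2 ln |x|. *)
Lemma velocity_gradient_decay : exists2 C : R, 0 < C & forall eta : R, 0 < eta ->
  exists rho : R, [/\ r0 < rho, 1 <= rho & forall e j x, rho <= `|x| ->
    `|D e (vel v j) x| <= C * eta * (`|x| `^ (- beta) * ln `|x|)].
Proof.
have [C1 C10 dgrad] := vorticity_gradient_decay.
have n120 : (0 : R) < 120 + 2 * C1.
  by apply: addr_gt0; [rewrite ltr0n|apply: mulr_gt0 C10].
exists ((120 + 2 * C1) / c0); first by apply: divr_gt0 => //; exact: c0_gt0.
move=> eta eta0.
have [rho1 [r0rho1 rho11 dec]] := vorticity_decay eta0.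
have [rho2 [r0rho2 rho21 dec2]] := dgrad eta eta0.
have [rho3 r0rho3 small] := mean_small hq hNS hint eta0.
pose rho := Num.max (Num.max rho1 rho2) (Num.max rho3 (expR 1)).
have [m1 m2 m3 m4] : [/\ rho1 <= rho, rho2 <= rho, rho3 <= rho & expR 1 <= rho].
  by rewrite !le_max !lexx !orbT.
have rho1' : 1 <= rho by exact: le_trans m1.
have rr : rho <= 2 * rho by rewrite ler_peMl ?ler1n// (le_trans ler01).
exists (2 * rho); split; [by apply: lt_le_trans rr; exact: lt_le_trans m1|exact: le_trans rr|].
move=> e j x rx.
have hx : rho <= `|x| / 2 by rewrite ler_pdivlMr// mulrC.
have x2 : r0 < `|x| / 2 by apply: lt_le_trans hx; exact: lt_le_trans m1.
have x1 : 1 <= `|x| by apply: le_trans rx; exact: le_trans rr.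
have x0 : 0 < `|x| by exact: lt_le_trans x1.
have [l lE] : exists l, l = `|x| / 8 by eexists.
have l0 : 0 < l by rewrite lE divr_gt0.
have L1 : 1 <= ln `|x|.
  have xe : expR 1 <= `|x| by apply: le_trans rx; exact: le_trans rr.
  by rewrite -[1]expRK ler_ln ?posrE ?expR_gt0.
have inU y : ball4 y -> U (x + l *: y) by rewrite lE => Oy; exact: scaled_in.
have sw : smooth_on ball4 (fun y => vel v j (x + l *: y)) by rewrite lE; exact: scaled_smooth.
have su : smooth_on ball4 (fun y => om (x + l *: y)) by rewrite lE; exact: scaled_smooth.
have X0 : 0 <= `|x| `^ (- beta) by exact: powR_ge0.
have [X XE] : exists X, X = `|x| `^ (- beta) by eexists.
rewrite -XE in X0 *.
(* lap v_1 = - d2 om and lap v_2 = d1 om. *)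
pose sg : R := if j then -1 else 1.
have sg1 : `|sg| = 1 by rewrite /sg; case: (j); rewrite ?normrN normr1.
pose g y := sg * l * om (x + l *: y).
have sgm : smooth_on ball4 g.
  apply: smooth_eq (smooth_lin (sg * l) 0 (@open_ball4 R) su su); first exact: open_ball4.
  by move=> y _; rewrite mul0r addr0.
have Dg c y : ball4 y -> D c g y = sg * l * (l * D c om (x + l *: y)).
  move=> Oy; have [_ H] := is_deriveZ (sg * l) (is_derive_aff (smooth_derive c som (inU _ Oy))).
  by rewrite [LHS]H.
have lapw y : ball4 y -> lap (fun y => vel v j (x + l *: y)) y = D (~~ j) g y.
  move=> Oy; rewrite (lap_shift (@open_ball4 R) (sv j) inU Oy) Dg// /sg.
  case: (j) => /=.
    by rewrite (lap_velocity1 hNS (inU _ Oy)) mulrN mulN1r mulNr expr2 mulrA.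
  by rewrite (lap_velocity2 hNS (inU _ Oy)) mul1r expr2 mulrA.
have normsg (t : R) : `|sg * l * t| = l * `|t|.
  by rewrite normrM normrM sg1 mul1r (gtr0_norm l0).
have gm y : ball1 y -> `|g y| <= l * (eta * (2 * X)).
  move=> Qy; rewrite /g normsg; apply: ler_wpM2l; first exact: ltW.
  rewrite XE lE; apply: (scaled_vorticity_le eta0 r0rho1 _ dec (ball1_sub4 Qy)).
  exact: le_trans hx.
pose d := (`|x| ^+ 2)^-1.
have xx1 : 1 <= `|x| ^+ 2 by rewrite exprn_ege1.
have d0 : 0 < d by rewrite invr_gt0 exprn_gt0.
have d1 : d <= 1 by rewrite invf_le1// exprn_gt0.
have dM y : `|y| <= d -> `|D (~~ j) g y| <= l * (l * (C1 * eta * (2 * `|x| * (2 * X)))).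
  move=> yd; have Qy : ball1 y by apply/ball1P; exact: le_trans d1.
  have Oy := ball1_sub4 Qy; have /andP[z1 z2] := far_ball4 x0 Oy; rewrite -lE in z1 z2.
  rewrite (Dg _ _ Oy) normsg; apply: ler_wpM2l; first exact: ltW.
  rewrite normrM (gtr0_norm l0); apply: ler_wpM2l; first exact: ltW.
  apply: (le_trans (dec2 _ _ _)); first by apply: le_trans z1; exact: le_trans hx.
  apply: ler_wpM2l; first by apply: mulr_ge0; exact: ltW.
  apply: ler_pM => //; rewrite ?powR_ge0//.
  by rewrite XE; apply: pow_neg_le => //; [rewrite ler1n|exact: ltW].
have main := log_gradient e sw sgm lapw gm d0 d1 dM.
have O0 : ball4 (0 : R * R) by rewrite /ball4 /= normr0 ltr0n.
have De y : ball4 y -> D e (fun y => vel v j (x + l *: y)) y = l * D e (vel v j) (x + l *: y).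
  by move=> Oy; exact: D_aff (sv j) (inU _ Oy).
rewrite (De _ O0) scaler0 addr0 normrM (gtr0_norm l0) in main.
have mean : bint (fun y => `|D e (fun y => vel v j (x + l *: y)) y|) <= l * (40 * eta * X).
  have cD : cont_on ball2 (fun y => D e (fun y => vel v j (x + l *: y)) y).
    exact: cont_sub ball2_sub4 (smooth_cont (smooth_D e sw)).
  have cg : cont_on ball2 (fun y => grad_norm v (x + l *: y)).
    by move=> y /ball2_sub4 Oy; apply: cont_aff; apply: (cont_grad_norm hNS); exact: inU.
  apply: (@le_trans _ _ (bint (fun y => l * grad_norm v (x + l *: y)))).
    apply: bint_le; [by ct|by ct|move=> y Qy].
    rewrite (De _ (ball1_sub4 Qy)) normrM (gtr0_norm l0); apply: ler_wpM2l; first exact: ltW.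
    exact: D_le_grad_norm.
  rewrite bintZ; last by ct.
  apply: ler_wpM2l; first exact: ltW.
  apply: (le_trans (small x l l0 _)).
    by rewrite lE; apply: (le_trans m3); apply: (le_trans hx); exact: half_le_sub8.
  have [k1 k2] := two_div_q hq.
  have lX : l `^ (- (2 / q)) <= 8 * X.
    have e8 : (1 : R) <= 8 by rewrite ler1n.
    apply: (le_trans (pow_neg_le e8 (ltW k1) (ltW k2) x0 (_ : `|x| / 8 <= l))); first by rewrite lE.
    apply: ler_wpM2l; first by rewrite ler0n.
    rewrite XE; have nb : - (2 / q) <= - beta by rewrite lerN2.
    exact: (ler_powR x1 nb).
  have e5 : 0 <= 5 * eta by apply: mulr_ge0; [rewrite ler0n|exact: ltW].
  apply: (le_trans (ler_wpM2l e5 lX)).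
  by rewrite le_eqVlt; apply/orP; left; apply/eqP; ring.
have lnd : - ln d = 2 * ln `|x|.
  by rewrite /d lnV ?posrE ?exprn_gt0// opprK lnXn// mulr_natl.
rewrite lnd in main.
rewrite -(ler_pM2l (@c0_gt0 R)) -(ler_pM2l l0).
rewrite mulrCA; apply: (le_trans main).
rewrite (_ : 4 * _ * d = l * (2 * C1 * eta * X)); last first.
  by rewrite /d lE; field; rewrite gt_eqF.
rewrite (_ : 20 * (l * (eta * (2 * X))) * (2 * ln `|x|) = l * (80 * eta * X * ln `|x|)); last by ring.
apply: (@le_trans _ _ (l * (40 * eta * X) + l * (2 * C1 * eta * X) + l * (80 * eta * X * ln `|x|))).
  by rewrite !lerD2r.
rewrite -!mulrDr; apply: ler_wpM2l; first exact: ltW.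
rewrite (_ : c0 * _ = (120 + 2 * C1) * (eta * X * ln `|x|)); last first.
  by field; rewrite gt_eqF// c0_gt0.
have eX : 0 <= eta * X by rewrite mulr_ge0// ltW.
exact: final_arith (ltW C10) eX L1.
Qed.

End Decay.

(** * Polar coordinates and the theorem *)

Section Polar.
Context {R : realType}.

Lemma enorm_polar (r t : R) : 0 <= r -> enorm (r * cos t, r * sin t) = r.
Proof.
move=> r0; rewrite /enorm /= !exprMn -mulrDr cos2Dsin2 mulr1.
by rewrite sqrtr_sqr ger0_norm.
Qed.

Lemma norm_polar (r t : R) : 0 <= r ->
  r / 2 <= `|(r * cos t, r * sin t)| <= r.
Proof.
move=> r0; have E := enorm_polar t r0; apply/andP; split.
  by rewrite ler_pdivrMr// mulrC -{1}E enorm_le_norm.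
by apply: le_trans (norm_le_enorm _) _; rewrite E.
Qed.

(** Decay estimates are proved with the sup norm and a constant; between r / 2 and r
    the power changes by a factor at most 2 as the exponent is at most 1, and
    eta = eps / (2 C) absorbs all constants. *)
Lemma littleo_polar (F : R * R -> R) (a : R) (g : R -> R) : 0 <= a -> a <= 1 ->
  {in >= 1 &, {homo g : s t / s <= t}} -> (forall s, 1 <= s -> 0 <= g s) ->
  (exists2 C : R, 0 < C & forall eta : R, 0 < eta -> exists rho : R, 1 <= rho /\
     forall x, rho <= `|x| -> `|F x| <= C * eta * (`|x| `^ (- a) * g `|x|)) ->
  littleo_unif (polar F) (fun r => r `^ (- a) * g r).
Proof.
move=> a0 a1 gm g0 [C C0 H] eps eps0.
have [|rho [rho1 {}H]] := H (eps / (2 * C)); first by rewrite divr_gt0// mulr_gt0.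
near=> r => t _; rewrite /polar.
have rr : 2 * rho <= r by near: r; apply: nbhs_pinfty_ge; exact: num_real.
have rho0 : 0 < rho by exact: lt_le_trans rho1.
have r0 : 0 < r by apply: lt_le_trans rr; rewrite mulr_gt0.
have /andP[n1 n2] := norm_polar t (ltW r0).
have nrho : rho <= `|(r * cos t, r * sin t)|.
  by apply: le_trans n1; rewrite ler_pdivlMr// mulrC.
have nx1 := le_trans rho1 nrho.
have r1 : 1 <= r by exact: le_trans n2.
apply: (le_trans (H _ nrho)).
have gn : g `|(r * cos t, r * sin t)| <= g r by apply: gm.
have pn : `|(r * cos t, r * sin t)| `^ (- a) <= 2 * r `^ (- a).
  by apply: pow_neg_le => //; rewrite ler1n.
rewrite (ger0_norm (mulr_ge0 (powR_ge0 _ _) (g0 _ r1))).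
apply: (@le_trans _ _ (C * (eps / (2 * C)) * (2 * r `^ (- a) * g r))).
  apply: ler_wpM2l; first by rewrite mulr_ge0 ?divr_ge0 ?mulr_ge0// ltW.
  by apply: ler_pM => //; rewrite ?powR_ge0 ?g0.
rewrite le_eqVlt; apply/orP; left; apply/eqP; field; by rewrite gt_eqF.
Unshelve. all: by end_near. Qed.

End Polar.

Lemma decay_exponent (R : realType) (q : R) : 2 < q ->
  0 <= 1 / q + 1 / q ^+ 2 <= 1.
Proof.
move=> q2; have q0 : 0 < q by exact: lt_trans q2.
rewrite addr_ge0 ?divr_ge0 ?exprn_ge0 ?(ltW q0)//=.
have h1 : 1 / q <= 1 / 2 by rewrite !mul1r lef_pV2 ?posrE// ltW.
have q1 : 1 <= q by apply: le_trans (ltW q2); rewrite ler1n.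
have h2 : 1 / q ^+ 2 <= 1 / q.
  by rewrite !mul1r lef_pV2 ?posrE ?exprn_gt0// expr2 ler_peMr// ltW.
by apply: (le_trans (lerD h1 (le_trans h2 h1))); rewrite -splitr.
Qed.

Unset Implicit Arguments.

Theorem theorem1p1 (R : realType) (r0 q : R) (v : R * R -> R * R)
    (p : R * R -> R) (hr0 : 0 < r0) (hq : 2 < q)
    (hNS : smooth_stationary_NS (exterior r0) v p)
    (hint : (\int[@lebesgue_measure R \x @lebesgue_measure R]_(x in exterior r0)
               ((grad_norm v x) `^ q)%:E < +oo)%E) :
  littleo_unif (polar (vorticity v)) (fun r => r `^ (- (1 / q + 1 / q ^+ 2))) /\
  littleo_unif (polar (grad_norm v))
    (fun r => r `^ (- (1 / q + 1 / q ^+ 2)) * ln r).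
Proof.
have /andP[b0 b1] := decay_exponent hq; split.
  rewrite [X in littleo_unif _ X](_ : _ = fun r => r `^ (- (1 / q + 1 / q ^+ 2)) * 1); last first.
    by apply/funext => r; rewrite mulr1.
  apply: (@littleo_polar _ _ _ (fun=> 1)) => //; exists 1 => // eta eta0.
  have [rho [_ rho1 H]] := vorticity_decay hr0 hq hNS hint eta0.
  by exists rho; split=> // x rx; rewrite mul1r mulr1; exact: H.
apply: littleo_polar => //.
- by move=> s t s1 t1; rewrite ler_ln// posrE (lt_le_trans _ (_ : 1 <= _)).
- by move=> s; exact: ln_ge0.
have [C C0 H] := velocity_gradient_decay hr0 hq hNS hint.
exists (2 * C) => [|eta eta0]; first exact: mulr_gt0.
have [rho [_ rho1 {}H]] := H eta eta0; exists rho; split=> // x rx.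
rewrite ger0_norm ?grad_norm_ge0// -2!(mulrA 2).
by apply: grad_norm_le => e j; exact: H.
Qed.
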